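(* Let $\mathfrak g=B^{(1)}_n$ with $n\ge3$ (resp. $\mathfrak g=D^{(1)}_n$ with $n\ge4$), let $l,k\in\mathbb Z_{\ge1}$, and let $B_l,B_k$ be the $U_q'(\mathfrak g)$ crystals defined in the context. Given $b_1\otimes b_2\in B_l\otimes B_k$, let $b_2'\otimes b_1'\in B_k\otimes B_l$ and $l',k',m\in\mathbb Z_{\ge0}$ be obtained by the Rule in the context with type $B$ (resp. type $D$) column insertion. Let $\iota:B_l\otimes B_k\to B_k\otimes B_l$ be the isomorphism of $U_q'(\mathfrak g)$ crystals and $H_{B_lB_k}$ the energy function on $B_l\otimes B_k$, normalized as in the context. Then $$\iota(b_1\otimes b_2)=b_2'\otimes b_1',\qquad H_{B_lB_k}(b_1\otimes b_2)=2\min(l',k')-m .$$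
   Context: **Crystals.** A crystal with index set $I=\{0,1,\dots,n\}$ is a finite set $B$ with maps $\tilde e_i,\tilde f_i:B\sqcup\{0\}\to B\sqcup\{0\}$ ($i\in I$), $\tilde e_i0=\tilde f_i0=0$, such that for $b,b'\in B$, $\tilde f_ib=b'$ iff $\tilde e_ib'=b$. Put $\varepsilon_i(b)=\max\{m\ge0:\tilde e_i^m b\ne0\}$, $\varphi_i(b)=\max\{m\ge0:\tilde f_i^m b\neq0\}$. The crystal $B\otimes B'$ is the set $B\times B'$ with $\tilde e_i(b\otimes b')=\tilde e_ib\otimes b'$ if $\varphi_i(b)\ge\varepsilon_i(b')$ and $b\otimes\tilde e_ib'$ otherwise; $\tilde f_i(b\otimes b')=\tilde f_ib\otimes b'$ if $\varphi_i(b)>\varepsilon_i(b')$ and $b\otimes\tilde f_ib'$ otherwise ($0\otimes b'=b\otimes0=0$). An isomorphism of crystals is a bijection commuting with all $\tilde e_i,\tilde f_i$, $i\in I$. For the crystals below it is known that $B_l\otimes B_k$ is connected and that there is a unique isomorphism $\iota:B_l\otimes B_k\to B_k\otimes B_l$. **Energy function.** $H=H_{B_lB_k}:B_l\otimes B_k\to\mathbb Z$ is determined up to a global additive constant by: whenever $\tilde e_i(b\otimes b')\ne0$, writing $\iota(b\otimes b')=\tilde b'\otimes\tilde b$, $H(\tilde e_i(b\otimes b'))-H(b\otimes b')$ equals $+1$ if $i=0$, $\varphi_0(b)\ge\varepsilon_0(b')$ and $\varphi_0(\tilde b')\ge\varepsilon_0(\tilde b)$; equals $-1$ if $i=0$,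 $\varphi_0(b)<\varepsilon_0(b')$ and $\varphi_0(\tilde b')<\varepsilon_0(\tilde b)$; equals $0$ otherwise. Normalization: $H(b_1\otimes b_2)=0$ when $b_1$ has $x_1=l$ and all other coordinates $0$, and $b_2$ has $\bar x_1=k$ and all other coordinates $0$. **The crystals.** In all formulas only changed coordinates are indicated, and the result is $0$ if it is not in the set. $B^{(1)}_n$: $B_l=\{(x_1,\dots,x_n,x_\circ,\bar x_n,\dots,\bar x_1):x_\circ\in\{0,1\},\ x_i,\bar x_i\in\mathbb Z_{\ge0},\ x_\circ+\sum_i(x_i+\bar x_i)=l\}$. $\tilde e_0$: $(x_2,\bar x_1)\mapsto(x_2-1,\bar x_1+1)$ if $x_2>\bar x_2$; $(x_1,\bar x_2)\mapsto(x_1-1,\bar x_2+1)$ if $x_2\le\bar x_2$. $\tilde f_0$: $(x_2,\bar x_1)\mapsto(x_2+1,\bar x_1-1)$ if $x_2\ge\bar x_2$; $(x_1,\bar x_2)\mapsto(x_1+1,\bar x_2-1)$ if $x_2<\bar x_2$. For $1\le i\le n-1$, $\tilde e_i$: $(x_i,x_{i+1})\mapsto(x_i+1,x_{i+1}-1)$ if $x_{i+1}>\bar x_{i+1}$; $(\bar x_{i+1},\bar x_i)\mapsto(\bar x_{i+1}+1,\bar x_i-1)$ if $x_{i+1}\le\bar x_{i+1}$. $\tilde f_i$: $(x_i,x_{i+1})\mapsto(x_i-1,x_{i+1}+1)$ if $x_{i+1}\ge\bar x_{i+1}$; $(\bar x_{i+1},\bar x_i)\mapsto(\bar x_{i+1}-1,\bar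 x_i+1)$ if $x_{i+1}<\bar x_{i+1}$. $\tilde e_n$: $(x_\circ,\bar x_n)\mapsto(1,\bar x_n-1)$ if $x_\circ=0$; $(x_n,x_\circ)\mapsto(x_n+1,0)$ if $x_\circ=1$. $\tilde f_n$: $(x_n,x_\circ)\mapsto(x_n-1,1)$ if $x_\circ=0$; $(x_\circ,\bar x_n)\mapsto(0,\bar x_n+1)$ if $x_\circ=1$. $D^{(1)}_n$: $B_l=\{(x_1,\dots,x_n,\bar x_n,\dots,\bar x_1):x_n=0\text{ or }\bar x_n=0,\ x_i,\bar x_i\in\mathbb Z_{\ge0},\ \sum_i(x_i+\bar x_i)=l\}$, with $\tilde e_i,\tilde f_i$ for $0\le i\le n-1$ given by the same formulas as for $B^{(1)}_n$, and $\tilde e_n$: $(x_{n-1},\bar x_n)\mapsto(x_{n-1}+1,\bar x_n-1)$ if $\bar x_n>0$; $(x_n,\bar x_{n-1})\mapsto(x_n+1,\bar x_{n-1}-1)$ if $\bar x_n=0$. $\tilde f_n$: $(x_n,\bar x_{n-1})\mapsto(x_n-1,\bar x_{n-1}+1)$ if $x_n>0$; $(x_{n-1},\bar x_n)\mapsto(x_{n-1}-1,\bar x_n+1)$ if $x_n=0$. **Tableaux.** Letters in type $B$: $1<2<\dots<n<\circ<\bar n<\dots<\bar2<\bar1$. Letters in type $D$: $1,\dots,n,\bar n,\dots,\bar1$ with the partial order $1<\dots<n-1<n<\overline{n-1}<\dots<\bar1$ and $n-1<\bar n<\overline{n-1}$, where $n$ and $\bar n$ are incomparable. For $b\in B_l$,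 $\mathcal T(b)$ is the one-row tableau of length $l$, weakly increasing from left to right, with $x_i$ letters $i$, $\bar x_i$ letters $\bar i$ (and $x_\circ$ letters $\circ$ in type $B$). **Column insertion.** Write $(a)$ for a one-box column and $(a|b)$ for a column with top entry $a$, bottom entry $b$. ''$c\to K\Rightarrow K';\,d$'' means: inserting letter $c$ in column $K$ turns it into $K'$ and bumps out $d$, which is then inserted into the next column on the right. $\alpha,\beta,\gamma$ denote arbitrary letters, $x\in\{1,\dots,n\}$; ''$(\alpha,\gamma)\ne(x,\bar x)$'' means for all $x$. Type $B$: A0: $\alpha\to\emptyset\Rightarrow(\alpha)$ (stop). A1: $\beta\to(\alpha)\Rightarrow(\alpha|\beta)$ (stop) if $\alpha<\beta$ or $(\alpha,\beta)=(\circ,\circ)$. B0: $\alpha\to(\beta)\Rightarrow(\alpha);\beta$ if $\alpha\le\beta$ and $(\alpha,\beta)\ne(\circ,\circ)$. B1: $\beta\to(\alpha|\gamma)\Rightarrow(\alpha|\beta);\gamma$ if $\alpha<\beta\le\gamma$, $(\alpha,\gamma)\ne(x,\bar x)$, $(\beta,\gamma)\ne(\circ,\circ)$. B2: $\alpha\to(\beta|\gamma)\Rightarrow(\alpha|\gamma);\beta$ if $\alpha\le\beta<\gamma$, $(\alpha,\gamma)\ne(x,\bar x)$, $(\alpha,\beta)\ne(\circ,\circ)$. B3: $\circ\to(\circ|\bar x)\Rightarrow(\circ|\circ);\bar x$. B4: $x\to(\circ|\circ)\Rightarrow(x|\circ);\circ$. B5: $\beta\to(x|\bar x)\Rightarrow(x-1|\beta);\overline{x-1}$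 if $x\le\beta\le\bar x$, $x\ne1$. B6: $x\to(\beta|\bar x)\Rightarrow(x+1|\overline{x+1});\beta$ if $x<\beta<\bar x$, $x\ne n$. B7: $n\to(\circ|\bar n)\Rightarrow(n|\circ);\bar n$. Type $D$: A0: $\alpha\to\emptyset\Rightarrow(\alpha)$ (stop). A1: $\beta\to(\alpha)\Rightarrow(\alpha|\beta)$ (stop) if $\alpha<\beta$ or $(\alpha,\beta)\in\{(n,\bar n),(\bar n,n)\}$. B0: $\alpha\to(\beta)\Rightarrow(\alpha);\beta$ if $\alpha\le\beta$. B1: $\beta\to(\alpha|\gamma)\Rightarrow(\alpha|\beta);\gamma$ if $\alpha<\beta\le\gamma$, $(\alpha,\gamma)\ne(x,\bar x)$. B2: $\alpha\to(\beta|\gamma)\Rightarrow(\alpha|\gamma);\beta$ if $\alpha\le\beta<\gamma$, $(\alpha,\gamma)\ne(x,\bar x)$. B3: $\beta\to(x|\bar x)\Rightarrow(x-1|\beta);\overline{x-1}$ if $x\le\beta\le\bar x$, $x\ne n,1$. B4: $x\to(\beta|\bar x)\Rightarrow(x+1|\overline{x+1});\beta$ if $x<\beta<\bar x$, $x\ne n-1,n$. B5: $x\to(\mu_1|\mu_2)\Rightarrow(x|\mu_2);\mu_1$ if $\{\mu_1,\mu_2\}=\{n,\bar n\}$, $x\ne n$. B6: $\mu_2\to(\mu_1|\bar x)\Rightarrow(\mu_1|\mu_2);\bar x$ if $\{\mu_1,\mu_2\}=\{n,\bar n\}$, $\bar x\ne\bar n$. B7: $n-1\to(\mu|\overline{n-1})\Rightarrow(\mu|\bar\mu);\mu$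 if $\mu\in\{n,\bar n\}$ (with $\bar\mu=n$ if $\mu=\bar n$). B8: $\mu_2\to(\mu_1|\mu_2)\Rightarrow(n-1|\mu_2);\overline{n-1}$ if $\{\mu_1,\mu_2\}=\{n,\bar n\}$. To insert a letter into a tableau $T$ (written $c\longrightarrow T$), insert it in the leftmost column and continue to the right until A0 or A1 occurs. **Inverse column insertion.** It starts at the rightmost box of a row: this box is removed and its letter is inversely inserted into the column to its left, which changes and expels a letter to be inversely inserted into the next column to the left, and so on; the letter expelled from the leftmost column is the letter bumped out of the tableau (if the removed box is in the leftmost column, its letter is itself bumped out). The elementary inverse steps are the cases B0, B1, … of the relevant type read backwards: inversely inserting $d$ into $K'$ gives $K$ and expels $c$ whenever $c\to K\Rightarrow K';d$ is an instance of one of these cases. **Rule.** Let $z=\min(\#\text{ letters }1\text{ in }\mathcal T(b_1),\ \#\text{ letters }\bar1\text{ in }\mathcal T(b_2))$. Remove $z$ letters $1$ from $\mathcal T(b_1)$ to get a one-row tableau $T_*$ of length $l'=l-z$, and remove $z$ letters $\bar1$ from $\mathcal T(b_2)$ to get the row $v_1\cdots v_{k'}$ (left to right), $k'=k-z$. Let $T^{(0)}=(v_1\longrightarrow(\cdots(v_{k'-1}\longrightarrow(v_{k'}\longrightarrow T_* ))\cdots))$. Only the listed cases occur, and $T^{(0)}$ has at most two rows; let $m$ be the length of its second row, so its first row has length $l'+k'-m$. Now perform $l'$ successive inverse column insertions: the first $l'-m$ start at the current rightmost box of the first row, the last $m$ start at the current rightmost box of the second row. Let $w_1,\dots,w_{l'}$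 be the letters successively bumped out and $T^{(l')}$ the remaining one-row tableau of length $k'$. Then $b_2'\in B_k$ and $b_1'\in B_l$ are the elements such that $\mathcal T(b_2')$ consists of $z$ letters $1$ followed by $T^{(l')}$, and $\mathcal T(b_1')$ consists of $w_1,\dots,w_{l'}$ followed by $z$ letters $\bar1$. *)

(* Defs.v *)
From HB Require Import structures.
From mathcomp Require Import all_boot all_order all_algebra zify.

Set Implicit Arguments.
Unset Strict Implicit.
Unset Printing Implicit Defensive.

(* The number max {m | g^m b <> 0}, where 0 is [None].  The bound [#|T|] on m
   is harmless when g has no infinite string, which [crystal] requires. *)
Definition string_length (T : finType) (g : T -> option T) (b : T) : nat :=
  \max_(m < #|T| | iter m (obind g) (Some b) != None) m.

(* The element 0 is [None], so that e_i 0 = f_i 0 = 0 is built in.  [cr_nil]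
   says that every e_i-string is finite, i.e. that the maxima defining epsilon
   and phi exist: a finite string has at most [#|B|] elements. *)
Record crystal (n : nat) := Crystal {
  cr_elt :> finType;
  cr_e : 'I_n.+1 -> cr_elt -> option cr_elt;
  cr_f : 'I_n.+1 -> cr_elt -> option cr_elt;
  cr_fe : forall i b b', cr_f i b = Some b' <-> cr_e i b' = Some b;
  cr_nil : forall i b, iter #|cr_elt| (obind (cr_e i)) (Some b) = None
}.
Arguments cr_e {n c} i b.
Arguments cr_f {n c} i b.

Definition eps (n : nat) (B : crystal n) (i : 'I_n.+1) (b : B) : nat :=
  string_length (cr_e i) b.
Definition phi (n : nat) (B : crystal n) (i : 'I_n.+1) (b : B) : nat :=
  string_length (cr_f i) b.

Section StringLength.
Variable T : finType.
Implicit Types (g h : T -> option T) (b c : T).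

Lemma iter_obind_None g m : iter m (obind g) None = None.
Proof. by elim: m => //= m ->. Qed.

Lemma iter_measure g (s : T -> nat) b c m :
  (forall b c, g b = Some c -> s b < s c) ->
  iter m (obind g) (Some b) = Some c -> s b + m <= s c.
Proof.
move=> gs; elim: m c => [|m IH] c /=; first by case=> ->; rewrite addn0.
case E: (iter m _ _) => [a|] //= /gs; have := IH _ E; lia.
Qed.

Lemma iter_nil_incr g (s : T -> nat) b :
  (forall b c, g b = Some c -> s b < s c) ->
  iter #|T| (obind g) (Some b) = None.
Proof.
move=> gs; case E: (iter _ _ _) => [c|] //; exfalso.
pose k (j : 'I_#|T|.+1) := odflt b (iter j (obind g) (Some b)).
have kE (j : 'I_#|T|.+1) : iter j (obind g) (Some b) = Some (k j).
  rewrite /k; case F: (iter j _ _) => [a|] //.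
  have: iter (#|T| - j) (obind g) (iter j (obind g) (Some b)) = Some c.
    by rewrite -iterD subnK // -ltnS.
  by rewrite F iter_obind_None.
have lt_k (i j : 'I_#|T|.+1) : i < j -> s (k i) < s (k j).
  move=> ij; have := kE j; rewrite -(subnK (ltnW ij)) iterD kE.
  move=> /(iter_measure gs); lia.
have kI : injective k.
  move=> i j eq_k; apply/val_inj/eqP; case: ltngtP => // /lt_k;
  by rewrite eq_k ltnn.
by have := leq_card k kI; rewrite card_ord ltnn.
Qed.

Lemma iter_nil_decr g (s : T -> nat) b :
  (forall b c, g b = Some c -> s c < s b) ->
  iter #|T| (obind g) (Some b) = None.
Proof.
move=> gs; apply: (@iter_nil_incr g (fun x => \max_y s y - s x)) => a c /gs.
have := @leq_bigmax T s a; lia.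
Qed.

Lemma string_lengthP g b m : iter #|T| (obind g) (Some b) = None ->
  (iter m (obind g) (Some b) != None) = (m <= string_length g b).
Proof.
move=> gnil.
have mono i j : i <= j -> iter j (obind g) (Some b) != None ->
    iter i (obind g) (Some b) != None.
  move=> ij; apply: contraNneq => E.
  by rewrite -(subnK ij) iterD E iter_obind_None.
apply/idP/idP => [nz|].
  have lt_m : m < #|T|.
    by rewrite ltnNge; apply/negP => /mono/(_ nz); rewrite gnil.
  exact: (leq_bigmax_cond (Ordinal lt_m)).
move=> le_m; apply: mono le_m _.
rewrite /string_length.
have T0 : 0 < #|T| by apply/card_gt0P; exists b.
by case: (@eq_bigmax_cond _ [pred m : 'I_#|T| |
  iter m (obind g) (Some b) != None] (fun m => m)) => [|j /= Pj ->] //;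
  apply/card_gt0P; exists (Ordinal T0).
Qed.

Lemma string_length_next g b c :
  (forall b, iter #|T| (obind g) (Some b) = None) ->
  g b = Some c -> string_length g b = (string_length g c).+1.
Proof.
move=> gnil gb.
have E m : (m < string_length g b) = (m <= string_length g c).
  by rewrite -!string_lengthP // iterSr /= gb.
by have := E (string_length g c); have := E (string_length g c).+1; lia.
Qed.

Lemma iter_inv g h m b c : (forall b c, h b = Some c <-> g c = Some b) ->
  iter m (obind h) (Some b) = Some c <-> iter m (obind g) (Some c) = Some b.
Proof.
move=> hg; elim: m b c => [|m IH] b c /=; first by split=> -[->].
rewrite -iterS iterSr /=; split.
  case E: (h b) => [a|]; last by rewrite iter_obind_None.
  by move=> /IH ->; apply/hg.
case E: (iter m _ _) => [a|] //= /hg ->; exact/IH.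
Qed.

Lemma string_length_prev g h b c : (forall b c, h b = Some c <-> g c = Some b) ->
  (forall b, iter #|T| (obind g) (Some b) = None) ->
  g c = Some b -> string_length h b = (string_length h c).+1.
Proof.
move=> hg gnil /hg; apply: string_length_next => a.
by case E: (iter _ _ _) => [d|] //; move/(iter_inv _ _ _ hg): E; rewrite gnil.
Qed.

End StringLength.

Section CrystalStrings.
Variables (n : nat) (B : crystal n).
Implicit Types (b c : B) (i : 'I_n.+1).

Lemma eps_e i b c : cr_e i b = Some c -> eps i b = (eps i c).+1.
Proof. exact/string_length_next/cr_nil. Qed.

Lemma phi_e i b c : cr_e i b = Some c -> phi i c = (phi i b).+1.
Proof. by apply: string_length_prev; [exact: cr_fe | exact: cr_nil]. Qed.

End CrystalStrings.

Section Tensor.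
Variables (n : nat) (B B' : crystal n).
Local Notation BB' := (B * B')%type.

Definition tensor_e (i : 'I_n.+1) (p : BB') : option BB' :=
  if eps i p.2 <= phi i p.1 then omap (fun b => (b, p.2)) (cr_e i p.1)
  else omap (fun b' => (p.1, b')) (cr_e i p.2).

Definition tensor_f (i : 'I_n.+1) (p : BB') : option BB' :=
  if eps i p.2 < phi i p.1 then omap (fun b => (b, p.2)) (cr_f i p.1)
  else omap (fun b' => (p.1, b')) (cr_f i p.2).

Lemma tensor_fe i p q : tensor_f i p = Some q <-> tensor_e i q = Some p.
Proof.
case: p q => [b b'] [c c']; rewrite /tensor_f /tensor_e /=; split.
  case: ifP => lt_b.
    case E: (cr_f i b) => [a|] //= [<- <-]; move/cr_fe: E => E.
    have := phi_e E => Eb; rewrite E /= ifT //; lia.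
  case E: (cr_f i b') => [a|] //= [<- <-]; move/cr_fe: E => E.
  have := eps_e E => Eb; rewrite E /= ifF //; lia.
case: ifP => lt_b.
  case E: (cr_e i c) => [a|] //= [<- <-].
  have := phi_e E => Eb; move/cr_fe: E => ->; rewrite /= ifT //; lia.
case E: (cr_e i c') => [a|] //= [<- <-].
have := eps_e E => Eb; move/cr_fe: E => ->; rewrite /= ifF //; lia.
Qed.

Lemma tensor_nil i p : iter #|{: BB'}| (obind (tensor_e i)) (Some p) = None.
Proof.
apply: (@iter_nil_decr _ _ (fun q => eps i q.1 + eps i q.2)) => {p} q r.
rewrite /tensor_e; case: ifP => _.
  by case E: (cr_e i q.1) => [a|] //= [<-] /=; rewrite (eps_e E) addSn.
by case E: (cr_e i q.2) => [a|] //= [<-] /=; rewrite (eps_e E) addnS.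
Qed.

Definition tensor : crystal n := Crystal tensor_fe tensor_nil.

End Tensor.

Notation "B '\tens' B'" := (tensor B B') (at level 40, left associativity).

Definition crystal_iso (n : nat) (B B' : crystal n) (g : B -> B') : Prop :=
  [/\ bijective g,
      forall i b, cr_e i (g b) = omap g (cr_e i b) &
      forall i b, cr_f i (g b) = omap g (cr_f i b)].

Section Energy.
Variables (n : nat) (B B' : crystal n).

(* The conditions hold for e_0 acting on the left factor both in B (x) B' and
   in B' (x) B, resp. on the right factor in both. *)
Definition energy_step (iota : B \tens B' -> B' \tens B) (i : 'I_n.+1)
    (p : B \tens B') : int :=
  let q := iota p in
  if [&& i == ord0, eps ord0 p.2 <= phi ord0 p.1
       & eps ord0 q.2 <= phi ord0 q.1] then 1%R
  else if [&& i == ord0, phi ord0 p.1 < eps ord0 p.2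
            & phi ord0 q.1 < eps ord0 q.2] then (-1)%R
  else 0%R.

Definition energy_function (iota : B \tens B' -> B' \tens B)
    (H : B \tens B' -> int) : Prop :=
  forall i (p p' : B \tens B'), cr_e i p = Some p' ->
    (H p' - H p)%R = energy_step iota i p.

End Energy.

Variant affine_type := typeB | typeD.

Definition min_rank (X : affine_type) : nat :=
  match X with typeB => 3 | typeD => 4 end.

(* x, o and x-bar *)
Variant letter := Pos of nat | Circ | Bar of nat.

Definition letter_sum (c : letter) : nat + (unit + nat) :=
  match c with Pos i => inl i | Circ => inr (inl tt) | Bar i => inr (inr i) end.
Definition sum_letter (s : nat + (unit + nat)) : letter :=
  match s with inl i => Pos i | inr (inl _) => Circ | inr (inr i) => Bar i end.
Lemma letter_sumK : cancel letter_sum sum_letter. Proof. by case. Qed.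
HB.instance Definition _ := Countable.copy letter (can_type letter_sumK).

Lemma eq_Pos i j : (Pos i == Pos j) = (i == j).
Proof. by apply/eqP/eqP => [[]|->]. Qed.
Lemma eq_Bar i j : (Bar i == Bar j) = (i == j).
Proof. by apply/eqP/eqP => [[]|->]. Qed.
Lemma eq_Pos_Bar i j : (Pos i == Bar j) = false. Proof. exact/eqP. Qed.
Lemma eq_Bar_Pos i j : (Bar i == Pos j) = false. Proof. exact/eqP. Qed.
Lemma eq_Pos_Circ i : (Pos i == Circ) = false. Proof. exact/eqP. Qed.
Lemma eq_Circ_Pos i : (Circ == Pos i) = false. Proof. exact/eqP. Qed.
Lemma eq_Bar_Circ i : (Bar i == Circ) = false. Proof. exact/eqP. Qed.
Lemma eq_Circ_Bar i : (Circ == Bar i) = false. Proof. exact/eqP. Qed.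
Definition eq_letterE := (eq_Pos, eq_Bar, eq_Pos_Bar, eq_Bar_Pos, eq_Pos_Circ,
  eq_Circ_Pos, eq_Bar_Circ, eq_Circ_Bar).

Section Alphabet.
Variables (X : affine_type) (n : nat).

(* 1, ..., n, (o,) n-bar, ..., 1-bar: also the order of the coordinates *)
Definition alphabet : seq letter :=
  [seq Pos i | i <- iota 1 n] ++
  match X with typeB => [:: Circ] | typeD => [::] end ++
  [seq Bar i | i <- rev (iota 1 n)].

(* In type D the enumeration [alphabet] is a linear extension of the partial
   order, in which only n and n-bar are incomparable. *)
Definition llt (a b : letter) : bool :=
  [&& index a alphabet < index b alphabet, b \in alphabet &
      match X with
      | typeB => true
      | typeD => ~~ ((a == Pos n) && (b == Bar n))
      end].
Definition lle (a b : letter) : bool :=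
  (a \in alphabet) && ((a == b) || llt a b).

Lemma alphabet_uniq : uniq alphabet.
Proof.
rewrite /alphabet cat_uniq map_inj_uniq ?iota_uniq /=; last by move=> ? ? [].
rewrite cat_uniq map_inj_uniq ?rev_uniq ?iota_uniq; last by move=> ? ? [].
rewrite andbT; apply/and3P; split.
- apply/hasPn => c; rewrite mem_cat => /orP[|/mapP[j _ ->]].
    by case: X => //; rewrite inE => /eqP ->; apply/mapP => -[].
  by apply/mapP => -[].
- by case: X.
by apply/hasPn => c /mapP[j _ ->]; case: X.
Qed.

Lemma mem_Pos i : (Pos i \in alphabet) = (0 < i <= n).
Proof.
rewrite !mem_cat mem_map; last by move=> ? ? [].
rewrite mem_iota add1n ltnS; case: (_ <= _ <= _) => //=.
by case: X; rewrite ?inE /=; apply/mapP => -[].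
Qed.

Lemma mem_Bar i : (Bar i \in alphabet) = (0 < i <= n).
Proof.
rewrite !mem_cat [X in _ || (_ || X)]mem_map; last by move=> ? ? [].
rewrite mem_rev mem_iota add1n ltnS; case: (_ <= _ <= _); rewrite ?orbT //.
rewrite orbF; apply/norP; split; first by apply/mapP => -[].
by case: X.
Qed.

Lemma mem_Circ : (Circ \in alphabet) = if X is typeB then true else false.
Proof.
rewrite !mem_cat; case: X; rewrite ?inE ?eqxx ?orbT //.
by apply/norP; split; apply/mapP => -[].
Qed.

Lemma index_Pos i : 0 < i <= n -> index (Pos i) alphabet = i.-1.
Proof.
move=> ir; rewrite index_cat map_f ?mem_iota; last by lia.
rewrite index_map; last by move=> ? ? [].
have E : nth 0 (iota 1 n) i.-1 = i by rewrite nth_iota; lia.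
by rewrite -{1}E index_uniq ?iota_uniq // size_iota; lia.
Qed.

Lemma index_Circ : X = typeB -> index Circ alphabet = n.
Proof.
move=> XB; rewrite index_cat ifF; last by apply/mapP => -[].
by rewrite XB /= size_map size_iota addn0.
Qed.

Lemma index_Bar i : 0 < i <= n -> index (Bar i) alphabet =
  (if X is typeB then n.+1 else n) + (n - i).
Proof.
move=> ir; rewrite index_cat ifF; last by apply/mapP => -[].
rewrite index_cat ifF; last by case: X.
rewrite index_map; last by move=> ? ? [].
have E : nth 0 (rev (iota 1 n)) (n - i) = i.
  by rewrite nth_rev ?size_iota ?nth_iota; lia.
have F : index i (rev (iota 1 n)) = n - i.
  by rewrite -{1}E index_uniq ?rev_uniq ?iota_uniq // size_rev size_iota; lia.
by rewrite F size_map size_iota; case: X => /=; lia.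
Qed.

End Alphabet.

Section KR.
Variables (X : affine_type) (n l : nat).
Local Notation A := (alphabet X n).

(* Coordinates are at most l because their sum is l. *)
Definition coords : finType := (size A).-tuple 'I_l.+1.

(* The multiplicity x_c of the letter c; it is 0 if c is not in the alphabet. *)
Definition tcoord (t : coords) (c : letter) : nat :=
  nth 0 [seq val j | j <- t] (index c A).

Definition admissible (t : coords) : bool :=
  (\sum_(c <- A) tcoord t c == l) &&
  match X with
  | typeB => tcoord t Circ <= 1
  | typeD => (tcoord t (Pos n) == 0) || (tcoord t (Bar n) == 0)
  end.

Definition kr_elt : finType := {t : coords | admissible t}.

Definition coord (b : kr_elt) (c : letter) : nat := tcoord (val b) c.

(* The element obtained from b by changing x_d to x_d - 1 and x_u to x_u + 1,
   and [None] if there is no such element. *)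
Definition move (b : kr_elt) (d u : letter) : option kr_elt :=
  [pick b' : kr_elt | [&& d \in A, u \in A &
     all (fun c => coord b' c + (c == d) == coord b c + (c == u)) A]].

Definition kr_e (i : 'I_n.+1) (b : kr_elt) : option kr_elt :=
  if i == 0 :> nat then
    if coord b (Bar 2) < coord b (Pos 2) then move b (Pos 2) (Bar 1)
    else move b (Pos 1) (Bar 2)
  else if i < n then
    if coord b (Bar i.+1) < coord b (Pos i.+1) then move b (Pos i.+1) (Pos i)
    else move b (Bar i) (Bar i.+1)
  else match X with
  | typeB => if coord b Circ == 0 then move b (Bar n) Circ
             else move b Circ (Pos n)
  | typeD => if 0 < coord b (Bar n) then move b (Bar n) (Pos n.-1)
             else move b (Bar n.-1) (Pos n)
  end.

Definition kr_f (i : 'I_n.+1) (b : kr_elt) : option kr_elt :=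
  if i == 0 :> nat then
    if coord b (Bar 2) <= coord b (Pos 2) then move b (Bar 1) (Pos 2)
    else move b (Bar 2) (Pos 1)
  else if i < n then
    if coord b (Bar i.+1) <= coord b (Pos i.+1) then move b (Pos i) (Pos i.+1)
    else move b (Bar i.+1) (Bar i)
  else match X with
  | typeB => if coord b Circ == 0 then move b (Pos n) Circ
             else move b Circ (Bar n)
  | typeD => if 0 < coord b (Pos n) then move b (Pos n) (Bar n.-1)
             else move b (Pos n.-1) (Bar n)
  end.

Lemma coord_notin b c : c \notin A -> coord b c = 0.
Proof.
rewrite -index_mem -leqNgt => le_c.
by rewrite /coord /tcoord nth_default // size_map size_tuple.
Qed.

Lemma coord_inj b b' : {in A, coord b =1 coord b'} -> b = b'.
Proof.
move=> eq_bb; apply/val_inj/eq_from_tnth => j; apply: val_inj.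
have lt_j : j < size A by [].
have tE (t : coords) : tcoord t (nth Circ A j) = tnth t j.
  rewrite /tcoord index_uniq ?alphabet_uniq //.
  by rewrite (nth_map ord0) ?size_tuple // -tnth_nth.
by rewrite /= -(tE (val b)) -(tE (val b')); apply: eq_bb; rewrite mem_nth.
Qed.

Lemma moveP b d u b' : move b d u = Some b' <->
  [/\ d \in A, u \in A &
      forall c, coord b' c + (c == d) = coord b c + (c == u)].
Proof.
rewrite /move; split.
  case: pickP => // a /and3P[dA uA /allP H] [<-]; split=> // c.
  have [cA|cA] := boolP (c \in A); first exact/eqP/H.
  rewrite !coord_notin //; have [E|_] := eqVneq c d; first by rewrite E dA in cA.
  by have [E|_] := eqVneq c u; first by rewrite E uA in cA.
case=> dA uA H; case: pickP => [a /and3P[_ _ /allP Ha]|no_b].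
  by congr Some; apply: coord_inj => c cA; have := eqP (Ha c cA); have := H c; lia.
have := no_b b'; rewrite dA uA /= => /negbT /allPn[c _].
by rewrite H eqxx.
Qed.

Lemma move_sym b d u b' : move b d u = Some b' <-> move b' u d = Some b.
Proof. by split=> /moveP[dA uA H]; apply/moveP; split. Qed.

Lemma coord_adm (b : kr_elt) :
  match X with
  | typeB => coord b Circ <= 1
  | typeD => (coord b (Pos n) == 0) || (coord b (Bar n) == 0)
  end.
Proof. by have /andP[] := valP b. Qed.

Lemma coord_circ (b : kr_elt) : X = typeB -> coord b Circ <= 1.
Proof.
move=> XB; have := coord_adm b; move: (_ <= 1) (_ || _) => P Q.
by rewrite XB.
Qed.

Lemma coord_n (b : kr_elt) : X = typeD ->
  (coord b (Pos n) == 0) || (coord b (Bar n) == 0).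
Proof.
move=> XD; have := coord_adm b; move: (_ <= 1) (_ || _) => P Q.
by rewrite XD.
Qed.

Lemma kr_fe i b b' : kr_f i b = Some b' <-> kr_e i b' = Some b.
Proof.
have side (P Q : bool) d u d' u' x y :
    (move b d u = Some b' -> P -> Q) ->
    (move b d' u' = Some b' -> ~~ P -> ~~ Q) ->
    (move b d u = Some b' -> Q -> P) ->
    (move b d' u' = Some b' -> ~~ Q -> ~~ P) ->
    x = b' -> y = b ->
    (if P then move b d u else move b d' u') = Some x <->
    (if Q then move b' u d else move b' u' d') = Some y.
  move=> H1 H2 H3 H4 -> ->; split.
    case: ifPn => nP E; first by rewrite (H1 E nP); apply/move_sym.
    by rewrite (negPf (H2 E nP)); apply/move_sym.
  case: ifPn => nQ /move_sym E; first by rewrite (H3 E nQ).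
  by rewrite (negPf (H4 E nQ)).
rewrite /kr_f /kr_e; case: ifP => [i0|/negbT i0].
  by apply: side => // /moveP[_ _ H]; have := H (Pos 2); have := H (Bar 2);
    rewrite !eq_letterE /=; lia.
case: ifP => [lt_i|_].
  by apply: side => // /moveP[_ _ H]; have := H (Pos i.+1);
    have := H (Bar i.+1); rewrite !eq_letterE /=; lia.
case XE: X => /=.
  have := coord_circ b XE; have := coord_circ b' XE => c1 c2.
  rewrite -[in X in _ <-> X]if_neg.
  by apply: side => // /moveP[_ _ H]; have := H Circ;
    rewrite !eq_letterE eqxx /=; lia.
rewrite -[in X in _ <-> X]if_neg.
have := coord_n b XE; have := coord_n b' XE => c1 c2.
by apply: side => // /moveP[dA uA H]; have := H (Pos n); have := H (Bar n);
  move: dA uA; rewrite ?mem_Pos ?mem_Bar !eq_letterE /=; lia.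
Qed.

Let weight (b : kr_elt) : nat := \sum_(c <- A) coord b c * index c A.

Lemma weight_move b d u b' : move b d u = Some b' ->
  weight b' + index d A = weight b + index u A.
Proof.
case/moveP=> dA uA H.
have E v : v \in A -> index v A = \sum_(c <- A) (c == v) * index c A.
  move=> vA; rewrite (bigD1_seq v) ?alphabet_uniq //= eqxx mul1n.
  by rewrite big1 ?addn0 // => c /negPf ->.
rewrite (E d) // (E u) // -!big_split /=.
by apply: eq_bigr => c _; rewrite -!mulnDl H.
Qed.

Lemma kr_nil i b : iter #|kr_elt| (obind (kr_e i)) (Some b) = None.
Proof.
have [i0|i0] := eqVneq (i : nat) 0.
  apply: (@iter_nil_incr _ _ weight) => {}b c; rewrite /kr_e i0 /=.
  case: ifP => _ E; have := weight_move E; move/moveP: E => [dA uA _];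
    rewrite index_Pos -?(mem_Pos X) // index_Bar -?(mem_Bar X) //;
    move: dA uA; rewrite mem_Pos mem_Bar; case: X; lia.
apply: (@iter_nil_decr _ _ weight) => {}b c; rewrite /kr_e (negPf i0).
case: ifP => [lt_i|_].
  case: ifP => _ E; have := weight_move E; move/moveP: E => [dA uA _];
    rewrite ?index_Pos -?(mem_Pos X) // ?index_Bar -?(mem_Bar X) //;
    move: dA uA; rewrite ?mem_Pos ?mem_Bar; case: X; lia.
have n0 : n != 0 by have := ltn_ord i; lia.
case XE: X => /=.
  case: ifP => _ E; have := weight_move E; rewrite index_Circ //;
    rewrite ?index_Pos ?index_Bar ?XE; lia.
case: ifP => _ E; have := weight_move E; move/moveP: E => [dA uA _];
  rewrite index_Pos -?(mem_Pos X) // index_Bar -?(mem_Bar X) // XE;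
  move: dA uA; rewrite mem_Pos mem_Bar; lia.
Qed.

Definition KR : crystal n := Crystal kr_fe kr_nil.

Definition concentrated (b : kr_elt) (c : letter) : Prop :=
  forall c', coord b c' = if c' == c then l else 0.

(* The one-row tableau T(b), read from left to right; in type D it is weakly
   increasing because n and n-bar do not both occur. *)
Definition row (b : kr_elt) : seq letter :=
  flatten [seq nseq (coord b c) c | c <- A].

End KR.

Arguments KR : clear implicits.

Definition energy_normalized (X : affine_type) (n l k : nat)
    (H : KR X n l \tens KR X n k -> int) : Prop :=
  forall (b1 : KR X n l) (b2 : KR X n k),
    concentrated b1 (Pos 1) -> concentrated b2 (Bar 1) -> H (b1, b2) = 0%R.

(* A column is the sequence of its entries from top to bottom, and a tableau
   is the sequence of its columns from left to right. *)
Definition column := seq letter.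
Definition tableau := seq column.

Definition bar_pair (a c : letter) : bool :=
  if (a, c) is (Pos x, Bar y) then x == y else false.

Section Insertion.
Variables (X : affine_type) (n : nat).
Local Notation "a <=l b" := (lle X n a b) (at level 70).
Local Notation "a <l b" := (llt X n a b) (at level 70).

(* [bumpB c K K' d], [bumpD c K K' d]: c -> K => K'; d by one of the cases
   B0, B1, ... of the type *)
Inductive bumpB : letter -> column -> column -> letter -> Prop :=
| bumpB0 a b : a <=l b -> (a, b) <> (Circ, Circ) ->
    bumpB a [:: b] [:: a] b
| bumpB1 a b c : a <l b -> b <=l c -> ~~ bar_pair a c ->
    (b, c) <> (Circ, Circ) ->
    bumpB b [:: a; c] [:: a; b] c
| bumpB2 a b c : a <=l b -> b <l c -> ~~ bar_pair a c ->
    (a, b) <> (Circ, Circ) ->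
    bumpB a [:: b; c] [:: a; c] b
| bumpB3 x : 1 <= x <= n ->
    bumpB Circ [:: Circ; Bar x] [:: Circ; Circ] (Bar x)
| bumpB4 x : 1 <= x <= n ->
    bumpB (Pos x) [:: Circ; Circ] [:: Pos x; Circ] Circ
| bumpB5 x b : 1 <= x <= n -> Pos x <=l b -> b <=l Bar x -> x <> 1 ->
    bumpB b [:: Pos x; Bar x] [:: Pos x.-1; b] (Bar x.-1)
| bumpB6 x b : 1 <= x <= n -> Pos x <l b -> b <l Bar x -> x <> n ->
    bumpB (Pos x) [:: b; Bar x] [:: Pos x.+1; Bar x.+1] b
| bumpB7 :
    bumpB (Pos n) [:: Circ; Bar n] [:: Pos n; Circ] (Bar n).

Definition npair (mu1 mu2 : letter) : Prop :=
  (mu1, mu2) = (Pos n, Bar n) \/ (mu1, mu2) = (Bar n, Pos n).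

Inductive bumpD : letter -> column -> column -> letter -> Prop :=
| bumpD0 a b : a <=l b ->
    bumpD a [:: b] [:: a] b
| bumpD1 a b c : a <l b -> b <=l c -> ~~ bar_pair a c ->
    bumpD b [:: a; c] [:: a; b] c
| bumpD2 a b c : a <=l b -> b <l c -> ~~ bar_pair a c ->
    bumpD a [:: b; c] [:: a; c] b
| bumpD3 x b : 1 <= x <= n -> Pos x <=l b -> b <=l Bar x -> x <> n -> x <> 1 ->
    bumpD b [:: Pos x; Bar x] [:: Pos x.-1; b] (Bar x.-1)
| bumpD4 x b : 1 <= x <= n -> Pos x <l b -> b <l Bar x ->
    x <> n.-1 -> x <> n ->
    bumpD (Pos x) [:: b; Bar x] [:: Pos x.+1; Bar x.+1] b
| bumpD5 x mu1 mu2 : 1 <= x <= n -> npair mu1 mu2 -> x <> n ->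
    bumpD (Pos x) [:: mu1; mu2] [:: Pos x; mu2] mu1
| bumpD6 x mu1 mu2 : 1 <= x <= n -> npair mu1 mu2 -> x <> n ->
    bumpD mu2 [:: mu1; Bar x] [:: mu1; mu2] (Bar x)
| bumpD7 mu mu' : npair mu mu' ->
    bumpD (Pos n.-1) [:: mu; Bar n.-1] [:: mu; mu'] mu
| bumpD8 mu1 mu2 : npair mu1 mu2 ->
    bumpD mu2 [:: mu1; mu2] [:: Pos n.-1; mu2] (Bar n.-1).

Definition bump (c : letter) (K K' : column) (d : letter) : Prop :=
  match X with typeB => bumpB c K K' d | typeD => bumpD c K K' d end.

Definition stacks (a b : letter) : Prop :=
  a <l b \/
  match X with typeB => (a, b) = (Circ, Circ) | typeD => npair a b end.

(* [insert c T T']: inserting c in the tableau T may yield T' *)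
Inductive insert : letter -> tableau -> tableau -> Prop :=
| insert_A0 a : a \in alphabet X n ->
    insert a [::] [:: [:: a]]
| insert_A1 a b T : stacks a b ->
    insert b ([:: a] :: T) ([:: a; b] :: T)
| insert_bump c d K K' T T' : bump c K K' d -> insert d T T' ->
    insert c (K :: T) (K' :: T').

(* [insert_word v T T'] with v = v_1 ... v_r:
   T' = (v_1 -> ( ... (v_r -> T))) *)
Inductive insert_word : seq letter -> tableau -> tableau -> Prop :=
| insert_nil T : insert_word [::] T T
| insert_cons a v T T' T'' : insert_word v T T' -> insert a T' T'' ->
    insert_word (a :: v) T T''.

(* [uninsert d T T' w]: inversely inserting d in the rightmost column of T,
   and then on to the left, changes T to T' and bumps w out of the leftmost
   column. *)
Inductive uninsert : letter -> tableau -> tableau -> letter -> Prop :=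
| uninsert_nil d : uninsert d [::] [::] d
| uninsert_rcons c d K K' T T' w : bump c K K' d -> uninsert c T T' w ->
    uninsert d (rcons T K') (rcons T' K) w.

(* Inverse column insertion starting at the rightmost box, with letter d, of
   the first row, resp. of the second row, of a tableau with at most two rows;
   the boxes of the second row are the bottom boxes of the leftmost columns. *)
Inductive uninsert_row1 : tableau -> tableau -> letter -> Prop :=
| UninsertRow1 d L L' w : uninsert d L L' w ->
    uninsert_row1 (rcons L [:: d]) L' w.

Inductive uninsert_row2 : tableau -> tableau -> letter -> Prop :=
| UninsertRow2 a d L L' R w : uninsert d L L' w ->
    all (fun K => size K == 1) R ->
    uninsert_row2 (L ++ [:: a; d] :: R) (L' ++ [:: a] :: R) w.

(* [uninserts p q T T' w]: p inverse insertions from the first row, followed by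
   q from the second one; w lists the letters in the order they come out. *)
Inductive uninserts : nat -> nat -> tableau -> tableau -> seq letter -> Prop :=
| uninserts_done T : uninserts 0 0 T T [::]
| uninserts_row1 p q T T' T'' a w : uninsert_row1 T T' a ->
    uninserts p q T' T'' w -> uninserts p.+1 q T T'' (a :: w)
| uninserts_row2 q T T' T'' a w : uninsert_row2 T T' a ->
    uninserts 0 q T' T'' w -> uninserts 0 q.+1 T T'' (a :: w).

End Insertion.

Definition row_tableau (r : seq letter) : tableau := [seq [:: a] | a <- r].

Definition row2_length (T : tableau) : nat := count (fun K => 1 < size K) T.

Section Rule.
Variables (X : affine_type) (n l k : nat).

Definition cancelled (b1 : KR X n l) (b2 : KR X n k) : nat :=
  minn (count_mem (Pos 1) (row b1)) (count_mem (Bar 1) (row b2)).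

(* [rule b1 b2 b2' b1' l' k' m]: the rule applied to b1 (x) b2 produces
   b2' (x) b1' and the integers l', k', m. *)
Definition rule (b1 : KR X n l) (b2 : KR X n k)
    (b2' : KR X n k) (b1' : KR X n l) (l' k' m : nat) : Prop :=
  let z := cancelled b1 b2 in
  let Tstar := iter z (rem (Pos 1)) (row b1) in
  let v := iter z (rem (Bar 1)) (row b2) in
  l' = l - z /\ k' = k - z /\
  exists (T0 : tableau) (w r : seq letter),
    [/\ insert_word X n v (row_tableau Tstar) T0,
        m = row2_length T0,
        uninserts X n (l' - m) m T0 (row_tableau r) w,
        row b2' = nseq z (Pos 1) ++ r &
        row b1' = w ++ nseq z (Bar 1)].

End Rule.

(* Main.v *)
(** Forgetting the 0-arrows, both sides of the rule are crystals of words: an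
element of [KR] is the word [rev (row b)], and a tableau is read column by
column from right to left, each column from top to bottom.  Each elementary
step [c -> K => K'; d] is the graph of an isomorphism between two sets of
three-letter words, [K c] and [d K'], stable under the operators f_1, ..., f_n.
Hence insertion and inverse insertion commute with f_1, ..., f_n, and so does
the whole rule; the z letters 1 and the z letters 1-bar that it cancels form a
neutral word, and z is constant along the arrows.  Every element is reached
from a highest weight element, which has the form
[1^l (x) 1^a 2^m 1-bar^z]; there the rule is computed by hand, and the
isomorphism is forced because m and z can be read off the weight.  As H is
constant along the arrows f_1, ..., f_n, only its values at the highest weight
elements remain; two kinds of 0-arrows, leading from (m + 1, z) to (m, z + 1)
and from (0, z) to the component of (1, z), each decrease it by 1. *)

Require Import Defs.
From mathcomp Require Import all_boot all_order all_algebra zify.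
From Stdlib Require Import ZArith Lia.
(* Restores the names [bump] and [coord], shadowed by MathComp. *)
Import Defs.

Set Implicit Arguments.
Unset Strict Implicit.
Unset Printing Implicit Defensive.

#[local] Arguments Z.of_nat : simpl never.
#[local] Arguments Z.add : simpl never.
#[local] Arguments Z.sub : simpl never.
#[local] Arguments Z.opp : simpl never.
#[local] Arguments Z.eqb : simpl never.

(** * Crystals of words *)

(** The rule is given as a relation, so a priori it may have no outcome or several. Existence is
    never proved by following the boxes of a tableau: an outcome at a highest weight element is
    transported along the arrows, and with it the shapes of all tableaux involved, since a word
    alone does not determine the tableau that it is read from. Uniqueness is a separate matter and
    rests on the elementary steps being single-valued both forwards and backwards. Two further
    points shape the argument. The elementary steps have to be checked uniformly in n; measuring
    letters by their distance from the centre of the alphabet turns every check into linear integer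
    arithmetic. The minimality of z is not a consequence of the neutrality of the cancelled letters;
    it is transported as a condition of its own, namely that no pair of 1 and 1-bar is left to
    cancel. Rows are reversed so that the cancelled letters of the two factors meet in the middle of
    the word. *)

Section WordCrystal.
Variables (T : Type) (ph ep : T -> nat) (fl : T -> T).
Implicit Types (c : T) (u v w s t : seq T) (Q : seq T -> seq T -> Prop).

(** A word is a tensor product of its letters with the head as leftmost factor; truncated
    subtraction plays the role of the maximum with 0 in the formulas for epsilon and phi of a tensor
    product. *)
Fixpoint weps w : nat :=
  if w is c :: w' then ep c + (weps w' - ph c) else 0.
Fixpoint wphi w : nat :=
  if w is c :: w' then wphi w' + (ph c - weps w') else 0.
Fixpoint wf w : option (seq T) :=
  if w is c :: w' then
    if weps w' < ph c then Some (fl c :: w') else omap (cons c) (wf w')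
  else None.

Lemma weps_cat u v : weps (u ++ v) = weps u + (weps v - wphi u).
Proof. by elim: u => [|c u IH] /=; lia. Qed.

Lemma wphi_cat u v : wphi (u ++ v) = wphi v + (wphi u - weps v).
Proof. by elim: u => [|c u IH] /=; rewrite ?weps_cat; lia. Qed.

Lemma wf_cat u v : wf (u ++ v) =
  if weps v < wphi u then omap (cat^~ v) (wf u) else omap (cat u) (wf v).
Proof.
elim: u => [|c u IH] /=; first by case: (wf v).
rewrite weps_cat IH; have [lt_c|le_c] := ltnP (weps u) (ph c).
  case: ifPn => h; case: ifPn => h'; rewrite //=; try by exfalso; lia.
  by case: ifPn => h2; [exfalso; lia | case: (wf v)].
case: ifPn => h; first by exfalso; lia.
case: ifPn => h1; case: ifPn => h2; try by exfalso; lia.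
  by case: (wf u).
by case: (wf v).
Qed.

Lemma wf_isSome w : wf w = (0 < wphi w) :> bool.
Proof.
elim: w => //= c w IH; case: ifPn => h; first by rewrite /= ; lia.
have -> : omap (cons c) (wf w) = wf w :> bool by case: (wf w).
rewrite IH; lia.
Qed.

Lemma wphi_gt0 w w' : wf w = Some w' -> 0 < wphi w.
Proof. by move=> E; rewrite -wf_isSome E. Qed.

Lemma wf_Some w : 0 < wphi w -> exists w', wf w = Some w'.
Proof. by rewrite -wf_isSome; case: (wf w) => // w' _; exists w'. Qed.

Lemma wf_None w : wphi w = 0 -> wf w = None.
Proof. by move=> E; have := wf_isSome w; rewrite E; case: (wf w). Qed.

Lemma wf_catl u v w : wf (u ++ v) = Some w ->
  (exists u', [/\ weps v < wphi u, wf u = Some u' & w = u' ++ v]) \/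
  (exists v', [/\ wphi u <= weps v, wf v = Some v' & w = u ++ v']).
Proof.
rewrite wf_cat; case: ltnP => h.
  by case E: (wf u) => [u'|] //= [<-]; left; exists u'.
by case E: (wf v) => [v'|] //= [<-]; right; exists v'.
Qed.

Lemma wf_size w w' : wf w = Some w' -> size w' = size w.
Proof.
elim: w w' => //= c w IH w'; case: ifP => _; first by case=> <-.
by case E: (wf w) => [v|] //= [<-] /=; rewrite (IH _ E).
Qed.

Lemma neutral_nseq m c : ep c = 0 -> ph c = 0 ->
  weps (nseq m c) = 0 /\ wphi (nseq m c) = 0.
Proof. by move=> e p; elim: m => //= m [-> ->]; rewrite e p. Qed.

Lemma wf_cat_neutral u v : weps v = 0 -> wphi v = 0 ->
  wf (u ++ v) = omap (cat^~ v) (wf u).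
Proof.
move=> ev pv; rewrite wf_cat ev (wf_None pv) /=.
by case: ltnP => //; rewrite leqn0 => /eqP/wf_None ->.
Qed.

Lemma wf_neutral_cat u v : weps u = 0 -> wphi u = 0 ->
  wf (u ++ v) = omap (cat u) (wf v).
Proof. by move=> eu pu; rewrite wf_cat pu. Qed.

(** Only f is followed, since everything is propagated downwards from highest weight elements. [Q]
    speaks of the images and not of [u] and [v]: it records the structure that the new words
    inherit, so that the link can be used again. *)
Definition word_link u v Q : Prop :=
  [/\ weps u = weps v, wphi u = wphi v &
      forall u', wf u = Some u' -> exists2 v', wf v = Some v' & Q u' v'].

Lemma link_refl u Q : (forall u', wf u = Some u' -> Q u' u') ->
  word_link u u Q.
Proof. by move=> H; split=> // u' E; exists u' => //; apply: H. Qed.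

Lemma link_mono u v Q Q' : word_link u v Q ->
  (forall u' v', Q u' v' -> Q' u' v') -> word_link u v Q'.
Proof.
by case=> e p f H; split=> // u' /f[v' E q]; exists v' => //; apply: H.
Qed.

Lemma link_trans u v w Q1 Q2 Q : word_link u v Q1 -> word_link v w Q2 ->
  (forall u' v' w', Q1 u' v' -> Q2 v' w' -> Q u' w') -> word_link u w Q.
Proof.
move=> [e1 p1 f1] [e2 p2 f2] H; split; rewrite ?e1 ?p1 // => u'.
by case/f1=> v' /f2[w' E q2] q1; exists w' => //; apply: H q1 q2.
Qed.

(** Equal phi means that f is defined on both words or on neither, and f is single-valued; so the
    image of [u] is linked to the image of [v] that is given. *)
Lemma link_sym u v Q : word_link u v Q -> word_link v u (fun x y => Q y x).
Proof.
case=> e p f; split=> // v' E.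
have [u' Eu] : exists u', wf u = Some u'.
  by apply: wf_Some; rewrite p; apply: wphi_gt0 E.
by exists u' => //; have [v''] := f _ Eu; rewrite E => -[<-].
Qed.

(** The tensor product rule looks only at epsilon and phi of the factors, so f selects the same
    factor in both products. *)
Lemma link_cat u v s t Q1 Q2 Q : word_link u v Q1 -> word_link s t Q2 ->
  (forall u' v', Q1 u' v' -> Q (u' ++ s) (v' ++ t)) ->
  (forall s' t', Q2 s' t' -> Q (u ++ s') (v ++ t')) ->
  word_link (u ++ s) (v ++ t) Q.
Proof.
move=> [e1 p1 f1] [e2 p2 f2] H1 H2; split.
- by rewrite !weps_cat e1 e2 p1.
- by rewrite !wphi_cat p1 e2 p2.
move=> w; rewrite !wf_cat p1 e2; case: ifP => _.
  case E: (wf u) => [u'|] //= [<-]; have [v' -> q] := f1 _ E.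
  by exists (v' ++ t) => //; apply: H1.
case E: (wf s) => [s'|] //= [<-]; have [t' -> q] := f2 _ E.
by exists (v ++ t') => //; apply: H2.
Qed.

Hypothesis flP : forall c, 0 < ph c -> ph c = (ph (fl c)).+1 /\
  ep (fl c) = (ep c).+1.

Lemma wf_sig w w' : wf w = Some w' ->
  wphi w = (wphi w').+1 /\ weps w' = (weps w).+1.
Proof.
elim: w w' => //= c w IH w'; case: ltnP => h.
  by case=> <- /=; have [] := @flP c; lia.
by case E: (wf w) => [v|] //= [<-] /=; have [] := IH _ E; lia.
Qed.

End WordCrystal.

(** * The elementary steps on integer codes of letters *)

(* The letters i, o and i-bar are coded by the integers - (n + 1 - i), 0 and
   n + 1 - i, and the index i of f_i by j = n + 1 - i, so that n does not occur
   in the signatures; f_n is the case j = 1. *)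
Definition zphi (X : affine_type) (j z : Z) : nat :=
  match X with
  | typeB => if Z.eqb z (- j)%Z then (if Z.eqb j 1 then 2 else 1)
             else if Z.eqb z (j - 1)%Z then 1 else 0
  | typeD => if Z.eqb j 1 then (if Z.eqb z (-2)%Z || Z.eqb z (-1)%Z then 1 else 0)
             else if Z.eqb z (- j)%Z || Z.eqb z (j - 1)%Z then 1 else 0
  end.

Definition zeps (X : affine_type) (j z : Z) : nat :=
  match X with
  | typeB => if Z.eqb z j then (if Z.eqb j 1 then 2 else 1)
             else if Z.eqb z (1 - j)%Z then 1 else 0
  | typeD => if Z.eqb j 1 then (if Z.eqb z 2 || Z.eqb z 1 then 1 else 0)
             else if Z.eqb z j || Z.eqb z (1 - j)%Z then 1 else 0
  end.

Definition zf (X : affine_type) (j z : Z) : Z :=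
  match X with
  | typeB => (z + 1)%Z
  | typeD => if Z.eqb j 1 then (z + 3)%Z else (z + 1)%Z
  end.

#[local] Arguments zphi : simpl never.
#[local] Arguments zeps : simpl never.
#[local] Arguments zf : simpl never.

Ltac prune := try (exfalso; xlia zchecker).
Ltac solve_or :=
  first [ left; repeat (apply: conj); xlia zchecker
        | right; solve_or
        | repeat (apply: conj); xlia zchecker ].
Ltac split_letter spec t :=
  let H := fresh in
  (have H := spec t); case: H => * ; prune.

Section ZSpec.
Open Scope Z_scope.

(** The indices are phi, epsilon and f of the code z; the last one has a meaning only where phi is
    positive. *)
Variant zspecB (j z : Z) : nat -> nat -> Z -> Prop :=
| ZB1 of 1 < j & z = - j : zspecB j z 1 0 (1 - j)
| ZB2 of 1 < j & z = 1 - j : zspecB j z 0 1 (2 - j)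
| ZB3 of 1 < j & z = j - 1 : zspecB j z 1 0 j
| ZB4 of 1 < j & z = j : zspecB j z 0 1 (j + 1)
| ZB5 of j = 1 & z = -1 : zspecB j z 2 0 0
| ZB6 of j = 1 & z = 0 : zspecB j z 1 1 1
| ZB7 of j = 1 & z = 1 : zspecB j z 0 2 2
| ZB8 of z <> - j & z <> 1 - j & z <> j - 1 & z <> j : zspecB j z 0 0 (z + 1).

Variant zspecD (j z : Z) : nat -> nat -> Z -> Prop :=
| ZD1 of 1 < j & z = - j : zspecD j z 1 0 (1 - j)
| ZD2 of 1 < j & z = 1 - j : zspecD j z 0 1 (2 - j)
| ZD3 of 1 < j & z = j - 1 : zspecD j z 1 0 j
| ZD4 of 1 < j & z = j : zspecD j z 0 1 (j + 1)
| ZD5 of 1 < j & z <> - j & z <> 1 - j & z <> j - 1 & z <> j :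
  zspecD j z 0 0 (z + 1)
| ZD6 of j = 1 & z = -2 : zspecD j z 1 0 1
| ZD7 of j = 1 & z = -1 : zspecD j z 1 0 2
| ZD8 of j = 1 & z = 1 : zspecD j z 0 1 4
| ZD9 of j = 1 & z = 2 : zspecD j z 0 1 5
| ZD10 of j = 1 & z <> -2 & z <> -1 & z <> 1 & z <> 2 :
  zspecD j z 0 0 (z + 3).

Lemma zspecBP j z : 1 <= j ->
  zspecB j z (zphi typeB j z) (zeps typeB j z) (zf typeB j z).
Proof.
move=> j1; rewrite /zphi /zeps /zf.
case: (Z.eqb_spec j 1) => [->|jn1].
  case: (Z.eqb_spec z (-1)%Z) => [->|]; first by constructor; lia.
  case: (Z.eqb_spec z 0) => [->|]; first by constructor; lia.
  by case: (Z.eqb_spec z 1) => [->|] *; [constructor 7 | constructor 8]; lia.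
case: (Z.eqb_spec z (-j)) => [->|h1].
  rewrite (_ : -j + 1 = 1 - j); last lia.
  by do ?[case: Z.eqb_spec => /= ?; first lia]; constructor; lia.
case: (Z.eqb_spec z (j - 1)) => [->|h2].
  rewrite (_ : j - 1 + 1 = j); last lia.
  by do ?[case: Z.eqb_spec => /= ?; first lia]; constructor; lia.
case: (Z.eqb_spec z j) => [->|h3]; first by constructor; lia.
case: (Z.eqb_spec z (1 - j)) => [->|h4].
  rewrite (_ : 1 - j + 1 = 2 - j); last lia.
  by do ?[case: Z.eqb_spec => /= ?; first lia]; constructor; lia.
by constructor 8; lia.
Qed.

Lemma zspecDP j z : 1 <= j ->
  zspecD j z (zphi typeD j z) (zeps typeD j z) (zf typeD j z).
Proof.
move=> j1; rewrite /zphi /zeps /zf.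
case: (Z.eqb_spec j 1) => [->|jn1].
  case: (Z.eqb_spec z (-2)) => [->|]; first by constructor.
  case: (Z.eqb_spec z (-1)) => [->|]; first by constructor.
  case: (Z.eqb_spec z 1) => [->|]; first by constructor.
  by case: (Z.eqb_spec z 2) => [->|] *; [constructor 9 | constructor 10].
case: (Z.eqb_spec z (-j)) => [->|h1].
  rewrite (_ : -j + 1 = 1 - j); last lia.
  by do ?[case: Z.eqb_spec => /= ?; first lia]; constructor; lia.
case: (Z.eqb_spec z (j - 1)) => [->|h2].
  rewrite (_ : j - 1 + 1 = j); last lia.
  by do ?[case: Z.eqb_spec => /= ?; first lia]; constructor; lia.
case: (Z.eqb_spec z j) => /= [->|h3]; first by constructor; lia.
case: (Z.eqb_spec z (1 - j)) => [->|h4].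
  rewrite (_ : 1 - j + 1 = 2 - j); last lia.
  by do ?[case: Z.eqb_spec => /= ?; first lia]; constructor; lia.
by constructor 5; lia.
Qed.

(** Here and in the next two tables the disequalities of the neutral cases are resolved into order
    relations, so that impossible combinations of letters are discarded by plain linear
    inequalities. *)
Variant zspecB1 (z : Z) : nat -> nat -> Z -> Prop :=
| ZB1_m1 of z = -1 : zspecB1 z 2 0 0
| ZB1_0 of z = 0 : zspecB1 z 1 1 1
| ZB1_1 of z = 1 : zspecB1 z 0 2 2
| ZB1_lt of z < -1 : zspecB1 z 0 0 (z + 1)
| ZB1_gt of 1 < z : zspecB1 z 0 0 (z + 1).

Variant zspecD1 (z : Z) : nat -> nat -> Z -> Prop :=
| ZD1_m2 of z = -2 : zspecD1 z 1 0 1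
| ZD1_m1 of z = -1 : zspecD1 z 1 0 2
| ZD1_1 of z = 1 : zspecD1 z 0 1 4
| ZD1_2 of z = 2 : zspecD1 z 0 1 5
| ZD1_0 of z = 0 : zspecD1 z 0 0 3
| ZD1_lt of z < -2 : zspecD1 z 0 0 (z + 3)
| ZD1_gt of 2 < z : zspecD1 z 0 0 (z + 3).

(** Only the node j = 1 distinguishes the two types; for j > 1 one table serves both. *)
Variant zspec_gt1 (j z : Z) : nat -> nat -> Z -> Prop :=
| Zgt_mj of z = - j : zspec_gt1 j z 1 0 (1 - j)
| Zgt_1mj of z = 1 - j : zspec_gt1 j z 0 1 (2 - j)
| Zgt_jm1 of z = j - 1 : zspec_gt1 j z 1 0 j
| Zgt_j of z = j : zspec_gt1 j z 0 1 (j + 1)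
| Zgt_lt of z < - j : zspec_gt1 j z 0 0 (z + 1)
| Zgt_mid of 1 - j < z & z < j - 1 : zspec_gt1 j z 0 0 (z + 1)
| Zgt_gt of j < z : zspec_gt1 j z 0 0 (z + 1).

Lemma zspecB1P z : zspecB1 z (zphi typeB 1 z) (zeps typeB 1 z) (zf typeB 1 z).
Proof.
case: (zspecBP z (Z.le_refl 1)) => *; try by constructor || lia.
by have [h|h] := Z.lt_ge_cases z 0; [apply: ZB1_lt | apply: ZB1_gt]; lia.
Qed.

Lemma zspecD1P z : zspecD1 z (zphi typeD 1 z) (zeps typeD 1 z) (zf typeD 1 z).
Proof.
case: (zspecDP z (Z.le_refl 1)) => *; try by constructor || lia.
case: (Z.eq_dec z 0) => [->|nz]; first exact: ZD1_0.
by have [h|h] := Z.lt_ge_cases z 0; [apply: ZD1_lt | apply: ZD1_gt]; lia.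
Qed.

Lemma zspec_gt1P X j z : 1 < j ->
  zspec_gt1 j z (zphi X j z) (zeps X j z) (zf X j z).
Proof.
move=> j1.
have other : z <> - j -> z <> 1 - j -> z <> j - 1 -> z <> j ->
    zspec_gt1 j z 0 0 (z + 1).
  move=> *; have [h|h] := Z.lt_ge_cases z (- j); first by apply: Zgt_lt.
  have [h'|h'] := Z.lt_ge_cases z j; last by apply: Zgt_gt; lia.
  by apply: Zgt_mid; lia.
case: X.
  by case: (zspecBP z (Z.lt_le_incl _ _ j1)) => *; first
    [exact: other | constructor; lia | lia].
by case: (zspecDP z (Z.lt_le_incl _ _ j1)) => *; first
  [exact: other | constructor; lia | lia].
Qed.

(* The disjuncts are the cases B1-B7 of type B, resp. B1-B8 of type D, with
   columns (k0|k1) and (e0|e1). *)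
Definition zbumpB (n c k0 k1 e0 e1 d : Z) : Prop :=
  (k0 < c /\ c <= k1 /\ - n <= k0 /\ k1 <= n /\ k0 + k1 <> 0 /\
    ~ (c = 0 /\ k1 = 0) /\ e0 = k0 /\ e1 = c /\ d = k1) \/
  (c <= k0 /\ k0 < k1 /\ - n <= c /\ k1 <= n /\ c + k1 <> 0 /\
    ~ (c = 0 /\ k0 = 0) /\ e0 = c /\ e1 = k1 /\ d = k0) \/
  (c = 0 /\ k0 = 0 /\ 0 < k1 /\ k1 <= n /\ e0 = 0 /\ e1 = 0 /\ d = k1) \/
  (c < 0 /\ - n <= c /\ k0 = 0 /\ k1 = 0 /\ e0 = c /\ e1 = 0 /\ d = 0) \/
  (k0 + k1 = 0 /\ k0 < 0 /\ k0 <= c /\ c <= k1 /\ - n < k0 /\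
    e0 = k0 - 1 /\ e1 = c /\ d = k1 + 1) \/
  (c + k1 = 0 /\ - n <= c /\ c < -1 /\ c < k0 /\ k0 < k1 /\ e0 = c + 1 /\ e1 = k1 - 1 /\
    d = k0) \/
  (c = -1 /\ k0 = 0 /\ k1 = 1 /\ 1 <= n /\ e0 = -1 /\ e1 = 0 /\ d = 1).

(** The value 0 is still allowed; together with the nonvanishing required in [zbumpD] the pair
    consists of n and n-bar in some order. *)
Definition znpair a b := a + b = 0 /\ -1 <= a <= 1.

Definition zbumpD (n c k0 k1 e0 e1 d : Z) : Prop :=
  c <> 0 /\ k0 <> 0 /\ k1 <> 0 /\ (
  (k0 < c /\ c <= k1 /\ - n <= k0 /\ k1 <= n /\ k0 + k1 <> 0 /\
    ~ (k0 = -1 /\ c = 1) /\ ~ (c = -1 /\ k1 = 1) /\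
    e0 = k0 /\ e1 = c /\ d = k1) \/
  (c <= k0 /\ k0 < k1 /\ - n <= c /\ k1 <= n /\ c + k1 <> 0 /\
    ~ (c = -1 /\ k0 = 1) /\ ~ (k0 = -1 /\ k1 = 1) /\
    e0 = c /\ e1 = k1 /\ d = k0) \/
  (k0 + k1 = 0 /\ k0 < -1 /\ k0 <= c /\ c <= k1 /\ - n < k0 /\
    e0 = k0 - 1 /\ e1 = c /\ d = k1 + 1) \/
  (c + k1 = 0 /\ - n <= c /\ c < -2 /\ c < k0 /\ k0 < k1 /\ e0 = c + 1 /\ e1 = k1 - 1 /\
    d = k0) \/
  (- n <= c /\ c < -1 /\ znpair k0 k1 /\ e0 = c /\ e1 = k1 /\ d = k0) \/
  (1 < k1 /\ k1 <= n /\ znpair k0 c /\ e0 = k0 /\ e1 = c /\ d = k1) \/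
  (c = -2 /\ k1 = 2 /\ -1 <= k0 <= 1 /\ e0 = k0 /\ e1 = - k0 /\ d = k0) \/
  (znpair k0 k1 /\ c = k1 /\ e0 = -2 /\ e1 = k1 /\ d = 2)).

Definition zbump X :=
  match X with typeB => zbumpB | typeD => zbumpD end.

Definition zbump_words X n (u v : seq Z) : Prop :=
  exists c k0 k1 e0 e1 d,
    [/\ u = [:: k0; k1; c], v = [:: d; e0; e1] & zbump X n c k0 k1 e0 e1 d].

Lemma zbumpB1_link n c k0 k1 e0 e1 d : 1 <= n ->
  zbumpB n c k0 k1 e0 e1 d ->
  word_link (zphi typeB 1) (zeps typeB 1) (zf typeB 1)
    [:: k0; k1; c] [:: d; e0; e1] (zbump_words typeB n).
Proof.
move=> n1; have spec t := zspecB1P t.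
rewrite /word_link /=.
case=> [H|[H|[H|[H|[H|[H|H]]]]]]; decompose [and] H => {H}; subst d e0 e1;
repeat match goal with |- context [zphi typeB 1 ?t] => split_letter spec t end.
all: clear spec; split=> //; move=> u' [] // <-.
all: eexists; first reflexivity.
(* The six codes are read off the computed words by unification; which case of the insertion they
   satisfy is left to the search [solve_or]. *)
all: do 6 eexists.
all: split; [reflexivity|reflexivity|].
all: solve_or.
Qed.

(** The cases are not stable one by one. For a letter inserted strictly between i+1 and its bar, f_i
    turns the column with entries i and (i+1)-bar, an instance of B1, into the column with entries
    i+1 and (i+1)-bar, an instance of B5. Hence the conclusion only asks for some case. *)
Lemma zbumpB_gt1_link n j c k0 k1 e0 e1 d : 1 < j <= n ->
  zbumpB n c k0 k1 e0 e1 d ->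
  word_link (zphi typeB j) (zeps typeB j) (zf typeB j)
    [:: k0; k1; c] [:: d; e0; e1] (zbump_words typeB n).
Proof.
move=> [j1 jn]; have spec t := zspec_gt1P typeB t j1.
rewrite /word_link /=.
case=> [H|[H|[H|[H|[H|[H|H]]]]]]; decompose [and] H => {H}; subst d e0 e1;
repeat match goal with |- context [zphi typeB j ?t] => split_letter spec t end.
all: clear spec; split=> //; move=> u' [] // <-.
all: eexists; first reflexivity.
all: do 6 eexists.
all: split; [reflexivity|reflexivity|].
all: solve_or.
Qed.

Lemma zbumpB_link n j c k0 k1 e0 e1 d : 1 <= j <= n ->
  zbumpB n c k0 k1 e0 e1 d ->
  word_link (zphi typeB j) (zeps typeB j) (zf typeB j)
    [:: k0; k1; c] [:: d; e0; e1] (zbump_words typeB n).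
Proof.
move=> [j1 jn]; case: (Z.eq_dec j 1) => [Ej|nj].
  by subst j; exact: zbumpB1_link.
by apply: zbumpB_gt1_link; lia.
Qed.

Lemma zbumpD1_link n c k0 k1 e0 e1 d : 3 <= n ->
  zbumpD n c k0 k1 e0 e1 d ->
  word_link (zphi typeD 1) (zeps typeD 1) (zf typeD 1)
    [:: k0; k1; c] [:: d; e0; e1] (zbump_words typeD n).
Proof.
move=> n3; have spec t := zspecD1P t.
rewrite /word_link /=.
case=> [nc [n0 [n1 [H|[H|[H|[H|[H|[H|[H|H]]]]]]]]]]; rewrite /znpair in H; decompose [and] H => {H}; subst d e0 e1;
repeat match goal with |- context [zphi typeD 1 ?t] => split_letter spec t end.
all: clear spec; split=> //; move=> u' [] // <-.
all: eexists; first reflexivity.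
all: do 6 eexists.
all: split; [reflexivity|reflexivity|].
all: do 3 (split; first xlia zchecker).
all: rewrite /znpair; solve_or.
Qed.

(* For j = 2, f_j may turn an instance of one case of the insertion into an
   instance of another. *)
Lemma zbumpD_gt1_link n j c k0 k1 e0 e1 d : 3 <= n -> 1 < j <= n ->
  zbumpD n c k0 k1 e0 e1 d ->
  word_link (zphi typeD j) (zeps typeD j) (zf typeD j)
    [:: k0; k1; c] [:: d; e0; e1] (zbump_words typeD n).
Proof.
move=> n3 [j1 jn]; have spec t := zspec_gt1P typeD t j1.
rewrite /word_link /=.
case=> [nc [n0 [n1 [H|[H|[H|[H|[H|[H|[H|H]]]]]]]]]]; rewrite /znpair in H; decompose [and] H => {H}; subst d e0 e1;
repeat match goal with |- context [zphi typeD j ?t] => split_letter spec t end.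
all: clear spec; split=> //; move=> u' [] // <-.
all: eexists; first reflexivity.
all: do 6 eexists.
all: split; [reflexivity|reflexivity|].
all: do 3 (split; first xlia zchecker).
all: rewrite /znpair; case: (Z.eq_dec j 2) => ?; prune; solve_or.
Qed.

Lemma zbumpD_link n j c k0 k1 e0 e1 d : 3 <= n -> 1 <= j <= n ->
  zbumpD n c k0 k1 e0 e1 d ->
  word_link (zphi typeD j) (zeps typeD j) (zf typeD j)
    [:: k0; k1; c] [:: d; e0; e1] (zbump_words typeD n).
Proof.
move=> n3 [j1 jn]; case: (Z.eq_dec j 1) => [Ej|nj].
  by subst j; exact: zbumpD1_link.
by apply: zbumpD_gt1_link; lia.
Qed.

End ZSpec.

(** * Letters and their codes *)

Section Letters.
Variables (X : affine_type) (n : nat).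
Local Notation A := (alphabet X n).

Definition zcode (c : letter) : Z :=
  match c with
  | Pos x => Z.of_nat x - Z.of_nat n.+1
  | Circ => 0
  | Bar x => Z.of_nat n.+1 - Z.of_nat x
  end%Z.

Definition zletter (z : Z) : letter :=
  (if z <? 0 then Pos (Z.to_nat (z + Z.of_nat n.+1))
   else if z =? 0 then Circ else Bar (Z.to_nat (Z.of_nat n.+1 - z)))%Z.

(** In type D the code 0 is a gap between n and n-bar. *)
Definition zvalid (z : Z) : Prop :=
  (- Z.of_nat n <= z <= Z.of_nat n /\ (X = typeD -> z <> 0))%Z.

Lemma mem_zcode c : c \in A -> zvalid (zcode c).
Proof.
rewrite /zvalid; case: c => [x||x]; rewrite ?mem_Pos ?mem_Bar ?mem_Circ /=.
- by move=> ?; split=> [|_]; lia.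
- by move=> h; split; [lia | move=> XD; move: h; rewrite XD].
- by move=> ?; split=> [|_]; lia.
Qed.

Lemma zletterK z : (- Z.of_nat n.+1 <= z <= Z.of_nat n.+1)%Z ->
  zcode (zletter z) = z.
Proof.
rewrite /zletter => zr; case: Z.ltb_spec => /= h; first lia.
by case: Z.eqb_spec => /= h'; lia.
Qed.

Lemma mem_zletter z : zvalid z -> zletter z \in A.
Proof.
rewrite /zletter => -[zr zD]; case: Z.ltb_spec => /= h.
  by rewrite mem_Pos; lia.
case: Z.eqb_spec => /= h'; last by rewrite mem_Bar; lia.
by rewrite mem_Circ; case: X zD => // /(_ erefl).
Qed.

Lemma zcodeK c : c \in A -> zletter (zcode c) = c.
Proof.
rewrite /zletter; case: c => [x||x]; rewrite ?mem_Pos ?mem_Bar //= => xr.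
  by case: Z.ltb_spec => h; [congr Pos|]; lia.
case: Z.ltb_spec => h; first lia.
by case: Z.eqb_spec => h'; [|congr Bar]; lia.
Qed.

Lemma zcode_inj c c' : c \in A -> c' \in A -> zcode c = zcode c' -> c = c'.
Proof. by move=> /zcodeK {2}<- /zcodeK {2}<- ->. Qed.

(** One order of the incomparable pair suffices: codes place n before n-bar, so the opposite
    comparison already fails. *)
Definition zincomp (x y : Z) : Prop := (X = typeD /\ x = -1 /\ y = 1)%Z.

Lemma zcode_Pos_n c : c \in A -> (zcode c = -1)%Z <-> c = Pos n.
Proof.
case: c => [x||x]; rewrite ?mem_Pos ?mem_Bar /= => xr; split => // h.
- by congr Pos; lia.
- by case: h; lia.
- lia.
Qed.

Lemma zcode_Bar_n c : c \in A -> (zcode c = 1)%Z <-> c = Bar n.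
Proof.
case: c => [x||x]; rewrite ?mem_Pos ?mem_Bar /= => xr; split => // h.
- lia.
- by congr Bar; lia.
- by case: h; lia.
Qed.

Lemma index_zcode c : c \in A -> Z.of_nat (index c A) =
  (zcode c + Z.of_nat n - (if X is typeD then (if zcode c <? 0 then 0 else 1) else 0))%Z.
Proof.
case: c => [x||x] xA; move: (xA); rewrite ?mem_Pos ?mem_Bar ?mem_Circ /= => xr.
- rewrite index_Pos //; case: X => /=; first lia.
  by case: Z.ltb_spec; lia.
- move: xr; case XE: X => // _; rewrite -XE index_Circ //=; lia.
- rewrite index_Bar //; case: X => /=; first lia.
  by case: Z.ltb_spec; lia.
Qed.

Lemma lltP a b : llt X n a b <->
  [/\ a \in A, b \in A, (zcode a < zcode b)%Z & ~ zincomp (zcode a) (zcode b)].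
Proof.
have aux : a \in A -> b \in A -> index a A < index b A <-> (zcode a < zcode b)%Z.
  move=> aA bA; have := index_zcode aA; have := index_zcode bA.
  have [_ ha] := mem_zcode aA; have [_ hb] := mem_zcode bA.
  case: X ha hb; first lia.
  by move=> /(_ erefl) ha /(_ erefl) hb; do 2 case: Z.ltb_spec; lia.
split.
  case/and3P=> lt_ab bA h; have aA : a \in A.
    by rewrite -index_mem; apply: ltn_trans lt_ab _; rewrite index_mem.
  split=> //; first exact/aux.
  move=> [XD [/(zcode_Pos_n aA) a1 /(zcode_Bar_n bA) b1]].
  by move: h; rewrite XD a1 b1 !eqxx.
case=> aA bA lt_ab h; apply/and3P; split=> //; first exact/aux.
case XE: X => //; apply/negP => /andP[/eqP a1 /eqP b1]; apply: h; split=> //.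
by split; [apply/(zcode_Pos_n aA) | apply/(zcode_Bar_n bA)].
Qed.

Lemma lleP a b : lle X n a b <->
  [/\ a \in A, b \in A, (zcode a <= zcode b)%Z & ~ zincomp (zcode a) (zcode b)].
Proof.
split.
  case/andP=> aA /orP[/eqP <-|/lltP[_ bA h1 h2]]; last by split=> //; lia.
  by split=> //; [lia | move=> [_ [-> ]]].
case=> aA bA h h'; apply/andP; split=> //; have [//|nab] := eqVneq a b.
rewrite /=; apply/lltP; split=> //.
suff: zcode a <> zcode b by lia.
by move=> /zcode_inj E; rewrite E // eqxx in nab.
Qed.

Lemma bar_pairP a c : a \in A -> c \in A ->
  bar_pair a c <-> (zcode a < 0 /\ zcode a + zcode c = 0)%Z.
Proof.
rewrite /bar_pair; case: a => [x||x]; case: c => [y||y]; rewrite ?mem_Pos ?mem_Bar /= => xA yA;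
  split=> //; lia.
Qed.

Definition lphi (i : nat) (c : letter) : nat :=
  zphi X (Z.of_nat n.+1 - Z.of_nat i) (zcode c).
Definition leps (i : nat) (c : letter) : nat :=
  zeps X (Z.of_nat n.+1 - Z.of_nat i) (zcode c).
Definition lf (i : nat) (c : letter) : letter :=
  zletter (zf X (Z.of_nat n.+1 - Z.of_nat i) (zcode c)).

Hypothesis n2 : 2 < n.
Variable i : nat.
Hypothesis ir : 0 < i <= n.
Local Notation j := (Z.of_nat n.+1 - Z.of_nat i)%Z.

(** Staying in range makes the result the code of a letter; the strict growth later makes [height]
    increase along every arrow. *)
Lemma zf_bounds z : 0 < zphi X j z ->
  (- Z.of_nat n <= z /\ zf X j z <= Z.of_nat n /\ z < zf X j z)%Z.
Proof.
have j1 : (1 <= j)%Z by lia.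
by case: X; [case: (zspecBP z j1) | case: (zspecDP z j1)]; lia.
Qed.

Lemma zcode_lf c : 0 < lphi i c -> zcode (lf i c) = zf X j (zcode c).
Proof. by move=> /zf_bounds h; rewrite zletterK //; lia. Qed.

Lemma lf_sig c : 0 < lphi i c ->
  lphi i c = (lphi i (lf i c)).+1 /\ leps i (lf i c) = (leps i c).+1.
Proof.
move=> h; rewrite /lphi /leps zcode_lf //; move: h; rewrite /lphi.
have j1 : (1 <= j)%Z by lia.
case: X; [case: (zspecBP (zcode c) j1) | case: (zspecDP (zcode c) j1)] => // *;
  match goal with |- context [zphi _ _ ?t] =>
    try case: (zspecBP t j1); try case: (zspecDP t j1) end; lia.
Qed.

Lemma lf_mem c : c \in A -> 0 < lphi i c -> lf i c \in A.
Proof.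
move=> /mem_zcode h ph; apply: mem_zletter.
have := zf_bounds ph; case: h => h1 h2 h3; split; first lia.
move=> XD; move: ph (h2 XD); rewrite /lphi XD.
have j1 : (1 <= j)%Z by lia.
by case: (zspecDP (zcode c) j1); lia.
Qed.

Local Notation wph := (wphi (lphi i) (leps i)).
Local Notation wep := (weps (lphi i) (leps i)).
Local Notation wff := (wf (lphi i) (leps i) (lf i)).
Local Notation link := (word_link (lphi i) (leps i) (lf i)).

Lemma weps_zcode u : weps (zphi X j) (zeps X j) (map zcode u) = wep u.
Proof. by elim: u => //= c u ->. Qed.

Lemma wphi_zcode u : wphi (zphi X j) (zeps X j) (map zcode u) = wph u.
Proof. by elim: u => //= c u ->; rewrite weps_zcode. Qed.

Lemma wf_zcode u : wf (zphi X j) (zeps X j) (zf X j) (map zcode u) =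
  omap (map zcode) (wff u).
Proof.
elim: u => //= c u ->; rewrite weps_zcode; case: ifP => h.
  by rewrite /= zcode_lf //; exact: leq_ltn_trans h.
by case: (wff u).
Qed.

Lemma wf_mem u u' : wff u = Some u' -> {subset u <= A} -> {subset u' <= A}.
Proof.
elim: u u' => //= c u IH u'; case: ifP => h.
  move=> [<-] uA d; rewrite inE => /orP[/eqP ->|du].
    by apply: lf_mem; [apply: uA; rewrite inE eqxx | apply: leq_ltn_trans h].
  by apply: uA; rewrite inE du orbT.
case E: (wff u) => [v|] //= [<-] uA d; rewrite inE => /orP[/eqP ->|].
  by apply: uA; rewrite inE eqxx.
by apply: IH => // e eu; apply: uA; rewrite inE eu orbT.
Qed.

End Letters.

(** * Two-letter words: bumping against stacking in a one-box column *)

Section ZRow.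
Open Scope Z_scope.

(** The condition for c to bump k out of a one-box column by B0; its negation is the condition for c
    to be stacked below k by A1. *)
Definition zrow (X : affine_type) (k c : Z) : Prop :=
  c <= k /\ match X with
            | typeB => ~ (c = 0 /\ k = 0)
            | typeD => ~ (c = -1 /\ k = 1)
            end.

(** Each alternative is a union of components of the crystal of two-letter words, so no arrow turns
    bumping into stacking or conversely. *)
Lemma zrow_stable X j k c w : 1 <= j -> (X = typeD -> k <> 0 /\ c <> 0) ->
  wf (zphi X j) (zeps X j) (zf X j) [:: k; c] = Some w ->
  exists k' c', w = [:: k'; c'] /\ (zrow X k c <-> zrow X k' c').
Proof.
move=> j1; rewrite /zrow; case: X => /=.
  move=> _; destruct (zspecBP k j1); prune; destruct (zspecBP c j1); prune;
  rewrite /=; case=> // <-;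
  do 2 eexists; (split; first reflexivity); xlia zchecker.
move=> /(_ erefl) [k0 c0].
destruct (zspecDP k j1); prune; destruct (zspecDP c j1); prune;
  rewrite /=; case=> // <-;
  do 2 eexists; (split; first reflexivity); xlia zchecker.
Qed.
End ZRow.

Section Bump.
Variables (X : affine_type) (n : nat).
Local Notation A := (alphabet X n).
Local Notation zc := (zcode n).

Lemma npairP a b : npair n a b <->
  (a = Pos n /\ b = Bar n) \/ (a = Bar n /\ b = Pos n).
Proof.
by split; move=> [[-> ->]|[-> ->]]; [left|right|left|right].
Qed.

Lemma zcode_Circ c : c \in A -> (zc c = 0)%Z <-> c = Circ.
Proof.
case: c => [x||x]; rewrite ?mem_Pos ?mem_Bar /= => xr; split => // h; lia.
Qed.

Lemma zcode_neg c : c \in A -> (zc c < 0)%Z ->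
  exists2 x, 0 < x <= n & c = Pos x /\ zc c = (Z.of_nat x - Z.of_nat n.+1)%Z.
Proof.
by case: c => [x||x]; rewrite ?mem_Pos ?mem_Bar /= => xr h; try lia; exists x.
Qed.

Lemma zcode_pos c : c \in A -> (0 < zc c)%Z ->
  exists2 x, 0 < x <= n & c = Bar x /\ zc c = (Z.of_nat n.+1 - Z.of_nat x)%Z.
Proof.
by case: c => [x||x]; rewrite ?mem_Pos ?mem_Bar /= => xr h; try lia; exists x.
Qed.

End Bump.

Section BumpOne.
Variables (X : affine_type) (n : nat).
Local Notation A := (alphabet X n).
Local Notation zc := (zcode n).
Hypothesis n2 : 2 < n.

Lemma bump_one c k K' d : Defs.bump X n c [:: k] K' d <->
  [/\ K' = [:: c], d = k, k \in A, c \in A & zrow X (zc k) (zc c)].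
Proof.
rewrite /Defs.bump /zrow; case: X; split.
- move E: [:: k] => K H; case: H E => // a b /lleP[aA bA h _] nb [->].
  by split=> //; split=> // -[/(zcode_Circ aA) Ea /(zcode_Circ bA) Eb];
    apply: nb; rewrite Ea Eb.
- case=> -> -> kA cA [le_ck h]; constructor.
    by apply/lleP; split=> //; case.
  by move=> [Ec Ek]; apply: h; rewrite Ec Ek.
- move E: [:: k] => K H; case: H E => // a b /lleP[aA bA h nab] [->].
  by split=> //; split=> // hab; apply: nab.
- case=> -> -> kA cA [le_ck h]; constructor.
  by apply/lleP; split=> //; case=> _; apply: h.
Qed.

Lemma stacksP a b : stacks X n a b <->
  [/\ a \in A, b \in A & ~ zrow X (zc a) (zc b)].
Proof.
rewrite /stacks /zrow; case: X; split.
- case=> [/lltP[aA bA h1 h2]|[-> ->]]; first by split=> // -[h _]; lia.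
  by split; rewrite ?mem_Circ // => -[_]; apply.
- case=> aA bA h; have [lt_ab|le_ba] := Z.lt_ge_cases (zc a) (zc b).
    by left; apply/lltP; split=> //; case.
  have [h1 h2] : (zc a = 0 /\ zc b = 0)%Z by lia.
  by right; move/(zcode_Circ aA): h1 => ->; move/(zcode_Circ bA): h2 => ->.
- case=> [/lltP[aA bA h1 h2]|/npairP[[-> ->]|[-> ->]]].
  + by split=> // -[h _]; lia.
  + by rewrite mem_Pos mem_Bar; split=> /=; lia.
  by rewrite mem_Pos mem_Bar; split=> /=; lia.
case=> aA bA h; have [lt_ab|le_ba] := Z.lt_ge_cases (zc a) (zc b).
  have [[ha hb]|hab] : (zc a = -1 /\ zc b = 1 \/ ~ (zc a = -1 /\ zc b = 1))%Z
    by lia.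
    by right; left; congr pair; [apply/(zcode_Pos_n aA) | apply/(zcode_Bar_n bA)].
  by left; apply/lltP; split=> //; case.
have [h1 h2] : (zc b = -1 /\ zc a = 1)%Z by lia.
by right; right; congr pair; [apply/(zcode_Bar_n aA) | apply/(zcode_Pos_n bA)].
Qed.

Lemma znpairP a b : a \in A -> b \in A -> znpair (zc a) (zc b) ->
   (X = typeD) -> npair n a b.
Proof.
move=> aA bA [h1 h2] XD; apply/npairP.
have [_ /(_ XD) a0] := mem_zcode aA.
have [E|E] : (zc a = -1 \/ zc a = 1)%Z by lia.
  by left; split; [apply/(zcode_Pos_n aA) | apply/(zcode_Bar_n bA); lia].
by right; split; [apply/(zcode_Bar_n aA) | apply/(zcode_Pos_n bA); lia].
Qed.

Lemma npair_zcode a b : npair n a b ->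
  [/\ a \in A, b \in A & (znpair (zc a) (zc b) /\ zc a <> 0)%Z].
Proof.
case/npairP=> -[-> ->]; rewrite mem_Pos mem_Bar /znpair /=.
  by split; lia.
by split; lia.
Qed.

Definition zbump_letters c k0 k1 e0 e1 d : Prop :=
  all (mem A) [:: c; k0; k1; e0; e1; d] /\
  zbump X (Z.of_nat n) (zc c) (zc k0) (zc k1) (zc e0) (zc e1) (zc d).

End BumpOne.

(** * Translation of the two-box steps between letters and codes *)

Lemma mem_codeB n c : c \in alphabet typeB n ->
  (- Z.of_nat n <= zcode n c <= Z.of_nat n)%Z.
Proof. by case/mem_zcode. Qed.

Lemma mem_codeD n c : c \in alphabet typeD n ->
  (- Z.of_nat n <= zcode n c <= Z.of_nat n /\ zcode n c <> 0)%Z.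
Proof. by case/mem_zcode => ? /(_ erefl). Qed.

Lemma Circ_codes n b c : b \in alphabet typeB n -> c \in alphabet typeB n ->
  (b, c) <> (Circ, Circ) -> ~ (zcode n b = 0 /\ zcode n c = 0)%Z.
Proof.
by move=> bA cA h [/(zcode_Circ bA) Eb /(zcode_Circ cA) Ec]; apply: h; rewrite Eb Ec.
Qed.

Lemma bar_codes X n a c : a \in alphabet X n -> c \in alphabet X n ->
  ~~ bar_pair a c -> ~ (zcode n a < 0 /\ zcode n a + zcode n c = 0)%Z.
Proof. by move=> aA cA /negP h /(bar_pairP aA cA). Qed.

Lemma bump_twoB n c k0 k1 K' d : 2 < n -> bumpB typeB n c [:: k0; k1] K' d ->
  exists e0 e1, K' = [:: e0; e1] /\ zbump_letters typeB n c k0 k1 e0 e1 d.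
Proof.
rewrite /zbump_letters => n2; move E: [:: k0; k1] => K H.
case: H E => //.
- move=> a b g /lltP[aA bA h1 _] /lleP[_ gA h2 _] /(bar_codes aA gA) h3.
  move=> /(Circ_codes bA gA) h4 [-> ->]; exists a, b; split=> //.
  have := mem_codeB aA; have := mem_codeB gA; rewrite /= aA bA gA; split=> //.
  left; lia.
- move=> a b g /lleP[aA bA h1 _] /lltP[_ gA h2 _] /(bar_codes aA gA) h3.
  move=> /(Circ_codes aA bA) h4 [-> ->]; exists a, g; split=> //.
  have := mem_codeB aA; have := mem_codeB gA; rewrite /= aA bA gA; split=> //.
  right; left; lia.
- move=> x xr [-> ->]; exists Circ, Circ; split=> //.
  rewrite /= mem_Circ mem_Bar xr; split=> //.
  do 2 right; left; lia.
- move=> x xr [-> ->]; exists (Pos x), Circ; split=> //.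
  rewrite /= mem_Circ mem_Pos xr; split=> //.
  do 3 right; left; lia.
- move=> x b xr /lleP[_ bA h1 _] /lleP[_ _ h2 _] x1 [-> ->].
  exists (Pos x.-1), b; split=> //.
  rewrite /= !mem_Pos !mem_Bar bA; split; first by lia.
  move: h1 h2 => /= h1 h2.
  do 4 right; left; lia.
- move=> x b xr /lltP[_ bA h1 _] /lltP[_ _ h2 _] x1 [-> ->].
  exists (Pos x.+1), (Bar x.+1); split=> //.
  rewrite /= !mem_Pos !mem_Bar bA; split; first by lia.
  move: h1 h2 => /= h1 h2.
  do 5 right; left; lia.
move=> [-> ->]; exists (Pos n), Circ; split=> //.
rewrite /= mem_Pos mem_Bar mem_Circ; split; first by lia.
do 6 right; lia.
Qed.

Lemma zbumpB_bump n c k0 k1 e0 e1 d : 2 < n ->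
  zbump_letters typeB n c k0 k1 e0 e1 d -> bumpB typeB n c [:: k0; k1] [:: e0; e1] d.
Proof.
move=> n2 []; rewrite /= andbT => /and5P[cA k0A k1A e0A /andP[e1A dA]].
have eq_letter a b : a \in alphabet typeB n -> b \in alphabet typeB n ->
  zcode n a = zcode n b -> a = b by exact: zcode_inj.
have := mem_codeB cA; have := mem_codeB k0A; have := mem_codeB k1A.
move=> bk1 bk0 bc.
have zi x y : ~ zincomp typeB x y by case.
case=> [H|[H|[H|[H|[H|[H|H]]]]]].
- have [E0 [E1 E2]] : e0 = k0 /\ e1 = c /\ d = k1.
    by split; [|split]; apply: eq_letter => //; lia.
  subst e0 e1 d; constructor.
  + by apply/lltP; split=> //; lia.
  + by apply/lleP; split=> //; lia.
  + by apply/negP => /(bar_pairP k0A k1A); lia.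
  by case=> Ec Ek; move: H; rewrite Ec Ek /=; lia.
- have [E0 [E1 E2]] : e0 = c /\ e1 = k1 /\ d = k0.
    by split; [|split]; apply: eq_letter => //; lia.
  subst e0 e1 d; constructor.
  + by apply/lleP; split=> //; lia.
  + by apply/lltP; split=> //; lia.
  + by apply/negP => /(bar_pairP cA k1A); lia.
  by case=> Ec Ek; move: H; rewrite Ec Ek /=; lia.
- have [x xr [Ek1 _]] := zcode_pos k1A ltac:(lia).
  have [Ec Ek0] : c = Circ /\ k0 = Circ by split; apply/(@zcode_Circ typeB n) => //; lia.
  have [Ee0 Ee1] : e0 = Circ /\ e1 = Circ by split; apply/(@zcode_Circ typeB n) => //; lia.
  have Ed : d = k1 by apply: eq_letter => //; lia.
  by subst; constructor.
- have [x xr [Ec _]] := zcode_neg cA ltac:(lia).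
  have [Ek0 Ek1] : k0 = Circ /\ k1 = Circ by split; apply/(@zcode_Circ typeB n) => //; lia.
  have [Ed Ee1] : d = Circ /\ e1 = Circ by split; apply/(@zcode_Circ typeB n) => //; lia.
  have Ee0 : e0 = c by apply: eq_letter => //; lia.
  by subst; constructor.
- have [x xr [Ek0 Zk0]] := zcode_neg k0A ltac:(lia).
  have Ek1 : k1 = Bar x by apply: eq_letter => //; rewrite ?mem_Bar //=; lia.
  have Ee0 : e0 = Pos x.-1 by apply: eq_letter => //; rewrite ?mem_Pos //=; lia.
  have Ed : d = Bar x.-1 by apply: eq_letter => //; rewrite ?mem_Bar //=; lia.
  have Ee1 : e1 = c by apply: eq_letter => //; lia.
  subst; constructor=> //; last lia.
  + by apply/lleP; split=> //; lia.
  + by apply/lleP; split=> //; lia.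
- have [x xr [Ec Zc]] := zcode_neg cA ltac:(lia).
  have Ek1 : k1 = Bar x by apply: eq_letter => //; rewrite ?mem_Bar //=; lia.
  have Ee0 : e0 = Pos x.+1 by apply: eq_letter => //; rewrite ?mem_Pos //=; lia.
  have Ee1 : e1 = Bar x.+1 by apply: eq_letter => //; rewrite ?mem_Bar //=; lia.
  have Ed : d = k0 by apply: eq_letter => //; lia.
  subst; constructor=> //; last lia.
  + by apply/lltP; split=> //; lia.
  + by apply/lltP; split=> //; lia.
have Pn : Pos n \in alphabet typeB n by rewrite mem_Pos; lia.
have Bn : Bar n \in alphabet typeB n by rewrite mem_Bar; lia.
have Cn : Circ \in alphabet typeB n by rewrite mem_Circ.
have -> : c = Pos n by apply: eq_letter => //=; move: H; clear; lia.
have -> : k0 = Circ by apply: eq_letter => //=; move: H; clear; lia.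
have -> : k1 = Bar n by apply: eq_letter => //=; move: H; clear; lia.
have -> : e0 = Pos n by apply: eq_letter => //=; move: H; clear; lia.
have -> : e1 = Circ by apply: eq_letter => //=; move: H; clear; lia.
have -> : d = Bar n by apply: eq_letter => //=; move: H; clear; lia.
exact: bumpB7.
Qed.

Lemma bump_twoD n c k0 k1 K' d : 2 < n -> bumpD typeD n c [:: k0; k1] K' d ->
  exists e0 e1, K' = [:: e0; e1] /\ zbump_letters typeD n c k0 k1 e0 e1 d.
Proof.
rewrite /zbump_letters => n2; move E: [:: k0; k1] => K H.
have zi x y : ~ zincomp typeD x y -> ~ (x = -1 /\ y = 1)%Z.
  by move=> h hxy; apply: h.
case: H E => //.
- move=> a b g /lltP[aA bA h1 /zi h1'] /lleP[_ gA h2 /zi h2'].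
  move=> /(bar_codes aA gA) h3 [-> ->]; exists a, b; split=> //.
  have [? ?] := mem_codeD aA; have [? ?] := mem_codeD gA.
  have [? ?] := mem_codeD bA.
  rewrite /= aA bA gA; split=> //; do 3 (split; first by []).
  left; lia.
- move=> a b g /lleP[aA bA h1 /zi h1'] /lltP[_ gA h2 /zi h2'].
  move=> /(bar_codes aA gA) h3 [-> ->]; exists a, g; split=> //.
  have [? ?] := mem_codeD aA; have [? ?] := mem_codeD gA.
  have [? ?] := mem_codeD bA.
  rewrite /= aA bA gA; split=> //; do 3 (split; first by []).
  right; left; lia.
- move=> x b xr /lleP[_ bA h1 _] /lleP[_ _ h2 _] xn x1 [-> ->].
  exists (Pos x.-1), b; split=> //.
  have [? ?] := mem_codeD bA.
  rewrite /= !mem_Pos !mem_Bar bA; split; first by lia.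
  move: h1 h2 => /= h1 h2; do 3 (split; first lia).
  do 2 right; left; lia.
- move=> x b xr /lltP[_ bA h1 _] /lltP[_ _ h2 _] x1 xn [-> ->].
  exists (Pos x.+1), (Bar x.+1); split=> //.
  have [? ?] := mem_codeD bA.
  rewrite /= !mem_Pos !mem_Bar bA; split; first by lia.
  move: h1 h2 => /= h1 h2; do 3 (split; first lia).
  do 3 right; left; lia.
- move=> x mu1 mu2 xr /(@npair_zcode typeD n n2)[m1A m2A [[h1 h1'] h2]] xn [-> ->].
  exists (Pos x), mu2; split=> //.
  have [? ?] := mem_codeD m2A.
  rewrite /= !mem_Pos m1A m2A; split; first by lia.
  do 3 (split; first lia).
  rewrite /znpair; do 4 right; left; lia.
- move=> x mu1 mu2 xr /(@npair_zcode typeD n n2)[m1A m2A [[h1 h1'] h2]] xn [-> ->].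
  exists mu1, mu2; split=> //.
  have [? ?] := mem_codeD m2A.
  rewrite /= !mem_Bar m1A m2A; split; first by lia.
  do 3 (split; first lia).
  rewrite /znpair; do 5 right; left; lia.
- move=> mu mu' /(@npair_zcode typeD n n2)[m1A m2A [[h1 h1'] h2]] [-> ->].
  exists mu, mu'; split=> //.
  rewrite /= !mem_Bar !mem_Pos m1A m2A; split; first by lia.
  do 3 (split; first lia).
  do 6 right; left; lia.
move=> mu1 mu2 /(@npair_zcode typeD n n2)[m1A m2A [[h1 h1'] h2]] [-> ->].
exists (Pos n.-1), mu2; split=> //.
have [? ?] := mem_codeD m2A.
rewrite /= !mem_Bar !mem_Pos m1A m2A; split; first by lia.
do 3 (split; first lia).
rewrite /znpair; do 7 right; lia.
Qed.

Lemma zbumpD_bump n c k0 k1 e0 e1 d : 2 < n ->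
  zbump_letters typeD n c k0 k1 e0 e1 d ->
  bumpD typeD n c [:: k0; k1] [:: e0; e1] d.
Proof.
move=> n2 []; rewrite /= andbT => /and5P[cA k0A k1A e0A /andP[e1A dA]].
have eq_letter a b : a \in alphabet typeD n -> b \in alphabet typeD n ->
  zcode n a = zcode n b -> a = b by exact: zcode_inj.
have := mem_codeD cA; have := mem_codeD k0A; have := mem_codeD k1A.
move=> bk1 bk0 bc.
have zi x y : ~ (x = -1 /\ y = 1)%Z -> ~ zincomp typeD x y.
  by move=> h [_ hxy]; apply: h.
have np a b := @znpairP typeD n n2 a b.
case=> nc [n0 [n1 [H|[H|[H|[H|[H|[H|[H|H]]]]]]]]].
- have [E0 [E1 E2]] : e0 = k0 /\ e1 = c /\ d = k1.
    by split; [|split]; apply: eq_letter => //; lia.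
  subst e0 e1 d; constructor.
  + by apply/lltP; split=> //; [lia | apply: zi; lia].
  + by apply/lleP; split=> //; [lia | apply: zi; lia].
  by apply/negP => /(bar_pairP k0A k1A); lia.
- have [E0 [E1 E2]] : e0 = c /\ e1 = k1 /\ d = k0.
    by split; [|split]; apply: eq_letter => //; lia.
  subst e0 e1 d; constructor.
  + by apply/lleP; split=> //; [lia | apply: zi; lia].
  + by apply/lltP; split=> //; [lia | apply: zi; lia].
  by apply/negP => /(bar_pairP cA k1A); lia.
- have [x xr [Ek0 Zk0]] := zcode_neg k0A ltac:(lia).
  have Ek1 : k1 = Bar x by apply: eq_letter => //; rewrite ?mem_Bar //=; lia.
  have Ee0 : e0 = Pos x.-1 by apply: eq_letter => //; rewrite ?mem_Pos //=; lia.
  have Ed : d = Bar x.-1 by apply: eq_letter => //; rewrite ?mem_Bar //=; lia.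
  have Ee1 : e1 = c by apply: eq_letter => //; lia.
  subst; constructor=> //; try lia.
  + by apply/lleP; split=> //; [lia | apply: zi; lia].
  + by apply/lleP; split=> //; [lia | apply: zi; lia].
- have [x xr [Ec Zc]] := zcode_neg cA ltac:(lia).
  have Ek1 : k1 = Bar x by apply: eq_letter => //; rewrite ?mem_Bar //=; lia.
  have Ee0 : e0 = Pos x.+1 by apply: eq_letter => //; rewrite ?mem_Pos //=; lia.
  have Ee1 : e1 = Bar x.+1 by apply: eq_letter => //; rewrite ?mem_Bar //=; lia.
  have Ed : d = k0 by apply: eq_letter => //; lia.
  subst; constructor=> //; try lia.
  + by apply/lltP; split=> //; [lia | apply: zi; lia].
  + by apply/lltP; split=> //; [lia | apply: zi; lia].
- have [x xr [Ec Zc]] := zcode_neg cA ltac:(lia).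
  have Ee0 : e0 = c by apply: eq_letter => //; lia.
  have Ee1 : e1 = k1 by apply: eq_letter => //; lia.
  have Ed : d = k0 by apply: eq_letter => //; lia.
  subst; constructor=> //; [apply: np => //; tauto | lia].
- have [x xr [Ek1 Zk1]] := zcode_pos k1A ltac:(lia).
  have Ee0 : e0 = k0 by apply: eq_letter => //; lia.
  have Ee1 : e1 = c by apply: eq_letter => //; lia.
  have Ed : d = k1 by apply: eq_letter => //; lia.
  subst; constructor=> //; [apply: np => //; tauto | lia].
- have -> : c = Pos n.-1 by apply: eq_letter => //; rewrite ?mem_Pos //=; lia.
  have -> : k1 = Bar n.-1 by apply: eq_letter => //; rewrite ?mem_Bar //=; lia.
  have -> : e0 = k0 by apply: eq_letter => //; lia.
  have -> : d = k0 by apply: eq_letter => //; lia.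
  by constructor; apply: np => //; split; lia.
have Ec : c = k1 by apply: eq_letter => //; lia.
have Ee1 : e1 = k1 by apply: eq_letter => //; lia.
have -> : e0 = Pos n.-1 by apply: eq_letter => //; rewrite ?mem_Pos //=; lia.
have -> : d = Bar n.-1 by apply: eq_letter => //; rewrite ?mem_Bar //=; lia.
by rewrite Ec Ee1; constructor; apply: np => //; tauto.
Qed.

(** * Elementary steps as links of words *)

Section Links.
Variables (X : affine_type) (n : nat).
Hypothesis n2 : 2 < n.
Local Notation A := (alphabet X n).
Local Notation zc := (zcode n).

Lemma bump_two c k0 k1 K' d : Defs.bump X n c [:: k0; k1] K' d ->
  exists e0 e1, K' = [:: e0; e1] /\ zbump_letters X n c k0 k1 e0 e1 d.
Proof. by rewrite /Defs.bump; case: X; [exact: bump_twoB | exact: bump_twoD]. Qed.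

Lemma zbump_bump c k0 k1 e0 e1 d : zbump_letters X n c k0 k1 e0 e1 d ->
  Defs.bump X n c [:: k0; k1] [:: e0; e1] d.
Proof. by rewrite /Defs.bump; case: X; [exact: zbumpB_bump | exact: zbumpD_bump]. Qed.

Lemma bump_size c K K' d : Defs.bump X n c K K' d ->
  (size K = 1 \/ size K = 2) /\ size K' = size K.
Proof. by rewrite /Defs.bump; case: X => -[]; auto. Qed.

Variable i : nat.
Hypothesis ir : 0 < i <= n.
Local Notation wph := (wphi (lphi X n i) (leps X n i)).
Local Notation wep := (weps (lphi X n i) (leps X n i)).
Local Notation wff := (wf (lphi X n i) (leps X n i) (lf X n i)).
Local Notation link := (word_link (lphi X n i) (leps X n i) (lf X n i)).

Lemma zrow_wf k c w : k \in A -> c \in A -> wff [:: k; c] = Some w ->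
  exists k' c', [/\ w = [:: k'; c'], k' \in A, c' \in A &
    zrow X (zc k) (zc c) <-> zrow X (zc k') (zc c')].
Proof.
move=> kA cA E; have := wf_zcode X n2 ir [:: k; c]; rewrite E /= => Ez.
have j1 : (1 <= Z.of_nat n.+1 - Z.of_nat i)%Z by lia.
have vk := mem_zcode kA; have vc := mem_zcode cA.
have [|k' [c' [Ew h]]] := zrow_stable j1 _ Ez.
  by case: vk vc => _ hk [_ hc] XD; split; [apply: hk | apply: hc].
have wA := wf_mem n2 ir E.
have {}wA : {subset w <= A}.
  by apply: wA => x; rewrite !inE => /orP[/eqP->|/eqP->].
case: w Ew wA h {E Ez} => [|k'' [|c'' [|? ?]]] //= [<- <-] wA h.
by exists k'', c''; split=> //; apply: wA; rewrite !inE eqxx ?orbT.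
Qed.

(** The size of the column is recorded so that longer words can later be cut at the same places. *)
Definition bump_words (s : nat) (u v : seq letter) : Prop :=
  exists c K K' d, [/\ u = K ++ [:: c], v = d :: K', Defs.bump X n c K K' d
    & size K = s].

(** For a one-box column the words K c and d K' coincide, and only the stability of [zrow] is at
    stake. For two boxes the link is transferred from the codes. *)
Lemma bump_link c K K' d : Defs.bump X n c K K' d ->
  link (K ++ [:: c]) (d :: K') (bump_words (size K)).
Proof.
move=> H; have [[Ks|Ks] K's] := bump_size H; rewrite Ks in K's *.
  case: K Ks H => [|k []] // _ /(bump_one _ _ _ _ _ _)[-> -> kA cA hr].
  apply: link_refl => u /(zrow_wf kA cA)[k' [c' [-> k'A c'A h]]].
  exists c', [:: k'], [:: c'], k'; split=> //.
  by apply/bump_one; split=> //; apply/h.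
case: K Ks H => [|k0 [|k1 []]] // _ /bump_two[e0 [e1 [-> [hA hz]]]].
have j1 : (1 <= Z.of_nat n.+1 - Z.of_nat i <= Z.of_nat n)%Z by lia.
have [h1 h2 h3] : word_link (zphi X (Z.of_nat n.+1 - Z.of_nat i))
   (zeps X (Z.of_nat n.+1 - Z.of_nat i)) (zf X (Z.of_nat n.+1 - Z.of_nat i))
   (map zc [:: k0; k1; c]) (map zc [:: d; e0; e1])
   (zbump_words X (Z.of_nat n)).
  by move: hz; case: X; [exact: zbumpB_link | apply: zbumpD_link; lia].
rewrite !weps_zcode !wphi_zcode in h1 h2; split=> // u' E.
have := h3 (map zc u'); rewrite wf_zcode // E => /(_ erefl)[v''].
rewrite wf_zcode //; case Ev: (wff _) => [v'|] //= [Ev''].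
have u'A : {subset u' <= A}.
  apply: (wf_mem n2 ir E) => x; move/allP: hA => hA; rewrite !inE => hx.
  by apply: hA; rewrite !inE; case/or3P: hx => ->; rewrite ?orbT.
have v'A : {subset v' <= A}.
  apply: (wf_mem n2 ir Ev) => x; move/allP: hA => hA; rewrite !inE => hx.
  by apply: hA; rewrite !inE; case/or3P: hx => ->; rewrite ?orbT.
rewrite -Ev'' => -[zc' [zk0 [zk1 [ze0 [ze1 [zd [Eu Ev' hb]]]]]]].
exists v' => //.
case: u' Eu u'A {E} => [|k0' [|k1' [|c' [|? ?]]]] //= [Ek0 Ek1 Ec] u'A.
case: v' Ev' v'A {Ev Ev''} => [|d' [|e0' [|e1' [|? ?]]]] //= [Ed Ee0 Ee1] v'A.
exists c', [:: k0'; k1'], [:: e0'; e1'], d'; split=> //.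
apply: zbump_bump; split; last by rewrite Ek0 Ek1 Ec Ed Ee0 Ee1.
(* Each of the six letters occurs in one of the two image words, and these stay in the alphabet. *)
apply/allP => x; rewrite !inE => hx; have [xu|xu] := boolP (x \in [:: k0'; k1'; c']).
  exact: u'A.
apply: v'A; move: hx xu; rewrite !inE.
by do 6!case: (x == _).
Qed.

End Links.

(** * Insertion and inverse insertion *)

(* Columns are read from right to left, and each column from top to bottom. *)
Definition reading (T : tableau) : seq letter := flatten (rev T).

Lemma reading_cat T T' : reading (T ++ T') = reading T' ++ reading T.
Proof. by rewrite /reading rev_cat flatten_cat. Qed.

Lemma reading_cons K T : reading (K :: T) = reading T ++ K.
Proof. by rewrite -cat1s reading_cat /reading /= cats0. Qed.

Lemma reading_rcons T K : reading (rcons T K) = K ++ reading T.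
Proof. by rewrite -cats1 reading_cat /reading /= cats0. Qed.

Lemma size_reading T T' : shape T = shape T' ->
  size (reading T) = size (reading T').
Proof.
by move=> h; rewrite !size_flatten /shape !map_rev -!/(shape _) h.
Qed.

(** Equality of shapes is what makes a reading word determine its tableau; for this reason all the
    links below carry shapes. *)
Lemma reading_inj T T' : shape T = shape T' -> reading T = reading T' -> T = T'.
Proof.
elim: T T' => [|K T IH] [|K' T'] //= [hK hT].
rewrite !reading_cons => /eqP.
rewrite eqseq_cat ?(size_reading hT) // => /andP[/eqP E /eqP ->].
by rewrite (IH _ hT E).
Qed.

Lemma reading_surj T w : size w = size (reading T) ->
  exists T', shape T' = shape T /\ reading T' = w.
Proof.
elim: T w => [|K T IH] w /=; first by move/size0nil=> ->; exists [::].
rewrite reading_cons size_cat => highest_weight.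
have [|T' [hT' ET']] := IH (take (size (reading T)) w).
  by rewrite size_takel // highest_weight leq_addr.
exists (drop (size (reading T)) w :: T'); split.
  by rewrite /= hT' size_drop highest_weight addKn.
by rewrite reading_cons ET' cat_take_drop.
Qed.

Lemma eq_cat (T : Type) (s1 s2 t1 t2 : seq T) : size s1 = size t1 ->
  s1 ++ s2 = t1 ++ t2 -> s1 = t1 /\ s2 = t2.
Proof.
by elim: s1 t1 => [|x s1 IH] [|y t1] //= [/IH H] [-> /H[-> ->]].
Qed.

Section TableauLinks.
Variables (X : affine_type) (n : nat).
Hypothesis n2 : 2 < n.
Local Notation A := (alphabet X n).
Variable i : nat.
Hypothesis ir : 0 < i <= n.
Local Notation wff := (wf (lphi X n i) (leps X n i) (lf X n i)).
Local Notation link := (word_link (lphi X n i) (leps X n i) (lf X n i)).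

Lemma wf_reading T w : wff (reading T) = Some w ->
  exists T', shape T' = shape T /\ reading T' = w.
Proof. by move/wf_size; exact: reading_surj. Qed.

Lemma wf_size1 c w : wff [:: c] = Some w -> exists c', w = [:: c'].
Proof. by move/wf_size; case: w => [|c' []] // _; exists c'. Qed.

Definition insert_words (s s' : seq nat) (u v : seq letter) : Prop :=
  exists c T T', [/\ u = reading T ++ [:: c], v = reading T',
    Defs.insert X n c T T', shape T = s & shape T' = s'].

(** The inserted letter ends the word, next to the leftmost column K. Replacing K c by d K' brings d
    next to the remaining columns, so the induction follows the bumped letter through the word. In
    the cases A0 and A1 the word does not change. *)
Lemma insert_link c T T' : Defs.insert X n c T T' ->
  link (reading T ++ [:: c]) (reading T')
    (insert_words (shape T) (shape T')).
Proof.
elim=> {c T T'} [a aA|a b T ab|c d K K' T T' hb hi IH].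
- apply: link_refl => u' E.
  have uA := wf_mem n2 ir E.
  have [a' Ea'] := wf_size1 E; subst u'.
  exists a', [::], [:: [:: a']]; split=> //; constructor.
  by apply: uA; [move=> x; rewrite inE => /eqP -> | rewrite inE].
- have [aA bA h] := (@stacksP X n n2 a b).1 ab.
  rewrite !reading_cons -catA /=; apply: link_refl => u'.
  case/wf_catl=> -[w [_ E ->]].
    have [T1 [sT1 <-]] := wf_reading E.
    exists b, ([:: a] :: T1), ([:: a; b] :: T1).
    rewrite !reading_cons -catA /= sT1; split=> //; exact: insert_A1.
  have [a' [b' [-> aA' bA' h']]] := zrow_wf n2 ir aA bA E.
  exists b', ([:: a'] :: T), ([:: a'; b'] :: T).
  rewrite !reading_cons -catA /=; split=> //; apply: insert_A1.
  by apply/(@stacksP X n n2); split=> // /h'.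
rewrite !reading_cons -catA.
(* The intermediate word is taken after the bump in K and before d enters T. [Q1] and [Q2] spell out
   the decomposition of its image as seen from either side. *)
apply: (link_trans (v := (reading T ++ [:: d]) ++ K')
  (Q1 := fun u v => exists c1 d1 K1 K1' T1,
    [/\ u = reading T1 ++ K1 ++ [:: c1], v = (reading T1 ++ [:: d1]) ++ K1',
       Defs.bump X n c1 K1 K1' d1, shape T1 = shape T & size K1 = size K])
  (Q2 := fun v w => exists d1 K1' T1 T1',
    [/\ v = (reading T1 ++ [:: d1]) ++ K1', w = reading T1' ++ K1',
       Defs.insert X n d1 T1 T1', shape T1 = shape T /\ shape T1' = shape T'
       & size K1' = size K'])).
- rewrite -catA; apply: (link_cat (Q1 := fun u v => u = v /\
    exists T1, shape T1 = shape T /\ reading T1 = u) _ (bump_link n2 ir hb)).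
  + by apply: link_refl => u' /wf_reading[T1 h]; split=> //; exists T1.
  + move=> u' _ [<- [T1 [sT1 <-]]]; exists c, d, K, K', T1.
    by rewrite -catA; split.
  + move=> _ _ [c1 [K1 [K1' [d1 [-> -> h sK]]]]].
    by exists c1, d1, K1, K1', T; rewrite -catA.
- apply: (link_cat (Q2 := fun u v => u = v /\ size u = size K') IH).
  + by apply: link_refl => u' /wf_size.
  + move=> _ _ [d1 [T1 [T1' [-> -> h s1 s2]]]].
    by exists d1, K', T1, T1'.
  + by move=> K1' _ [<- s1]; exists d, K1', T, T'.
move=> u' v' w' [c1 [d1 [K1 [K1' [T1 [-> -> h1 s1 s2]]]]]].
move=> [d2 [K2' [T2 [T2' [E -> h2 [s3 s4] s5]]]]].
(* Both links describe the same image of the intermediate word; equal sizes and shapes force the two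
   descriptions to agree. *)
have [|E1 E2] := eq_cat _ E.
  by rewrite !size_cat /= (@size_reading T1 T2) // s1 s3.
have [|E3 [E4]] := eq_cat _ E1; first by rewrite (@size_reading T1 T2) // s1 s3.
have E5 : T1 = T2 by apply: reading_inj => //; rewrite s1 s3.
subst T2 d2 K2'; exists c1, (K1 :: T1), (K1' :: T2'); rewrite !reading_cons.
split; rewrite -?catA //=.
- exact: insert_bump h1 h2.
- by rewrite s1 s2.
by rewrite s4 s5.
Qed.

Definition insert_word_words p s s' (u v : seq letter) : Prop :=
  exists w T T', [/\ u = reading T ++ rev w, v = reading T',
    insert_word X n w T T', size w = p & shape T = s /\ shape T' = s'].

Lemma insert_word_link w T T' : insert_word X n w T T' ->
  link (reading T ++ rev w) (reading T')
    (insert_word_words (size w) (shape T) (shape T')).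
Proof.
elim=> {w T T'} [T|a v T T' T'' hv IH ha].
  rewrite cats0; apply: link_refl => u' /wf_reading[T1 [s1 <-]].
  by exists [::], T1, T1; rewrite cats0; split=> //; constructor.
rewrite rev_cons -cats1 catA.
apply: (link_trans (v := reading T' ++ [:: a])
  (Q1 := fun u u' => exists v1 T1 T1' a1, [/\ u = (reading T1 ++ rev v1) ++ [:: a1],
     u' = reading T1' ++ [:: a1], insert_word X n v1 T1 T1', size v1 = size v
     & shape T1 = shape T /\ shape T1' = shape T']) _ (insert_link ha)).
  apply: (link_cat (Q2 := fun u v => u = v /\ exists a', u = [:: a']) IH).
  + by apply: link_refl => u' /wf_size1.
  + move=> _ _ [v1 [T1 [T1' [-> -> h1 h2 h3]]]].
    by exists v1, T1, T1', a.
  + by move=> _ _ [<- [a' ->]]; exists v, T, T', a'.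
move=> u' v' w' [v1 [T1 [T1' [a1 [-> -> h1 h2 [h3 h4]]]]]].
move=> [a2 [T2 [T2' [E -> h5 h6 h7]]]].
have [|E1 [E2]] := eq_cat _ E; first by rewrite (@size_reading T1' T2) // h4 h6.
have E3 : T1' = T2 by apply: reading_inj => //; rewrite h4 h6.
subst T2 a2; exists (a1 :: v1), T1, T2'.
rewrite rev_cons -cats1 catA; split=> //=; last by rewrite h2.
exact: insert_cons h1 h5.
Qed.

Definition uninsert_words (s s' : seq nat) (u v : seq letter) : Prop :=
  exists d T T' w, [/\ u = d :: reading T, v = reading T' ++ [:: w],
    uninsert X n d T T' w, shape T = s & shape T' = s'].

(** The travelling letter goes from the front of the word to its end, and each step is an elementary
    step reversed by [link_sym]. *)
Lemma uninsert_link d T T' w : uninsert X n d T T' w ->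
  link (d :: reading T) (reading T' ++ [:: w])
    (uninsert_words (shape T) (shape T')).
Proof.
elim=> {d T T' w} [d|c d K K' T T' w hb hi IH].
  apply: link_refl => u' E; have [a' ->] := wf_size1 E.
  by exists a', [::], [::], a'; split=> //; constructor.
rewrite !reading_rcons -cat_cons -catA.
apply: (link_trans (v := (K ++ [:: c]) ++ reading T)
  (Q1 := fun u v => exists c1 d1 K1 K1' T1,
    [/\ u = (d1 :: K1') ++ reading T1, v = K1 ++ (c1 :: reading T1),
       Defs.bump X n c1 K1 K1' d1, shape T1 = shape T & size K1 = size K])
  (Q2 := fun v w => exists c1 K1 T1 T1' w1,
    [/\ v = K1 ++ (c1 :: reading T1), w = K1 ++ reading T1' ++ [:: w1],
       uninsert X n c1 T1 T1' w1, shape T1 = shape T /\ shape T1' = shape T'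
       & size K1 = size K])).
- apply: (link_cat (Q2 := fun u v => u = v /\
    exists T1, shape T1 = shape T /\ reading T1 = u)
    (link_sym (bump_link n2 ir hb))).
  + by apply: link_refl => u' /wf_reading[T1 h]; split=> //; exists T1.
  + move=> _ _ [c1 [K1 [K1' [d1 [-> -> h sK]]]]].
    by exists c1, d1, K1, K1', T; rewrite -catA.
  + move=> u' _ [<- [T1 [sT1 <-]]]; exists c, d, K, K', T1.
    by rewrite -catA; split.
- rewrite -catA.
  apply: (link_cat (Q1 := fun u v => u = v /\ size u = size K) _ IH).
  + by apply: link_refl => u' /wf_size.
  + by move=> K1 _ [<- s1]; exists c, K1, T, T', w.
  + move=> _ _ [d1 [T1 [T1' [w1 [-> -> h s1 s2]]]]].
    by exists d1, K, T1, T1', w1.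
move=> u' v' w' [c1 [d1 [K1 [K1' [T1 [-> -> h1 s1 s2]]]]]].
move=> [c2 [K2 [T2 [T2' [w2 [E -> h2 [s3 s4] s5]]]]]].
have [|E1 [E2 E3]] := eq_cat _ E; first by rewrite s2 s5.
have E5 : T1 = T2 by apply: reading_inj => //; rewrite s1 s3.
subst T2 c2 K2; exists d1, (rcons T1 K1'), (rcons T2' K1), w2.
rewrite !reading_rcons -catA; split=> //; first exact: uninsert_rcons h1 h2.
- by rewrite /shape !map_rcons -!/(shape _) s1 (bump_size h1).2 (bump_size hb).2 s2.
by rewrite /shape !map_rcons -!/(shape _) s4 s2.
Qed.

End TableauLinks.

(** * Inverse insertions starting in the first and in the second row *)

Section UninsertLinks.
Variables (X : affine_type) (n : nat).
Hypothesis n2 : 2 < n.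
Variable i : nat.
Hypothesis ir : 0 < i <= n.
Local Notation wff := (wf (lphi X n i) (leps X n i) (lf X n i)).
Local Notation link := (word_link (lphi X n i) (leps X n i) (lf X n i)).

Definition uninsert_row_words (R : tableau -> tableau -> letter -> Prop)
    (s s' : seq nat) (u v : seq letter) : Prop :=
  exists T T' w, [/\ u = reading T, v = reading T' ++ [:: w], R T T' w,
    shape T = s & shape T' = s'].

Lemma uninsert_row1_link T T' w : uninsert_row1 X n T T' w ->
  link (reading T) (reading T' ++ [:: w])
    (uninsert_row_words (uninsert_row1 X n) (shape T) (shape T')).
Proof.
case=> {T T' w} d L L' w h; rewrite reading_rcons.
apply: link_mono (uninsert_link n2 ir h) _.
move=> _ _ [d1 [T1 [T1' [w1 [-> -> h1 s1 s2]]]]].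
exists (rcons T1 [:: d1]), T1', w1; split=> //; first by rewrite reading_rcons.
by rewrite /shape !map_rcons -!/(shape _) s1.
Qed.

Lemma size1_shape (R R' : tableau) : shape R = shape R' ->
  all (fun K => size K == 1) R = all (fun K => size K == 1) R'.
Proof.
move=> h; have E S : all (fun K : column => size K == 1) S = all (pred1 1) (shape S).
  by rewrite all_map.
by rewrite !E h.
Qed.

(** The removed bottom entry directly precedes the reading of the columns on its left, so the
    inverse insertion rewrites a suffix of the word; the one-box columns to the right and the top
    entry form a prefix that is left alone. *)
Lemma uninsert_row2_link T T' w : uninsert_row2 X n T T' w ->
  link (reading T) (reading T' ++ [:: w])
    (uninsert_row_words (uninsert_row2 X n) (shape T) (shape T')).
Proof.
case=> {T T' w} a d L L' R w h hR.
have E b e M S : reading (M ++ [:: b; e] :: S) =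
    reading ([:: b] :: S) ++ (e :: reading M).
  by rewrite reading_cat !reading_cons -!catA.
have E' b e M S : reading (M ++ [:: b] :: S) ++ [:: e] =
    reading ([:: b] :: S) ++ (reading M ++ [:: e]).
  by rewrite reading_cat !reading_cons -!catA.
rewrite E E'.
apply: (link_cat (Q1 := fun u v => u = v /\ exists a' R',
   u = reading ([:: a'] :: R') /\ shape R' = shape R) _ (uninsert_link n2 ir h)).
- apply: link_refl => u' /wf_reading[T1 [sT1 Eu]].
  case: T1 sT1 Eu => [|[|a' [|? ?]] R'] //= [sR'] Eu.
  split; first by [].
  exists a', R'; split; last by [].
  by rewrite -Eu.
- move=> _ _ [<- [a' [R' [-> sR']]]].
  exists (L ++ [:: a'; d] :: R'), (L' ++ [:: a'] :: R'), w; rewrite E E'; split=> //.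
  + by apply: UninsertRow2 => //; rewrite (size1_shape sR').
  + by rewrite /shape !map_cat /= -!/(shape _) sR'.
  by rewrite /shape !map_cat /= -!/(shape _) sR'.
move=> _ _ [d1 [L1 [L1' [w1 [-> -> h1 s1 s2]]]]].
exists (L1 ++ [:: a; d1] :: R), (L1' ++ [:: a] :: R), w1; rewrite E E'; split=> //.
+ by rewrite /shape !map_cat /= -!/(shape _) s1.
by rewrite /shape !map_cat /= -!/(shape _) s2.
Qed.

Definition uninserts_words p q s s' r (u v : seq letter) : Prop :=
  exists T T' w, [/\ u = reading T, v = reading T' ++ rev w,
    uninserts X n p q T T' w, shape T = s /\ shape T' = s' & size w = r].

(** Common to both rows: [R] is the relation of a single removal and [RU] the constructor of
    [uninserts] that goes with it. *)
Lemma uninserts_cons_link (R : tableau -> tableau -> letter -> Prop)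
    p q p' q' T T' T'' a w :
  (forall T1 T1' T1'' a1 w1, R T1 T1' a1 -> uninserts X n p q T1' T1'' w1 ->
    uninserts X n p' q' T1 T1'' (a1 :: w1)) ->
  link (reading T) (reading T' ++ [:: a])
    (uninsert_row_words R (shape T) (shape T')) ->
  R T T' a ->
  link (reading T') (reading T'' ++ rev w)
    (uninserts_words p q (shape T') (shape T'') (size w)) ->
  uninserts X n p q T' T'' w ->
  link (reading T) (reading T'' ++ rev (a :: w))
    (uninserts_words p' q' (shape T) (shape T'') (size (a :: w))).
Proof.
move=> RU Rlink Ra IH Uw; rewrite rev_cons -cats1 catA.
apply: (link_trans Rlink (Q2 := fun u v => exists T1 T2 a1 w1,
  [/\ u = reading T1 ++ [:: a1], v = (reading T2 ++ rev w1) ++ [:: a1],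
      uninserts X n p q T1 T2 w1, shape T1 = shape T' /\ shape T2 = shape T''
      & size w1 = size w])).
  apply: (link_cat (Q2 := fun u v => u = v /\ exists a', u = [:: a']) IH).
  + by apply: link_refl => u' /wf_size1.
  + by move=> _ _ [T1 [T2 [w1 [-> -> h1 h2 h3]]]]; exists T1, T2, a, w1.
  + by move=> _ _ [<- [a' ->]]; exists T', T'', a', w.
move=> u' v' w' [T1 [T2 [a1 [-> -> hR s1 s2]]]].
move=> [T3 [T4 [a2 [w1 [E -> h [s3 s4] s5]]]]].
have [|E1 [E2]] := eq_cat _ E; first by rewrite (@size_reading T2 T3) // s2 s3.
have E3 : T2 = T3 by apply: reading_inj => //; rewrite s2 s3.
subst T3 a2; exists T1, T4, (a1 :: w1); rewrite rev_cons -cats1 catA.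
by split=> //; [exact: RU hR h | rewrite /= s5].
Qed.

Lemma uninserts_link p q T T' w : uninserts X n p q T T' w ->
  link (reading T) (reading T' ++ rev w)
    (uninserts_words p q (shape T) (shape T') (size w)).
Proof.
elim=> {p q T T' w} [T|p q T T' T'' a w ha hu IH|q T T' T'' a w ha hu IH].
- rewrite cats0; apply: link_refl => u' /wf_reading[T1 [s1 <-]].
  by exists T1, T1, [::]; rewrite cats0; split=> //; constructor.
- apply: uninserts_cons_link (uninsert_row1_link ha) ha IH hu => T1 T2 T3 b v hb hv.
  exact: uninserts_row1 hb hv.
apply: uninserts_cons_link (uninsert_row2_link ha) ha IH hu => T1 T2 T3 b v hb hv.
exact: uninserts_row2 hb hv.
Qed.

End UninsertLinks.

(** * Determinism *)

Ltac solve_pair H K :=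
  rewrite /znpair in H K; decompose [and] H; decompose [and] K; clear H K;
  subst; first [ repeat split; xlia zchecker | exfalso; xlia zchecker ].

(** Any two cases that apply to the same input give the same output; the next lemma is the same for
    the cases read backwards, as inverse insertion needs. *)
Lemma zbump_det X m c k0 k1 e0 e1 d e0' e1' d' :
  zbump X m c k0 k1 e0 e1 d -> zbump X m c k0 k1 e0' e1' d' ->
  (e0 = e0' /\ e1 = e1' /\ d = d')%Z.
Proof.
case: X => /=.
  by case=> [H|[H|[H|[H|[H|[H|H]]]]]] [K|[K|[K|[K|[K|[K|K]]]]]]; solve_pair H K.
by case=> h0 [h1 [h2 [H|[H|[H|[H|[H|[H|[H|H]]]]]]]]]
  [_ [_ [_ [K|[K|[K|[K|[K|[K|[K|K]]]]]]]]]]; solve_pair H K.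
Qed.

Lemma zbump_inj X m c k0 k1 e0 e1 d c' k0' k1' :
  zbump X m c k0 k1 e0 e1 d -> zbump X m c' k0' k1' e0 e1 d ->
  (c = c' /\ k0 = k0' /\ k1 = k1')%Z.
Proof.
case: X => /=.
  by case=> [H|[H|[H|[H|[H|[H|H]]]]]] [K|[K|[K|[K|[K|[K|K]]]]]]; solve_pair H K.
by case=> h0 [h1 [h2 [H|[H|[H|[H|[H|[H|[H|H]]]]]]]]]
  [g0 [g1 [g2 [K|[K|[K|[K|[K|[K|[K|K]]]]]]]]]]; solve_pair H K.
Qed.

Section Determinism.
Variables (X : affine_type) (n : nat).
Hypothesis n2 : 2 < n.
Local Notation zc := (zcode n).

Lemma bump_det c K K' d K'' d' : Defs.bump X n c K K' d ->
  Defs.bump X n c K K'' d' -> K' = K'' /\ d = d'.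
Proof.
move=> H1 H2; have [[Ks|Ks] _] := bump_size H1.
  case: K Ks H1 H2 => [|k []] // _ /bump_one[-> -> _ _ _].
  by case/bump_one=> -> ->.
case: K Ks H1 H2 => [|k0 [|k1 []]] // _.
case/(bump_two n2)=> e0 [e1 [-> [hA hz]]].
case/(bump_two n2)=> e0' [e1' [-> [hA' hz']]].
have [E0 [E1 E2]] := zbump_det hz hz'.
move: hA hA'; rewrite /= !andbT => /and5P[_ _ _ e0A /andP[e1A dA]].
case/and5P=> _ _ _ e0A' /andP[e1A' dA'].
by rewrite (zcode_inj e0A e0A' E0) (zcode_inj e1A e1A' E1) (zcode_inj dA dA' E2).
Qed.

Lemma bump_inj c K K' d c' K2 : Defs.bump X n c K K' d ->
  Defs.bump X n c' K2 K' d -> c = c' /\ K = K2.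
Proof.
move=> H1 H2; have [Ks K's] := bump_size H1; have [_ K2s] := bump_size H2.
have sK : size K = size K2 by rewrite -K's K2s.
case: Ks => Ks; rewrite Ks in sK.
  case: K Ks H1 {K's K2s} => [|k []] // _ /bump_one[EK Ed _ _ _].
  case: K2 sK H2 => [|k2 []] // _ /bump_one[EK' Ed' _ _ _].
  by move: EK'; rewrite EK -Ed Ed' => -[->].
case: K Ks H1 {K's K2s} => [|k0 [|k1 []]] // _.
case/(bump_two n2)=> e0 [e1 [EK [hA hz]]].
case: K2 sK H2 => [|k0' [|k1' []]] // _.
case/(bump_two n2)=> e0' [e1' [+ [hA' hz']]].
rewrite EK => -[E0 E1]; subst e0' e1'.
have [Ec [Ek0 Ek1]] := zbump_inj hz hz'.
move: hA hA'; rewrite /= !andbT => /and5P[cA k0A k1A _ _].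
case/and5P=> cA' k0A' k1A' _ _.
by rewrite (zcode_inj cA cA' Ec) (zcode_inj k0A k0A' Ek0) (zcode_inj k1A k1A' Ek1).
Qed.

Lemma stacks_bump a b K' d : stacks X n a b -> Defs.bump X n b [:: a] K' d ->
  False.
Proof. by move=> /(@stacksP X n n2 _ _)[_ _ h] /bump_one[_ _ _ _ /h]. Qed.

Lemma insert_det c T T1 T2 : Defs.insert X n c T T1 ->
  Defs.insert X n c T T2 -> T1 = T2.
Proof.
move=> H; elim: H T2 => {c T T1} [a aA|a b T ab|c d K K' T T' hb hi IH] T2 H2.
- by inversion H2.
- move: H2 ab; move E: (_ :: T) => T0 H2.
  case: H2 E => // [a' b' T' _ [-> ->] //|c d K K' T' T'' hb _ [EK _] ab].
  by subst K; case: (stacks_bump ab hb).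
move: H2 hb; move E: (K :: T) => T0 H2.
case: H2 E => // [a b T1 ab [EK _] hb|c2 d2 K2 K2' T1 T1' hb2 hi2 [EK ET] hb].
  by subst K; case: (stacks_bump ab hb).
subst; have [-> Ed] := bump_det hb hb2; subst d.
by rewrite (IH _ hi2).
Qed.

Lemma insert_word_det v T T1 T2 : insert_word X n v T T1 ->
  insert_word X n v T T2 -> T1 = T2.
Proof.
move=> H; elim: H T2 => {v T T1} [T|a v T T' T'' hv IH ha] T2 H2.
  by inversion H2.
move: H2 ha; move E: (a :: v) => v0 H2.
case: H2 E IH => // a' v' T3 T4 T5 hv2 ha2 [-> ->] IH ha.
by move: ha2; rewrite -(IH _ hv2); exact: insert_det.
Qed.

Lemma uninsert_det d T T1 w1 T2 w2 : uninsert X n d T T1 w1 ->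
  uninsert X n d T T2 w2 -> T1 = T2 /\ w1 = w2.
Proof.
move=> H; elim: H T2 w2 => {d T T1 w1} [d|c d K K' T T' w hb hi IH] T2 w2.
  move E: [::] => T H2; case: H2 E => // c e K K' T' T3 w _ _.
  by case: T'.
move E: (rcons _ _) => T3 H2; case: H2 E hb IH hi => [?|c2 d2 K2 K2' T4 T5 w3].
  by case: T.
move=> hb2 hi2 /rcons_inj[-> ->] hb IH hi.
have [Ec EK] := bump_inj hb hb2; subst.
by have [-> ->] := IH _ _ hi2.
Qed.

Lemma uninsert_row1_det T T1 w1 T2 w2 : uninsert_row1 X n T T1 w1 ->
  uninsert_row1 X n T T2 w2 -> T1 = T2 /\ w1 = w2.
Proof.
case=> d L L' w h; move E: (rcons _ _) => T3 H2.
case: H2 E => d2 L2 L2' w3 h2 /rcons_inj[EL Ed]; subst.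
exact: uninsert_det h h2.
Qed.

(** [uninsert_row2] does not name the position of the removed box, but only one-box columns follow
    it, so it lies in the last column with two boxes. *)
Lemma last_tall_column (K K2 : column) (L L2 R R2 : tableau) :
  size K = 2 -> size K2 = 2 ->
  all (fun K => size K == 1) R -> all (fun K => size K == 1) R2 ->
  L ++ K :: R = L2 ++ K2 :: R2 -> [/\ L = L2, K = K2 & R = R2].
Proof.
move=> sK sK2 hR hR2; elim: L L2 => [|C L IH] [|C2 L2] /=.
- by case=> -> ->.
- by case=> _ ER; move: hR; rewrite ER all_cat /= sK2 andbF.
- by case=> _ ER; move: hR2; rewrite -ER all_cat /= sK andbF.
by case=> -> /IH[-> -> ->].
Qed.

Lemma uninsert_row2_det T T1 w1 T2 w2 : uninsert_row2 X n T T1 w1 ->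
  uninsert_row2 X n T T2 w2 -> T1 = T2 /\ w1 = w2.
Proof.
case=> a d L L' R w h hR; move E: (_ ++ _) => T3 H2.
case: H2 E => a2 d2 L2 L2' R2 w3 h2 hR2 E.
have [EL [Ea Ed] ER] := @last_tall_column [:: a; d] [:: a2; d2] _ _ _ _
  erefl erefl hR hR2 E.
by subst; have [-> ->] := uninsert_det h h2.
Qed.

Lemma uninserts_det p q T T1 w1 T2 w2 : uninserts X n p q T T1 w1 ->
  uninserts X n p q T T2 w2 -> T1 = T2 /\ w1 = w2.
Proof.
move=> H; elim: H T2 w2 => {p q T T1 w1}
  [T|p q T T' T'' a w ha hu IH|q T T' T'' a w ha hu IH] T2 w2 H2.
- by inversion H2.
- move: H2; move Ep: p.+1 => p'; move Eq: q => q' H2.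
  case: H2 Ep Eq ha => // p1 q1 T1 T1' T1'' a1 w1 ha1 hu1 [Ep] Eq ha; subst.
  have [E ->] := uninsert_row1_det ha ha1; subst.
  by have [-> ->] := IH _ _ hu1.
move: H2; move Ep: 0 => p'; move Eq: q.+1 => q' H2.
case: H2 Ep Eq ha => // q1 T1 T1' T1'' a1 w1 ha1 hu1 _ [Eq] ha; subst.
have [E ->] := uninsert_row2_det ha ha1; subst.
by have [-> ->] := IH _ _ hu1.
Qed.

End Determinism.

(** * Coordinates and words of the elements of B_l *)

Section LetterValues.
Variables (X : affine_type) (n : nat).
Hypothesis n2 : 2 < n.
Local Notation A := (alphabet X n).

Lemma letter_val_lt i c : c \in A -> 0 < i < n ->
  lphi X n i c = (c == Pos i) + (c == Bar i.+1) /\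
  leps X n i c = (c == Pos i.+1) + (c == Bar i).
Proof.
rewrite /lphi /leps => cA ir.
have j1 : (1 <= Z.of_nat n.+1 - Z.of_nat i)%Z by lia.
case: c cA => [x||x]; rewrite ?mem_Pos ?mem_Bar ?eq_letterE /= => xr;
  by case: X; [case: (zspecBP _ j1) | case: (zspecDP _ j1)]; lia.
Qed.

Lemma letter_val_nB c : X = typeB -> c \in A ->
  lphi X n n c = (c == Pos n) * 2 + (c == Circ) /\
  leps X n n c = (c == Circ) + (c == Bar n) * 2.
Proof.
rewrite /lphi /leps => -> cA.
have j1 : (1 <= Z.of_nat n.+1 - Z.of_nat n)%Z by lia.
by case: c cA => [x||x]; rewrite ?mem_Pos ?mem_Bar ?eq_letterE /= => xr;
  case: (zspecBP _ j1); rewrite ?eqxx; lia.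
Qed.

Lemma letter_val_nD c : X = typeD -> c \in A ->
  lphi X n n c = (c == Pos n.-1) + (c == Pos n) /\
  leps X n n c = (c == Bar n.-1) + (c == Bar n).
Proof.
rewrite /lphi /leps => -> cA.
have j1 : (1 <= Z.of_nat n.+1 - Z.of_nat n)%Z by lia.
case: c cA => [x||x]; rewrite ?mem_Pos ?mem_Bar ?mem_Circ ?eq_letterE //= => xr;
  case: (zspecDP _ j1); lia.
Qed.

Lemma lf_eq i c c' : 0 < i <= n -> c \in A -> c' \in A -> 0 < lphi X n i c ->
  zf X (Z.of_nat n.+1 - Z.of_nat i) (zcode n c) = zcode n c' -> lf X n i c = c'.
Proof. by move=> ir cA c'A ph; rewrite /lf => ->; exact: zcodeK c'A. Qed.

Lemma lf_Pos i : 0 < i < n -> lf X n i (Pos i) = Pos i.+1.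
Proof.
move=> ir; have PA : Pos i \in A by rewrite mem_Pos; lia.
apply: lf_eq => //; try by rewrite ?mem_Pos; lia.
  by rewrite (letter_val_lt PA ir).1 eqxx.
have j1 : (1 <= Z.of_nat n.+1 - Z.of_nat i)%Z by lia.
by case: X => /=; [case: (zspecBP _ j1) | case: (zspecDP _ j1)]; lia.
Qed.

Lemma lf_Bar i : 0 < i < n -> lf X n i (Bar i.+1) = Bar i.
Proof.
move=> ir; have PA : Bar i.+1 \in A by rewrite mem_Bar; lia.
apply: lf_eq => //; try by rewrite ?mem_Bar; lia.
  by rewrite (letter_val_lt PA ir).1 eqxx addn1.
have j1 : (1 <= Z.of_nat n.+1 - Z.of_nat i)%Z by lia.
by case: X => /=; [case: (zspecBP _ j1) | case: (zspecDP _ j1)]; lia.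
Qed.

Lemma lf_nB : X = typeB -> lf X n n (Pos n) = Circ /\ lf X n n Circ = Bar n.
Proof.
move=> XB; have CA : Circ \in A by rewrite mem_Circ XB.
have PA : Pos n \in A by rewrite mem_Pos; lia.
have BA : Bar n \in A by rewrite mem_Bar; lia.
have j1 : (1 <= Z.of_nat n.+1 - Z.of_nat n)%Z by lia.
split; apply: lf_eq => //; try lia.
- by rewrite (letter_val_nB XB PA).1 eqxx.
- by rewrite XB /=; case: (zspecBP _ j1); lia.
- by rewrite (letter_val_nB XB CA).1 eqxx addn1.
- by rewrite XB /=; case: (zspecBP _ j1); lia.
Qed.

Lemma lf_nD : X = typeD ->
  lf X n n (Pos n.-1) = Bar n /\ lf X n n (Pos n) = Bar n.-1.
Proof.
move=> XD.
have PA x : 0 < x <= n -> Pos x \in A by rewrite mem_Pos.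
have BA x : 0 < x <= n -> Bar x \in A by rewrite mem_Bar.
have j1 : (1 <= Z.of_nat n.+1 - Z.of_nat n)%Z by lia.
split; apply: lf_eq => //; try by [lia | apply: PA; lia | apply: BA; lia].
- by rewrite (letter_val_nD XD _).1 ?eqxx //; apply: PA; lia.
- by rewrite XD /=; case: (zspecDP _ j1); lia.
- by rewrite (letter_val_nD XD _).1 ?eqxx ?addn1 //; apply: PA; lia.
- by rewrite XD /=; case: (zspecDP _ j1); lia.
Qed.

End LetterValues.

Section Coordinates.
Variables (X : affine_type) (n l : nat).
Local Notation A := (alphabet X n).
Implicit Type b : kr_elt X n l.

Lemma kr_elt_exists (g : letter -> nat) : \sum_(c <- A) g c = l ->
  match X with
  | typeB => g Circ <= 1
  | typeD => (g (Pos n) == 0) || (g (Bar n) == 0)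
  end -> 0 < n -> exists b, {in A, coord b =1 g}.
Proof.
move=> gl gadm n0.
pose t : coords X n l := [tuple inord (g (nth Circ A j)) | j < size A].
have tE c : c \in A -> tcoord t c = g c.
  move=> cA; have lt_c : index c A < size A by rewrite index_mem.
  rewrite /tcoord (nth_map ord0) ?size_tuple //.
  rewrite (_ : nth _ _ _ = tnth t (Ordinal lt_c)); last by rewrite (tnth_nth ord0).
  (* [inord] does not truncate here: a single coordinate is bounded by the sum l. *)
  rewrite tnth_mktuple /= nth_index // inordK // ltnS -gl.
  by rewrite (bigD1_seq c) ?alphabet_uniq //= leq_addr.
have adm : admissible t.
  rewrite /admissible -{2}gl (eq_big_seq g) ?eqxx /=; last by move=> c /tE.
  have hB : X = typeB -> tcoord t Circ <= 1.
    by move=> XB; rewrite tE ?mem_Circ ?XB //; move: gadm; rewrite XB.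
  have hD : X = typeD -> (tcoord t (Pos n) == 0) || (tcoord t (Bar n) == 0).
    move=> XD; rewrite !tE ?mem_Pos ?mem_Bar ?n0 ?leqnn //.
    by move: gadm; rewrite XD.
  move: hB hD; move: (_ <= 1) (_ || _) => P Q.
  by case: X => hB hD; [apply: hB | apply: hD].
by exists (Sub t adm) => c cA; rewrite -(tE c cA) /coord /=.
Qed.

Lemma sum_coord b : \sum_(c <- A) coord b c = l.
Proof. by have /andP[/eqP h _] := valP b. Qed.

(** The last three hypotheses make the result admissible: o is added only where there is none, and
    n, resp. n-bar, only if no n-bar, resp. n, remains once d has been removed. *)
Lemma move_Some b d u : 0 < n -> d \in A -> u \in A -> d != u ->
  0 < coord b d ->
  (X = typeB -> u = Circ -> coord b Circ = 0) ->
  (X = typeD -> u = Pos n -> coord b (Bar n) = (d == Bar n)) ->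
  (X = typeD -> u = Bar n -> coord b (Pos n) = (d == Pos n)) ->
  exists b', move b d u = Some b'.
Proof.
move=> n0 dA uA du d0 hB hP hN.
pose g c := coord b c + (c == u) - (c == d).
have gE c : g c + (c == d) = coord b c + (c == u).
  by rewrite /g; have [->|] := eqVneq c d; lia.
have sum1 e : e \in A -> \sum_(c <- A) (c == e) = 1.
  move=> eA; rewrite (bigD1_seq e) ?alphabet_uniq //= eqxx.
  by rewrite big1 // => c /negPf ->.
have gl : \sum_(c <- A) g c = l.
  have : \sum_(c <- A) (g c + (c == d)) = \sum_(c <- A) (coord b c + (c == u)).
    exact: eq_bigr.
  by rewrite !big_split /= sum_coord !sum1 //; lia.
have [|//|b' Eb'] := kr_elt_exists gl _.
  have hB' : X = typeB -> g Circ <= 1.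
    move=> XB; have := coord_circ b XB; rewrite /g.
    by have [Eu|] := eqVneq Circ u; [rewrite (hB XB (esym Eu)) |]; lia.
  have hD' : X = typeD -> (g (Pos n) == 0) || (g (Bar n) == 0).
    move=> XD; have := coord_n b XD; rewrite /g.
    have [Eu|nu] := eqVneq u (Pos n).
      by rewrite (hP XD Eu) (eq_sym (Bar n) d) Eu eq_letterE /=; lia.
    have [Eu|nu'] := eqVneq u (Bar n).
      by rewrite (hN XD Eu) (eq_sym (Pos n) d); lia.
    by clear; lia.
  move: hB' hD'; move: (_ <= 1) (_ || _) => P Q.
  by case: X => hB' hD'; [apply: hB' | apply: hD'].
exists b'; apply/moveP; split=> // c.
have [cA|cA] := boolP (c \in A); first by rewrite Eb' // gE.
rewrite !coord_notin //; have [E|_] := eqVneq c d; first by rewrite E dA in cA.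
by have [E|_] := eqVneq c u; first by rewrite E uA in cA.
Qed.

Lemma move_None b d u : d != u -> coord b d = 0 -> move b d u = None.
Proof.
move=> du d0; case E: (move b d u) => [b'|] //.
by case/moveP: E => _ _ /(_ d); rewrite d0 eqxx (negPf du); lia.
Qed.

Definition blocks (g : letter -> nat) (s : seq letter) : seq letter :=
  flatten [seq nseq (g c) c | c <- s].

Lemma blocks_cat g s s' : blocks g (s ++ s') = blocks g s ++ blocks g s'.
Proof. by rewrite /blocks map_cat flatten_cat. Qed.

Lemma eq_blocks g g' s : {in s, g =1 g'} -> blocks g s = blocks g' s.
Proof.
by move=> h; congr flatten; apply/eq_in_map => c /h ->.
Qed.

(** With equal letters grouped in reversed alphabetical order, the letter produced by f_i appears at
    the edge of the block that it joins, so the image is again the word of an element. *)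
Definition word b : seq letter := rev (row b).

Lemma wordE b : word b = blocks (coord b) (rev A).
Proof.
rewrite /word /row /blocks; elim: A => //= c s IH.
by rewrite rev_cat rev_cons map_rcons flatten_rcons -IH rev_nseq.
Qed.

Lemma rev_alphabet : rev A = [seq Bar x | x <- iota 1 n] ++
  (match X with typeB => [:: Circ] | typeD => [::] end) ++
  [seq Pos x | x <- rev (iota 1 n)].
Proof.
rewrite /alphabet !rev_cat -!map_rev revK catA.
by case: X.
Qed.

Lemma count_blocks g s c : uniq s ->
  count_mem c (blocks g s) = (c \in s) * g c.
Proof.
elim: s => //= d s IH /andP[ds us].
rewrite /blocks /= count_cat -/(blocks g s) IH // inE count_nseq /=.
have [->|nd] := eqVneq c d; first by rewrite (negPf ds); lia.
by rewrite !mul0n.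
Qed.

Lemma row_count b c : count_mem c (row b) = coord b c.
Proof.
rewrite -(count_rev) -/(word b) wordE count_blocks ?rev_uniq ?alphabet_uniq //.
rewrite mem_rev; have [cA|cA] := boolP (c \in A); first by rewrite mul1n.
by rewrite coord_notin.
Qed.

Lemma row_inj b b' : row b = row b' -> b = b'.
Proof. by move=> E; apply: coord_inj => c _; rewrite -!row_count E. Qed.

Lemma size_row b : size (row b) = l.
Proof.
transitivity (\sum_(c <- A) coord b c); last exact: sum_coord.
rewrite /row size_flatten /shape -map_comp sumnE big_map.
by apply: eq_bigr => c _; rewrite /= size_nseq.
Qed.

End Coordinates.

Lemma match_typeB (T : Type) (x y : T) X : X = typeB ->
  match X with typeB => x | typeD => y end = x.
Proof. by move->. Qed.

Lemma match_typeD (T : Type) (x y : T) X : X = typeD ->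
  match X with typeB => x | typeD => y end = y.
Proof. by move->. Qed.

Lemma typeBD X : X = typeB \/ X = typeD.
Proof. by case: X; [left | right]. Qed.

Section NseqWords.
Variables (T : Type) (ph ep : T -> nat) (fl : T -> T).
Local Notation wep := (weps ph ep).
Local Notation wph := (wphi ph ep).
Local Notation wff := (wf ph ep fl).

Lemma nseq_eps m c : ph c = 0 -> wep (nseq m c) = m * ep c /\ wph (nseq m c) = 0.
Proof. by move=> p; elim: m => //= m [-> ->]; rewrite p; lia. Qed.

Lemma nseq_phi m c : ep c = 0 -> wep (nseq m c) = 0 /\ wph (nseq m c) = m * ph c.
Proof. by move=> p; elim: m => //= m [-> ->]; rewrite p; lia. Qed.

Lemma wf_nseq m c : ep c = 0 -> 0 < ph c ->
  wff (nseq m c) = if 0 < m then Some (fl c :: nseq m.-1 c) else None.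
Proof. by case: m => //= m e p; rewrite (nseq_phi _ e).1 p. Qed.

Lemma nseq_cons m (c : T) s : nseq m c ++ c :: s = nseq m.+1 c ++ s.
Proof. by elim: m => //= m ->. Qed.

Lemma neutral_cat u v : wep u = 0 -> wph u = 0 ->
  wep (u ++ v) = wep v /\ wph (u ++ v) = wph v.
Proof. by move=> e p; rewrite weps_cat wphi_cat e p; lia. Qed.

(* [u] and [v] are the words at the barred and at the unbarred end, and [Q] is
   the neutral word between them. *)
Lemma two_ends P u Q v R : wep P = 0 -> wph P = 0 -> wep Q = 0 -> wph Q = 0 ->
  wep R = 0 -> wph R = 0 ->
  [/\ wep (P ++ u ++ Q ++ v ++ R) = wep u + (wep v - wph u),
      wph (P ++ u ++ Q ++ v ++ R) = wph v + (wph u - wep v) &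
      wff (P ++ u ++ Q ++ v ++ R) =
        if wep v < wph u
        then omap (fun u' => P ++ u' ++ Q ++ v ++ R) (wff u)
        else omap (fun v' => P ++ u ++ Q ++ v' ++ R) (wff v)].
Proof.
move=> eP pP eQ pQ eR pR.
split.
- by rewrite !(weps_cat, wphi_cat); lia.
- by rewrite !(weps_cat, wphi_cat); lia.
rewrite wf_neutral_cat // wf_cat !weps_cat eQ pQ eR.
have -> : 0 + (wep v + (0 - wph v) - 0) = wep v by lia.
case: ifP => _; first by case: (wff u).
by rewrite wf_neutral_cat // wf_cat_neutral //; case: (wff v).
Qed.

End NseqWords.

(** * Position of the letters seen by f_i in the reversed alphabet *)

Section Decomposition.
Variables (X : affine_type) (n : nat).
Hypothesis n2 : 2 < n.
Local Notation A := (alphabet X n).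

Definition neutral_letter i c : Prop :=
  [/\ c \in A, lphi X n i c = 0 & leps X n i c = 0].
Definition neutral_letters i (S : seq letter) : Prop :=
  forall c, c \in S -> neutral_letter i c.

Lemma neutral_blocks g i S : neutral_letters i S ->
  weps (lphi X n i) (leps X n i) (blocks g S) = 0 /\
  wphi (lphi X n i) (leps X n i) (blocks g S) = 0.
Proof.
elim: S => //= c S IH h.
have [|e p] := IH; first by move=> d dS; apply: h; rewrite inE dS orbT.
have [|cA pc ec] := h c; first by rewrite inE eqxx.
have [e' p'] := neutral_nseq (g c) ec pc.
rewrite /blocks /= -/(blocks g S).
by have [-> ->] := neutral_cat (blocks g S) e' p'.
Qed.

Lemma iota_split i : 0 < i < n ->
  iota 1 n = iota 1 i.-1 ++ [:: i; i.+1] ++ iota i.+2 (n - i.+1).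
Proof.
move=> ir; rewrite -[in LHS](_ : i.-1 + (2 + (n - i.+1)) = n); last by lia.
by rewrite iotaD add1n prednK /=; [rewrite ?addnS ?addn0 | lia].
Qed.

Lemma iota_last : iota 1 n = iota 1 n.-2 ++ [:: n.-1; n].
Proof.
rewrite -[in LHS](_ : n.-2 + 2 = n); last by lia.
by rewrite iotaD /=; congr (_ ++ [:: _; _]); lia.
Qed.

Lemma decomp_lt i : 0 < i < n -> exists S1 S2 S3,
  rev A = S1 ++ [:: Bar i; Bar i.+1] ++ S2 ++ [:: Pos i.+1; Pos i] ++ S3 /\
  [/\ neutral_letters i S1, neutral_letters i S2 & neutral_letters i S3].
Proof.
move=> ir; exists [seq Bar x | x <- iota 1 i.-1].
exists ([seq Bar x | x <- iota i.+2 (n - i.+1)] ++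
  (match X with typeB => [:: Circ] | typeD => [::] end) ++
  [seq Pos x | x <- rev (iota i.+2 (n - i.+1))]).
exists [seq Pos x | x <- rev (iota 1 i.-1)]; split.
  rewrite rev_alphabet (iota_split ir) !rev_cat !map_cat /= -!catA.
  by case: X.
have nB x : 0 < x <= n -> x != i -> x != i.+1 -> neutral_letter i (Bar x).
  move=> xr h1 h2; have xA : Bar x \in A by rewrite mem_Bar.
  have [p e] := letter_val_lt n2 xA ir.
  by split; rewrite ?p ?e ?eq_letterE ?(negPf h1) ?(negPf h2).
have nP x : 0 < x <= n -> x != i -> x != i.+1 -> neutral_letter i (Pos x).
  move=> xr h1 h2; have xA : Pos x \in A by rewrite mem_Pos.
  have [p e] := letter_val_lt n2 xA ir.
  by split; rewrite ?p ?e ?eq_letterE ?(negPf h1) ?(negPf h2).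
split=> c.
- by case/mapP=> x; rewrite mem_iota => xr ->; apply: nB; lia.
- rewrite !mem_cat => /or3P[|CA|].
  + by case/mapP=> x; rewrite mem_iota => xr ->; apply: nB; lia.
  + have {CA} [cA Ec] : c \in A /\ c = Circ.
      move: CA; case XE: X; rewrite ?inE // => /eqP ->.
      by rewrite mem_Circ.
    rewrite Ec in cA *; have [e p] := letter_val_lt n2 cA ir.
    by split; rewrite ?e ?p ?eq_letterE.
  by case/mapP=> x; rewrite mem_rev mem_iota => xr ->; apply: nP; lia.
by case/mapP=> x; rewrite mem_rev mem_iota => xr ->; apply: nP; lia.
Qed.

Lemma decomp_nB : X = typeB -> exists S1 S3,
  rev A = S1 ++ [:: Bar n; Circ; Pos n] ++ S3 /\
  (neutral_letters n S1 /\ neutral_letters n S3).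
Proof.
move=> XB; exists [seq Bar x | x <- iota 1 n.-1], [seq Pos x | x <- rev (iota 1 n.-1)].
have E : iota 1 n = iota 1 n.-1 ++ [:: n].
  rewrite -[in LHS](_ : n.-1 + 1 = n); last by lia.
  by rewrite iotaD /=; congr (_ ++ [:: _]); lia.
split; first by rewrite rev_alphabet E rev_cat !map_cat /= -!catA XB.
split=> c /mapP[x]; rewrite ?mem_rev mem_iota => xr ->.
  have xA : Bar x \in A by rewrite mem_Bar; lia.
  have [e p] := letter_val_nB n2 XB xA.
  by split; rewrite ?e ?p ?eq_letterE //; lia.
have xA : Pos x \in A by rewrite mem_Pos; lia.
have [e p] := letter_val_nB n2 XB xA.
by split; rewrite ?e ?p ?eq_letterE //; lia.
Qed.

Lemma decomp_nD : X = typeD -> exists S1 S3,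
  rev A = S1 ++ [:: Bar n.-1; Bar n; Pos n; Pos n.-1] ++ S3 /\
  (neutral_letters n S1 /\ neutral_letters n S3).
Proof.
move=> XD; exists [seq Bar x | x <- iota 1 n.-2], [seq Pos x | x <- rev (iota 1 n.-2)].
split; first by rewrite rev_alphabet iota_last rev_cat !map_cat /= -!catA XD.
split=> c /mapP[x]; rewrite ?mem_rev mem_iota => xr ->.
  have xA : Bar x \in A by rewrite mem_Bar; lia.
  have [e p] := letter_val_nD n2 XD xA.
  by split; rewrite ?e ?p ?eq_letterE //; lia.
have xA : Pos x \in A by rewrite mem_Pos; lia.
have [e p] := letter_val_nD n2 XD xA.
by split; rewrite ?e ?p ?eq_letterE //; lia.
Qed.

End Decomposition.

(** * Coordinate formulas for f_i and e_i against the signature rule *)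

Section KRWords.
Variables (X : affine_type) (n l : nat).
Hypothesis n2 : 2 < n.
Local Notation A := (alphabet X n).
Local Notation wep i := (weps (lphi X n i) (leps X n i)).
Local Notation wph i := (wphi (lphi X n i) (leps X n i)).
Local Notation wff i := (wf (lphi X n i) (leps X n i) (lf X n i)).
Implicit Type b : kr_elt X n l.

Lemma move_coord b d u b' c : move b d u = Some b' -> c != d -> c != u ->
  coord b' c = coord b c.
Proof. by case/moveP=> _ _ /(_ c) + /negPf h /negPf h'; rewrite h h'; lia. Qed.

Lemma move_coord_d b d u b' : move b d u = Some b' -> d != u ->
  coord b' d = (coord b d).-1.
Proof. by case/moveP=> _ _ /(_ d) + /negPf h; rewrite h eqxx; lia. Qed.

Lemma move_coord_u b d u b' : move b d u = Some b' -> d != u ->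
  coord b' u = (coord b u).+1.
Proof. by case/moveP=> _ _ /(_ u) + h; rewrite eqxx eq_sym (negPf h); lia. Qed.

Lemma move_blocks b d u b' i S : move b d u = Some b' -> neutral_letters X n i S ->
  0 < lphi X n i d + leps X n i d -> 0 < lphi X n i u + leps X n i u ->
  blocks (coord b') S = blocks (coord b) S.
Proof.
move=> E hS hd hu; apply: eq_blocks => c cS; have [_ p e] := hS _ cS.
by apply: (move_coord E); apply/eqP => Ec; subst c; rewrite p e in hd hu.
Qed.

(** Let a, b, c, d be the numbers of letters i-bar, (i+1)-bar, i+1 and i. The signature is eps^a
    phi^b eps^c phi^d, whose middle part phi^b eps^c cancels. So f_i changes a letter (i+1)-bar if b
    > c and a letter i otherwise, which is the comparison that defines f_i. *)
Lemma word_sig_lt i b : 0 < i < n ->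
  [/\ wep i (word b) = coord b (Bar i) + (coord b (Pos i.+1) - coord b (Bar i.+1)),
      wph i (word b) = coord b (Pos i) + (coord b (Bar i.+1) - coord b (Pos i.+1)) &
      wff i (word b) = omap (@word X n l)
        (if coord b (Bar i.+1) <= coord b (Pos i.+1)
         then move b (Pos i) (Pos i.+1) else move b (Bar i.+1) (Bar i))].
Proof.
move=> ir; have ni : (i == i.+1) = false by lia.
have ni' : (i.+1 == i) = false by lia.
have [S1 [S2 [S3 [EA [h1 h2 h3]]]]] := @decomp_lt X n n2 i ir.
have Pi : Pos i \in A by rewrite mem_Pos; lia.
have Pi1 : Pos i.+1 \in A by rewrite mem_Pos; lia.
have Bi : Bar i \in A by rewrite mem_Bar; lia.
have Bi1 : Bar i.+1 \in A by rewrite mem_Bar; lia.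
have [pP eP] := letter_val_lt n2 Pi ir.
have [pP1 eP1] := letter_val_lt n2 Pi1 ir.
have [pB eB] := letter_val_lt n2 Bi ir.
have [pB1 eB1] := letter_val_lt n2 Bi1 ir.
move: pP eP pP1 eP1 pB eB pB1 eB1.
rewrite !eq_letterE !eqxx ni ni' /= => pP eP pP1 eP1 pB eB pB1 eB1.
have wE b0 : word b0 = blocks (coord b0) S1 ++
   (nseq (coord b0 (Bar i)) (Bar i) ++ nseq (coord b0 (Bar i.+1)) (Bar i.+1)) ++
   blocks (coord b0) S2 ++
   (nseq (coord b0 (Pos i.+1)) (Pos i.+1) ++ nseq (coord b0 (Pos i)) (Pos i)) ++
   blocks (coord b0) S3.
  by rewrite wordE EA !blocks_cat /blocks /= !cats0 -!catA.
have [e1 p1] := neutral_blocks (coord b) h1.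
have [e2 p2] := neutral_blocks (coord b) h2.
have [e3 p3] := neutral_blocks (coord b) h3.
have [H1 H2 H3] := @two_ends _ (lphi X n i) (leps X n i) (lf X n i) _
   (nseq (coord b (Bar i)) (Bar i) ++ nseq (coord b (Bar i.+1)) (Bar i.+1)) _
   (nseq (coord b (Pos i.+1)) (Pos i.+1) ++ nseq (coord b (Pos i)) (Pos i))
   _ e1 p1 e2 p2 e3 p3.
have [ea pa] := nseq_eps (leps X n i) (coord b (Bar i)) pB.
have [eb pb] := nseq_phi (lphi X n i) (coord b (Bar i.+1)) eB1.
have [ec pc] := nseq_eps (leps X n i) (coord b (Pos i.+1)) pP1.
have [ed pd] := nseq_phi (lphi X n i) (coord b (Pos i)) eP.
rewrite -wE !(weps_cat, wphi_cat) ea pa eb pb ec pc ed pd eB pB1 eP1 pP in H1 H2 H3.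
split; [by rewrite H1; clear; lia | by rewrite H2; clear; lia |].
rewrite {}H3 !wf_cat pa pc ed eb /=.
have -> : (coord b (Pos i.+1) * 1 + (0 - 0) <
   coord b (Bar i.+1) * 1 + (0 - 0)) = ~~ (coord b (Bar i.+1) <= coord b (Pos i.+1)).
  by clear; lia.
rewrite if_neg; case: ifPn => le_BP.
  rewrite wf_nseq ?pP //; have [d0|d0] := posnP (coord b (Pos i)).
    by rewrite move_None // eq_letterE ni.
  have [|||||b' Eb'] := @move_Some _ _ _ b (Pos i) (Pos i.+1) _ Pi Pi1 _ d0 => //.
  - by clear -n2; lia.
  - by rewrite eq_letterE ni.
  (* In type D with i+1 = n, a letter n may be added only if there is no n-bar; this follows from
     admissibility and the inequality between the two coordinates. *)
  - move=> XD [Ei]; have := coord_n b XD; move: le_BP; rewrite Ei eq_letterE.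
    by clear; lia.
  rewrite Eb' /= wE lf_Pos // (move_blocks Eb' h1) ?(move_blocks Eb' h2)
    ?(move_blocks Eb' h3) ?pP ?eP ?pP1 ?eP1 //.
  rewrite (move_coord_d Eb') ?(move_coord_u Eb') ?eq_letterE ?ni //.
  by rewrite !(move_coord Eb') ?eq_letterE // nseq_cons.
have B0 : 0 < coord b (Bar i.+1) by move: le_BP; clear; lia.
rewrite wf_nseq ?pB1 // B0.
have [|||||b' Eb'] := @move_Some _ _ _ b (Bar i.+1) (Bar i) _ Bi1 Bi _ B0 => //.
- by clear -n2; lia.
- by rewrite eq_letterE ni'.
- by move=> _ [Ei]; move: ir; rewrite Ei ltnn andbF.
rewrite Eb' /= wE lf_Bar // (move_blocks Eb' h1) ?(move_blocks Eb' h2)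
  ?(move_blocks Eb' h3) ?pB ?eB ?pB1 ?eB1 //.
rewrite (move_coord_d Eb') ?(move_coord_u Eb') ?eq_letterE ?ni' //.
by rewrite !(move_coord Eb') ?eq_letterE // nseq_cons.
Qed.

Lemma word_sig_nB b : X = typeB ->
  [/\ wep n (word b) = coord b (Bar n) * 2 +
         (coord b Circ + (0 - coord b Circ)),
      wph n (word b) = coord b (Pos n) * 2 + coord b Circ &
      wff n (word b) = omap (@word X n l)
        (if coord b Circ == 0 then move b (Pos n) Circ
         else move b Circ (Bar n))].
Proof.
move=> XB; have [S1 [S3 [EA [h1 h3]]]] := @decomp_nB X n n2 XB.
have n0 : 0 < n by clear -n2; lia.
have Pn : Pos n \in A by rewrite mem_Pos n0 leqnn.
have Bn : Bar n \in A by rewrite mem_Bar n0 leqnn.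
have Cn : Circ \in A by rewrite mem_Circ XB.
have [pP eP] := letter_val_nB n2 XB Pn.
have [pB eB] := letter_val_nB n2 XB Bn.
have [pC eC] := letter_val_nB n2 XB Cn.
move: pP eP pB eB pC eC.
rewrite !eq_letterE !eqxx /= => pP eP pB eB pC eC.
have wE b0 : word b0 = blocks (coord b0) S1 ++
   nseq (coord b0 (Bar n)) (Bar n) ++ [::] ++
   (nseq (coord b0 Circ) Circ ++ nseq (coord b0 (Pos n)) (Pos n)) ++
   blocks (coord b0) S3.
  by rewrite wordE EA !blocks_cat /blocks /= !cats0 -!catA.
have [e1 p1] := neutral_blocks (coord b) h1.
have [e3 p3] := neutral_blocks (coord b) h3.
have [H1 H2 H3] := @two_ends _ (lphi X n n) (leps X n n) (lf X n n) _
   (nseq (coord b (Bar n)) (Bar n)) [::]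
   (nseq (coord b Circ) Circ ++ nseq (coord b (Pos n)) (Pos n))
   _ e1 p1 erefl erefl e3 p3.
have [ea pa] := nseq_eps (leps X n n) (coord b (Bar n)) pB.
have [ed pd] := nseq_phi (lphi X n n) (coord b (Pos n)) eP.
have C1 := coord_circ b XB.
(* This depends on there being at most one o: two adjacent ones would again have epsilon and phi
   equal to 1. *)
have [ec pc] : wep n (nseq (coord b Circ) Circ) = coord b Circ /\
    wph n (nseq (coord b Circ) Circ) = coord b Circ.
  by case: (coord b Circ) C1 => [|[]] //= _; rewrite pC eC.
rewrite -wE !(weps_cat, wphi_cat) ea pa ec pc ed pd eB pP in H1 H2 H3.
split; [by rewrite H1; clear; lia | by rewrite H2; clear; lia |].
rewrite {}H3 !wf_cat pc ed !ltn0 /=.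
have [lP lC] := lf_nB n2 XB.
have [C0|C0] := posnP (coord b Circ).
  rewrite C0 /= wf_nseq ?pP //; have [d0|d0] := posnP (coord b (Pos n)).
    by rewrite move_None.
  have [|||||b' Eb'] := @move_Some _ _ _ b (Pos n) Circ _ Pn Cn _ d0 => //.
  rewrite Eb' /= wE lP (move_blocks Eb' h1) ?(move_blocks Eb' h3) ?pP ?eP ?pC ?eC //.
  rewrite (move_coord_d Eb') ?(move_coord_u Eb') ?eq_letterE //.
  by rewrite !(move_coord Eb') ?eq_letterE // C0.
have -> : coord b Circ = 1 by move: C0 C1; clear; lia.
rewrite /= pC /= lC.
have [|||||b' Eb'] := @move_Some _ _ _ b Circ (Bar n) _ Cn Bn _ C0 => //.
  by move=> XD; move: XB; rewrite {1}XD.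
have C1' : coord b Circ = 1 by move: C0 C1; clear; lia.
rewrite Eb' /= wE (move_blocks Eb' h1) ?(move_blocks Eb' h3) ?pB ?eB ?pC ?eC //.
rewrite (move_coord_d Eb') ?(move_coord_u Eb') ?eq_letterE //.
by rewrite !(move_coord Eb') ?eq_letterE // C1' /= nseq_cons.
Qed.

Lemma word_sig_nD b : X = typeD ->
  [/\ wep n (word b) = coord b (Bar n.-1) + coord b (Bar n),
      wph n (word b) = coord b (Pos n.-1) + coord b (Pos n) &
      wff n (word b) = omap (@word X n l)
        (if 0 < coord b (Pos n) then move b (Pos n) (Bar n.-1)
         else move b (Pos n.-1) (Bar n))].
Proof.
move=> XD; have [S1 [S3 [EA [h1 h3]]]] := @decomp_nD X n n2 XD.
have n0 : 0 < n by clear -n2; lia.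
have nn : (n == n.-1) = false by clear -n2; lia.
have nn' : (n.-1 == n) = false by clear -n2; lia.
have n1 : 0 < n.-1 <= n by clear -n2; lia.
have Pn : Pos n \in A by rewrite mem_Pos n0 leqnn.
have Bn : Bar n \in A by rewrite mem_Bar n0 leqnn.
have Pn1 : Pos n.-1 \in A by rewrite mem_Pos.
have Bn1 : Bar n.-1 \in A by rewrite mem_Bar.
have [pP eP] := letter_val_nD n2 XD Pn.
have [pB eB] := letter_val_nD n2 XD Bn.
have [pP1 eP1] := letter_val_nD n2 XD Pn1.
have [pB1 eB1] := letter_val_nD n2 XD Bn1.
move: pP eP pB eB pP1 eP1 pB1 eB1.
rewrite !eq_letterE !eqxx nn nn' /= => pP eP pB eB pP1 eP1 pB1 eB1.
have wE b0 : word b0 = blocks (coord b0) S1 ++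
   (nseq (coord b0 (Bar n.-1)) (Bar n.-1) ++ nseq (coord b0 (Bar n)) (Bar n)) ++
   [::] ++
   (nseq (coord b0 (Pos n)) (Pos n) ++ nseq (coord b0 (Pos n.-1)) (Pos n.-1)) ++
   blocks (coord b0) S3.
  by rewrite wordE EA !blocks_cat /blocks /= !cats0 -!catA.
have [e1 p1] := neutral_blocks (coord b) h1.
have [e3 p3] := neutral_blocks (coord b) h3.
have [H1 H2 H3] := @two_ends _ (lphi X n n) (leps X n n) (lf X n n) _
   (nseq (coord b (Bar n.-1)) (Bar n.-1) ++ nseq (coord b (Bar n)) (Bar n)) [::]
   (nseq (coord b (Pos n)) (Pos n) ++ nseq (coord b (Pos n.-1)) (Pos n.-1))
   _ e1 p1 erefl erefl e3 p3.
have [ea pa] := nseq_eps (leps X n n) (coord b (Bar n.-1)) pB1.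
have [eb pb] := nseq_eps (leps X n n) (coord b (Bar n)) pB.
have [ec pc] := nseq_phi (lphi X n n) (coord b (Pos n)) eP.
have [ed pd] := nseq_phi (lphi X n n) (coord b (Pos n.-1)) eP1.
rewrite -wE !(weps_cat, wphi_cat) ea pa eb pb ec pc ed pd eB1 eB pP1 pP in H1 H2 H3.
split; [by rewrite H1; clear; lia | by rewrite H2; clear; lia |].
rewrite {}H3 sub0n addn0 ltn0 wf_cat pc ed pP add0n muln1.
have [lP1 lP] := lf_nD n2 XD.
have cn := coord_n b XD.
have [C0|C0] := posnP (coord b (Pos n)).
  rewrite C0 /= wf_nseq ?pP1 //; have [d0|d0] := posnP (coord b (Pos n.-1)).
    by rewrite move_None.
  have [|||||b' Eb'] := @move_Some _ _ _ b (Pos n.-1) (Bar n) _ Pn1 Bn _ d0 => //.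
    by move=> _ _; rewrite eq_letterE nn'.
  rewrite Eb' /= wE lP1 (move_blocks Eb' h1) ?(move_blocks Eb' h3) ?pP1 ?eP1 ?pB ?eB //.
  rewrite (move_coord_d Eb') ?(move_coord_u Eb') ?eq_letterE //.
  rewrite !(move_coord Eb') ?eq_letterE ?nn ?nn' // C0 /=.
  by rewrite -!catA nseq_cons.
(* Admissibility empties the block of letters n-bar, so the new letter (n-1)-bar lands next to its
   own block. *)
have B0 : coord b (Bar n) = 0 by move: C0 cn; clear; lia.
rewrite wf_nseq ?pP // C0 /=.
have [|||||b' Eb'] := @move_Some _ _ _ b (Pos n) (Bar n.-1) _ Pn Bn1 _ C0 => //.
  by move=> _ [En]; rewrite En eqxx in nn'.
rewrite Eb' /= wE lP (move_blocks Eb' h1) ?(move_blocks Eb' h3) ?pP ?eP ?pB1 ?eB1 //.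
rewrite (move_coord_d Eb') ?(move_coord_u Eb') ?eq_letterE //.
rewrite !(move_coord Eb') ?eq_letterE ?nn ?nn' // B0 /= !cats0.
by rewrite nseq_cons.
Qed.

Lemma kr_word_f (i : 'I_n.+1) b : i != ord0 ->
  wff i (word b) = omap (@word X n l) (kr_f i b).
Proof.
move=> i0; have {}i0 : 0 < i by rewrite lt0n.
rewrite /kr_f eqn0Ngt i0 /=; have [lt_i|ge_i] := ltnP i n.
  by have [|_ _ ->] := @word_sig_lt i b; rewrite ?i0.
have Ei : i = n :> nat by apply/eqP; rewrite eqn_leq ge_i -ltnS ltn_ord.
rewrite Ei; have [XE|XE] := typeBD X;
  rewrite ?(match_typeB _ _ XE) ?(match_typeD _ _ XE).
  by have [_ _ ->] := word_sig_nB b XE.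
by have [_ _ ->] := word_sig_nD b XE.
Qed.

Lemma kr_word_e (i : 'I_n.+1) b : i != ord0 -> kr_e i b = None ->
  wep i (word b) = 0.
Proof.
move=> i0; have {}i0 : 0 < i by rewrite lt0n.
have n0 : 0 < n by clear -n2; lia.
have n1 : 0 < n.-1 <= n by clear -n2; lia.
have xn : 0 < n <= n by rewrite n0 leqnn.
have P x : 0 < x <= n -> Pos x \in A by rewrite mem_Pos.
have B x : 0 < x <= n -> Bar x \in A by rewrite mem_Bar.
rewrite /kr_e eqn0Ngt i0 /=; have [lt_i|ge_i] := ltnP i n.
  have ir : 0 < i < n by rewrite i0.
  have ni : (i.+1 == i) = false by clear; lia.
  have ni' : (i == i.+1 :> nat) = false by clear; lia.
  have [-> _ _] := word_sig_lt b ir.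
  have xi : 0 < i <= n by rewrite i0 ltnW.
  have xi1 : 0 < i.+1 <= n by [].
  case: ltnP => le_BP.
    have P0 : 0 < coord b (Pos i.+1) by move: le_BP; clear; lia.
    have [||||b' ->] := @move_Some _ _ _ b (Pos i.+1) (Pos i) n0 (P _ xi1) (P _ xi) _ P0;
      rewrite ?eq_letterE ?ni //.
    by move=> _ [Ei]; move: lt_i; rewrite {1}Ei ltnn.
  have [B0 _|B0] := posnP (coord b (Bar i)); first by move: le_BP; rewrite B0; clear; lia.
  have [||||b' -> //] := @move_Some _ _ _ b (Bar i) (Bar i.+1) n0 (B _ xi) (B _ xi1) _ B0;
    rewrite ?eq_letterE ?ni' //.
  move=> XD [Ei]; have := coord_n b XD; move: le_BP; rewrite Ei; clear; lia.
have Ei : i = n :> nat by apply/eqP; rewrite eqn_leq ge_i -ltnS ltn_ord.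
rewrite Ei; have [XE|XE] := typeBD X;
  rewrite ?(match_typeB _ _ XE) ?(match_typeD _ _ XE).
  have Cn : Circ \in A by rewrite mem_Circ XE.
  have [-> _ _] := word_sig_nB b XE.
  have [C0|C0] := posnP (coord b Circ); rewrite ?C0 /=.
    have [-> //|B0] := posnP (coord b (Bar n)).
    have [||||b' -> //] := @move_Some _ _ _ b (Bar n) Circ n0 (B _ xn) Cn _ B0 => //.
  have [||||b' -> //] := @move_Some _ _ _ b Circ (Pos n) n0 Cn (P _ xn) _ C0 => //.
  by move=> XD; move: XE; rewrite {1}XD.
have [-> _ _] := word_sig_nD b XE.
have cn := coord_n b XE.
have nn : (n == n.-1) = false by clear -n2; lia.
have nn' : (n.-1 == n) = false by clear -n2; lia.
have [B0|B0] := posnP (coord b (Bar n)).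
  have [-> _|B1] := posnP (coord b (Bar n.-1)); first by rewrite B0.
  have [||||b' -> //] := @move_Some _ _ _ b (Bar n.-1) (Pos n) n0 (B _ n1) (P _ xn) _ B1 => //.
  by move=> _ _; rewrite eq_letterE nn' B0.
have [||||b' -> //] := @move_Some _ _ _ b (Bar n) (Pos n.-1) n0 (B _ xn) (P _ n1) _ B0 => //.
by move=> _ [En]; rewrite En eqxx in nn'.
Qed.

End KRWords.

Lemma string_length0 (T : finType) (g : T -> option T) b :
  g b = None -> string_length g b = 0.
Proof.
move=> gb; apply/eqP; rewrite -leqn0; apply/bigmax_leqP => -[[|m] lt_m] //=.
by rewrite -iterS iterSr /= gb iter_obind_None.
Qed.

(** * Crystals modelled by words, and the cancelled letters *)

Section WordModel.
Variables (X : affine_type) (n : nat).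
Hypothesis n2 : 2 < n.
Local Notation wep i := (weps (lphi X n i) (leps X n i)).
Local Notation wph i := (wphi (lphi X n i) (leps X n i)).
Local Notation wff i := (wf (lphi X n i) (leps X n i) (lf X n i)).

(* [W] identifies the crystal [B], without its 0-arrows, with a set of words
   that is stable under the crystal operators of words. *)
Definition word_model (B : crystal n) (W : B -> seq letter) : Prop :=
  forall i : 'I_n.+1, i != ord0 ->
    (forall b, wff i (W b) = omap W (cr_f i b)) /\
    (forall b, cr_e i b = None -> wep i (W b) = 0).

Lemma nonzero_range (i : 'I_n.+1) : i != ord0 -> 0 < i <= n.
Proof. by move=> i0; rewrite lt0n -ltnS ltn_ord andbT. Qed.

Lemma word_f_sig (i : 'I_n.+1) w w' : i != ord0 -> wff i w = Some w' ->
  wph i w = (wph i w').+1 /\ wep i w' = (wep i w).+1.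
Proof.
move=> /nonzero_range ir; apply: wf_sig => c; exact: lf_sig.
Qed.

Section OneCrystal.
Variables (B : crystal n) (W : B -> seq letter).
Hypothesis WB : word_model W.

Lemma model_phi (i : 'I_n.+1) b : i != ord0 -> phi i b = wph i (W b).
Proof.
move=> i0; have [Wf _] := WB i0.
have [m] := ubnP (wph i (W b)); elim: m b => // m IH b lt_m.
have := Wf b; case E: (cr_f i b) => [c|] /= Ew.
  have [h _] := word_f_sig i0 Ew.
  move/cr_fe: E => /phi_e ->; rewrite h IH //; lia.
rewrite /phi string_length0 //.
by have := wf_isSome (lphi X n i) (leps X n i) (lf X n i) (W b); rewrite Ew /=; lia.
Qed.

(** An arrow e_i lowers both sides by 1; where there is no arrow, the second part of [word_model]
    says that the right side is 0 as well. *)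
Lemma model_eps (i : 'I_n.+1) b : i != ord0 -> eps i b = wep i (W b).
Proof.
move=> i0; have [Wf We] := WB i0.
have [m] := ubnP (wep i (W b)); elim: m b => // m IH b lt_m.
case E: (cr_e i b) => [c|]; last by rewrite We // /eps string_length0.
have := Wf c; rewrite (eps_e E); move/cr_fe: E => -> /= Ew.
have [_ h] := word_f_sig i0 Ew.
by rewrite h IH //; lia.
Qed.

End OneCrystal.

Lemma tensor_model (B B' : crystal n) (W : B -> seq letter)
    (W' : B' -> seq letter) : word_model W -> word_model W' ->
  @word_model (B \tens B') (fun p => W p.1 ++ W' p.2).
Proof.
move=> WB WB' i i0; have [Wf We] := WB i i0; have [Wf' We'] := WB' i i0.
split=> -[b b'] /=; rewrite /tensor_f /tensor_e /= (model_phi WB) ?(model_eps WB') //.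
  rewrite wf_cat; case: ifP => _.
    by rewrite Wf; case: (cr_f i b).
  by rewrite Wf'; case: (cr_f i b').
rewrite weps_cat; case: ifPn => [le_b|lt_b].
  by case E: (cr_e i b) => [c|] //= _; rewrite We //; lia.
by case E: (cr_e i b') => [c|] //= _; rewrite (We' _ E) in lt_b *; lia.
Qed.

Lemma KR_model l : @word_model (KR X n l) (@word X n l).
Proof.
by move=> i i0; split=> b; [exact: kr_word_f | exact: kr_word_e].
Qed.

Definition word2 l k (p : KR X n l \tens KR X n k) : seq letter :=
  word p.1 ++ word p.2.

Lemma word2_model l k : word_model (@word2 l k).
Proof. exact: tensor_model (@KR_model l) (@KR_model k). Qed.

Lemma row_Pos1 l (b : KR X n l) : exists2 s,
  row b = nseq (coord b (Pos 1)) (Pos 1) ++ s & Pos 1 \notin s.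
Proof.
have E : alphabet X n = Pos 1 :: behead (alphabet X n).
  by rewrite /alphabet; case: (n) n2.
exists (flatten [seq nseq (coord b c) c | c <- behead (alphabet X n)]).
  by rewrite /row E.
have := alphabet_uniq X n; rewrite E /= => /andP[h _].
apply/flattenP => -[s /mapP[c cA ->]]; rewrite mem_nseq => /andP[_ /eqP Ec].
by rewrite Ec cA in h.
Qed.

Lemma row_Bar1 l (b : KR X n l) : exists2 s,
  row b = s ++ nseq (coord b (Bar 1)) (Bar 1) & Bar 1 \notin s.
Proof.
have [A' E] : exists A', alphabet X n = rcons A' (Bar 1).
  rewrite /alphabet; case: (n) n2 => // m _.
  exists ([seq Pos i | i <- iota 1 m.+1] ++ match X with typeB => [:: Circ] | typeD => [::] end
     ++ [seq Bar i | i <- rev (iota 2 m)]).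
  by rewrite /= rev_cons map_rcons -!rcons_cat.
exists (flatten [seq nseq (coord b c) c | c <- A']).
  by rewrite /row E map_rcons flatten_rcons.
have := alphabet_uniq X n; rewrite E rcons_uniq /= => /andP[h _].
apply/flattenP => -[s /mapP[c cA ->]]; rewrite mem_nseq => /andP[_ /eqP Ec].
by rewrite Ec cA in h.
Qed.

Lemma row_head_Pos1 l (b : KR X n l) z t : row b = nseq z (Pos 1) ++ t ->
  exists2 s, t = nseq (count_mem (Pos 1) t) (Pos 1) ++ s & Pos 1 \notin s.
Proof.
move=> E; have [s Es s1] := row_Pos1 b; exists s => //.
have cz : coord b (Pos 1) = z + count_mem (Pos 1) t.
  by rewrite -row_count E count_cat count_nseq /= ?eqxx ?mul1n.
rewrite E cz nseqD -catA in Es; move/eqP: Es.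
by rewrite eqseq_cat // => /andP[_ /eqP].
Qed.

Lemma row_tail_Bar1 l (b : KR X n l) z t : row b = t ++ nseq z (Bar 1) ->
  exists2 s, t = s ++ nseq (count_mem (Bar 1) t) (Bar 1) & Bar 1 \notin s.
Proof.
move=> E; have [s Es s1] := row_Bar1 b; exists s => //.
have cz : coord b (Bar 1) = count_mem (Bar 1) t + z.
  by rewrite -row_count E count_cat count_nseq /= ?eqxx ?mul1n.
rewrite E cz nseqD catA in Es.
have [|//] := eq_cat _ Es.
by move: (congr1 size Es); rewrite !size_cat !size_nseq; lia.
Qed.

Lemma reading_row_tableau r : reading (row_tableau r) = rev r.
Proof.
elim: r => // a r IH; rewrite /row_tableau /= reading_cons.
by rewrite -/(row_tableau r) IH rev_cons cats1.
Qed.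

Lemma shape_row_tableau r : shape (row_tableau r) = nseq (size r) 1.
Proof. by rewrite /row_tableau; elim: r => //= a r ->. Qed.

Lemma row_tableau_shape T s : shape T = nseq s 1 ->
  exists2 r, T = row_tableau r & size r = s.
Proof.
elim: T s => [|K T IH] [|s] //=; first by exists [::].
case=> K1 /IH[r -> <-]; case: K K1 => [|a []] // _.
by exists (a :: r).
Qed.

Lemma row2_length_shape T : row2_length T = count [pred s | 1 < s] (shape T).
Proof. by rewrite /row2_length /shape count_map. Qed.

(** The 1s begin the row of the first factor and the 1-bars end the row of the second; after
    reversal they are adjacent. The same holds for the output of the rule. *)
Definition cancelling z : seq letter := nseq z (Pos 1) ++ nseq z (Bar 1).

Lemma letter_val_Pos1 i : 0 < i <= n ->
  lphi X n i (Pos 1) = (i == 1) /\ leps X n i (Pos 1) = 0.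
Proof.
case/andP=> i0 le_i; have PA : Pos 1 \in alphabet X n by rewrite mem_Pos; lia.
have [lt_i|ge_i] := ltnP i n.
  have ir : 0 < i < n by rewrite i0.
  have [-> ->] := letter_val_lt n2 PA ir; rewrite !eq_letterE; lia.
have -> : i = n by lia.
have [XB|XD] := typeBD X.
  have [-> ->] := letter_val_nB n2 XB PA; rewrite !eq_letterE; lia.
have [-> ->] := letter_val_nD n2 XD PA; rewrite !eq_letterE; lia.
Qed.

Lemma letter_val_Bar1 i : 0 < i <= n ->
  lphi X n i (Bar 1) = 0 /\ leps X n i (Bar 1) = (i == 1).
Proof.
case/andP=> i0 le_i; have PA : Bar 1 \in alphabet X n by rewrite mem_Bar; lia.
have [lt_i|ge_i] := ltnP i n.
  have ir : 0 < i < n by rewrite i0.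
  have [-> ->] := letter_val_lt n2 PA ir; rewrite !eq_letterE; lia.
have -> : i = n by lia.
have [XB|XD] := typeBD X.
  have [-> ->] := letter_val_nB n2 XB PA; rewrite !eq_letterE; lia.
have [-> ->] := letter_val_nD n2 XD PA; rewrite !eq_letterE; lia.
Qed.

Lemma cancelling_neutral i z : 0 < i <= n -> wep i (cancelling z) = 0 /\ wph i (cancelling z) = 0.
Proof.
move=> ir; have [pP eP] := letter_val_Pos1 ir; have [pB eB] := letter_val_Bar1 ir.
have [e1 p1] := nseq_phi (lphi X n i) z eP.
have [e2 p2] := nseq_eps (leps X n i) z pB.
by rewrite /cancelling !(weps_cat, wphi_cat) e1 p1 e2 p2 pP eB; lia.
Qed.

Lemma wf_cancelling i z u v : 0 < i <= n -> wff i (u ++ cancelling z ++ v) =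
  omap (fun s => take (size u) s ++ cancelling z ++ drop (size u) s) (wff i (u ++ v)).
Proof.
move=> ir; have [e p] := cancelling_neutral z ir.
have [ev _] := neutral_cat v e p.
rewrite !wf_cat ev; case: ifP => _.
  case E: (wff i u) => [u'|] //=.
  by rewrite take_size_cat ?drop_size_cat // (wf_size E).
rewrite p /=; case: (wff i v) => [v'|] //=.
by rewrite take_size_cat ?drop_size_cat.
Qed.

End WordModel.

(** * The rule commutes with the classical operators *)

Section Transport.
Variables (X : affine_type) (n : nat).
Hypothesis n2 : 2 < n.
Local Notation wep i := (weps (lphi X n i) (leps X n i)).
Local Notation wph i := (wphi (lphi X n i) (leps X n i)).
Local Notation wff i := (wf (lphi X n i) (leps X n i) (lf X n i)).
Local Notation link i := (word_link (lphi X n i) (leps X n i) (lf X n i)).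

Definition insertion_data (p : nat) (Ts v : seq letter) (T0 : tableau)
    (r w : seq letter) : Prop :=
  insert_word X n v (row_tableau Ts) T0 /\
  uninserts X n (p - row2_length T0) (row2_length T0) T0 (row_tableau r) w.

Lemma insertion_data_link i p Ts v T0 r w : 0 < i <= n -> insertion_data p Ts v T0 r w ->
  link i (rev Ts ++ rev v) (rev r ++ rev w) (fun x y =>
    exists Ts' v' T0' r' w', [/\ x = rev Ts' ++ rev v', y = rev r' ++ rev w',
      insertion_data p Ts' v' T0' r' w',
      size Ts' = size Ts /\ size r' = size r &
      row2_length T0' = row2_length T0]).
Proof.
move=> ir [hI hU].
have L1 := insert_word_link n2 ir hI.
have L2 := uninserts_link n2 ir hU.
rewrite !reading_row_tableau in L1 L2.
apply: (link_trans L1 L2) => x y y'.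
move=> [v' [T [T0' [-> -> hI' sv [sT sT0]]]]].
move=> [T0'' [T' [w' [E -> hU' [sT0' sT'] sw]]]].
have E0 : T0' = T0'' by apply: reading_inj => //; rewrite sT0 sT0'.
subst T0''.
have [Ts' ET sTs] := row_tableau_shape (etrans sT (shape_row_tableau _)).
have [r' Er sr] := row_tableau_shape (etrans sT' (shape_row_tableau _)).
subst T T'; exists Ts', v', T0', r', w'; rewrite !reading_row_tableau.
have E2 : row2_length T0' = row2_length T0 by rewrite !row2_length_shape sT0.
by split=> //; rewrite /insertion_data E2.
Qed.

Lemma wf_no_Pos1 i w w' : 0 < i <= n -> wff i w = Some w' ->
  Pos 1 \in w' -> Pos 1 \in w.
Proof.
move=> ir; elim: w w' => //= c w IH w'; case: ifP => h.
  move=> [<-]; rewrite !inE => /orP[/eqP E|->]; last by rewrite orbT.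
  have [_] := lf_sig n2 ir (leq_ltn_trans (leq0n _) h).
  by rewrite -E (letter_val_Pos1 X n2 ir).2.
case E: (wff i w) => [v|] //= [<-]; rewrite !inE => /orP[->//|/(IH _ E) ->].
by rewrite orbT.
Qed.

(** Says that z was the full minimum: no pair of 1 and 1-bar is left. *)
Definition separated (Ts v : seq letter) : bool :=
  ~~ ((Pos 1 \in Ts) && (Bar 1 \in v)).

(** The rule with z as a parameter; the minimum in [cancelled] is replaced by [separated], which can
    be followed along arrows. *)
Definition rule_data l k (p : KR X n l \tens KR X n k) (q : KR X n k \tens KR X n l)
    (z m : nat) : Prop :=
  exists Ts v T0 r w,
    [/\ row p.1 = nseq z (Pos 1) ++ Ts /\ row p.2 = v ++ nseq z (Bar 1),
        separated Ts v, insertion_data (l - z) Ts v T0 r w, row2_length T0 = m &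
        row q.1 = nseq z (Pos 1) ++ r /\ row q.2 = w ++ nseq z (Bar 1)].

(* Only f_1 creates a letter 1-bar; it does so at the barred end of the second
   factor, and only if that factor has no 1-signature to cancel the letters 1
   of the first factor. *)
Lemma separated_f (i : 'I_n.+1) l k (b1 : KR X n l) (b2' : KR X n k)
    z Ts v Ts' v' : i != ord0 ->
  row b1 = nseq z (Pos 1) ++ Ts -> row b2' = v' ++ nseq z (Bar 1) ->
  size Ts' = size Ts -> separated Ts v ->
  wff i (rev Ts ++ rev v) = Some (rev Ts' ++ rev v') -> separated Ts' v'.
Proof.
move=> i0 Eb Eb' sTs sep; have ir := nonzero_range i0.
case/wf_catl=> -[s [hs Es E]].
  have [|E1 /(can_inj revK) Ev] := eq_cat _ E.
    by rewrite (wf_size Es) !size_rev.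
  apply/negP => /andP[T1 v1]; move: sep; rewrite /separated -Ev v1 andbT.
  by rewrite -mem_rev (wf_no_Pos1 ir Es) // -E1 mem_rev.
have [|/(can_inj revK) ET Ev] := eq_cat _ E; first by rewrite !size_rev.
apply/negP => /andP[T1 v1]; move: sep; rewrite /separated -ET T1 /= => nv.
rewrite ET in T1.
have [s' Ev' _] := row_tail_Bar1 n2 Eb'.
have [t Et] : exists t, s = Bar 1 :: t.
  move: v1; rewrite -has_pred1 has_count -Ev Ev' rev_cat rev_nseq.
  rewrite -Ev'; case: (count_mem _ _) => // m _.
  by exists (nseq m (Bar 1) ++ rev s').
have [s1 ETs _] := row_head_Pos1 n2 Eb.
have [e1 p1] := letter_val_Bar1 X n2 ir.
rewrite Et in Es; move: Es hs nv; rewrite -mem_rev.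
case: (rev v) => //= c t0; rewrite inE negb_or => + + /andP[cB _].
case: ifP => lt_c.
  case=> Ec _ hs; have c0 := leq_ltn_trans (leq0n _) lt_c.
  have [hp he] := lf_sig n2 ir c0.
  rewrite Ec p1 in he; have i1 : i = 1 :> nat by case: eqP he.
  rewrite i1 eqxx in he; case: he => he.
  have : 0 < count_mem (Pos 1) Ts by rewrite -has_count has_pred1.
  move: hs; rewrite ETs rev_cat rev_nseq wphi_cat -ETs.
  have [pP eP] := letter_val_Pos1 X n2 ir.
  have [e2 p2] := nseq_phi (lphi X n i) (count_mem (Pos 1) Ts) eP.
  rewrite e2 p2 pP i1 eqxx -{1}i1; move: lt_c; rewrite i1 -he; clear; lia.
by case: (wff i t0) => //= w [Ec]; rewrite Ec eqxx in cB.
Qed.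

(** Here q is any outcome of the rule, not yet the image of p under the isomorphism; both the arrow
    at q and the existence of an outcome at p' are produced by the link. *)
Lemma rule_data_f (i : 'I_n.+1) l k (p p' : KR X n l \tens KR X n k) q z m :
  i != ord0 -> rule_data p q z m -> cr_f i p = Some p' ->
  exists2 q', cr_f i q = Some q' & rule_data p' q' z m.
Proof.
move=> i0 [Ts [v [T0 [r [w [[E1 E2] sep hc hm [E3 E4]]]]]]] Ef.
have ir := nonzero_range i0.
have [Wp _] := word2_model X n2 l k i0.
have [Wq _] := word2_model X n2 k l i0.
have wp : word2 p = rev Ts ++ cancelling z ++ rev v.
  by rewrite /word2 /word E1 E2 !rev_cat !rev_nseq /cancelling -!catA.
have wq : word2 q = rev r ++ cancelling z ++ rev w.
  by rewrite /word2 /word E3 E4 !rev_cat !rev_nseq /cancelling -!catA.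
have := Wp p; rewrite Ef wp wf_cancelling //=.
case Eu: (wff i (rev Ts ++ rev v)) => [u|] //= [Ew'].
have [_ _ H] := insertion_data_link ir hc.
have [y Ey [Ts' [v' [T0' [r' [w' [Eu' Ey' hc' [sT sr] hm']]]]]]] := H _ Eu.
have := Wq q; rewrite wq wf_cancelling //= Ey /=.
case Eq: (tensor_f i q) => [q'|] //= [Ewq]; exists q' => //.
rewrite Eu' take_size_cat ?drop_size_cat ?size_rev ?sT // in Ew'.
rewrite Ey' take_size_cat ?drop_size_cat ?size_rev ?sr // in Ewq.
(* The lengths of the factors are fixed, so the word shows where the first factor with its z letters
   1 ends. *)
have split_words l1 k1 (p0 t0 : KR X n l1 \tens KR X n k1) s t s0 :
    row p0.1 = nseq z (Pos 1) ++ s0 -> size s = size s0 ->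
    rev s ++ cancelling z ++ rev t = word2 t0 ->
    row t0.1 = nseq z (Pos 1) ++ s /\ row t0.2 = t ++ nseq z (Bar 1).
  move=> Er Es; rewrite /cancelling -!catA catA => Et.
  have [|Et1 Et2] := eq_cat _ Et.
    rewrite size_cat size_rev size_nseq /word size_rev size_row.
    have H0 := size_row p0.1; rewrite Er size_cat size_nseq in H0.
    by rewrite Es addnC H0.
  split; apply: (can_inj revK); rewrite -/(word _) -?Et1 -?Et2 rev_cat rev_nseq //.
have [F1 F2] := split_words _ _ _ _ _ _ _ E1 sT Ew'.
have [F3 F4] := split_words _ _ _ _ _ _ _ E3 sr Ewq.
exists Ts', v', T0', r', w'; split=> //; last by rewrite hm'.
by apply: separated_f i0 E1 F2 sT sep _; rewrite Eu Eu'.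
Qed.

End Transport.

(** * Highest weight elements *)

Section HighestWeight.
Variables (X : affine_type) (n : nat).
Hypothesis n2 : 2 < n.
Local Notation A := (alphabet X n).
Local Notation wep i := (weps (lphi X n i) (leps X n i)).
Local Notation wph i := (wphi (lphi X n i) (leps X n i)).
Local Notation wff i := (wf (lphi X n i) (leps X n i) (lf X n i)).

(** A measure for climbing to a highest weight element; the shift by n makes the contribution of
    every letter of the alphabet nonnegative. *)
Definition height (w : seq letter) : nat :=
  sumn [seq Z.to_nat (zcode n c + Z.of_nat n) | c <- w].

Lemma wf_height i w w' : 0 < i <= n -> wff i w = Some w' ->
  height w < height w'.
Proof.
move=> ir; rewrite /height; elim: w w' => //= c w IH w'; case: ifP => h.
  move=> [<-] /=; have c0 := leq_ltn_trans (leq0n _) h.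
  have := zf_bounds n2 ir c0; rewrite (zcode_lf n2 ir c0).
  by clear; lia.
by case E: (wff i w) => [v|] //= [<-] /=; have := IH _ E; clear; lia.
Qed.

Lemma crystal_ind (B : crystal n) (W : B -> seq letter) (P : B -> Prop) :
  word_model X W ->
  (forall p, (forall i, i != ord0 -> cr_e i p = None) -> P p) ->
  (forall i p p', i != ord0 -> cr_f i p = Some p' -> P p -> P p') ->
  forall p, P p.
Proof.
move=> WB Phw Pf p; have [N] := ubnP (height (W p)).
elim: N p => // N IH p lt_N.
have [/existsP[i /andP[i0]]|] := boolP [exists i, (i != ord0) && (cr_e i p != None)].
  case E: (cr_e i p) => [p1|] // _; move/cr_fe: E => E.
  apply: (Pf i p1) => //; apply: IH.
  have := (WB i i0).1 p1; rewrite E => /(wf_height (nonzero_range i0)).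
  by move: lt_N; clear; lia.
rewrite negb_exists => /forallP h; apply: Phw => i i0.
by have := h i; rewrite i0 /= negbK => /eqP.
Qed.

(** The letter 2-bar does not occur at highest weight, but it is created by the arrow e_0 that
    removes a letter 1. *)
Lemma row_support l (b : KR X n l) :
  (forall c, c \notin [:: Pos 1; Pos 2; Bar 2; Bar 1] -> coord b c = 0) ->
  row b = nseq (coord b (Pos 1)) (Pos 1) ++ nseq (coord b (Pos 2)) (Pos 2) ++
    nseq (coord b (Bar 2)) (Bar 2) ++ nseq (coord b (Bar 1)) (Bar 1).
Proof.
move=> h; have [S E] : exists S, A = [:: Pos 1; Pos 2] ++ S ++ [:: Bar 2; Bar 1].
  exists ([seq Pos i | i <- iota 3 n.-2] ++
    match X with typeB => [:: Circ] | typeD => [::] end ++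
    [seq Bar i | i <- rev (iota 3 n.-2)]).
  rewrite /alphabet; case: (n) n2 => [|[|m]] // _.
  by rewrite /= !rev_cons !map_rcons -!cats1 -!catA.
have SE : blocks (coord b) S = [::].
  have: forall c, c \in S -> coord b c = 0.
    move=> c cS; apply: h; apply/negP => hc.
    have := alphabet_uniq X n; rewrite E uniq_catC -catA.
    rewrite cat_uniq => /and3P[_ /hasPn H _].
    have /H : c \in [:: Bar 2; Bar 1] ++ [:: Pos 1; Pos 2].
      by move: hc; rewrite !inE => /or4P[] ->; rewrite ?orbT.
    by rewrite /= cS.
  elim: S {E} => //= c S IH H; rewrite /blocks /= H ?inE ?eqxx //=.
  by apply: IH => d dS; apply: H; rewrite inE dS orbT.
rewrite [LHS](_ : _ = blocks (coord b) A) // E !blocks_cat SE /blocks /= !cats0.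
by rewrite -!catA.
Qed.

(** For i > 1, epsilon_i bounds the number of letters i-bar; once these vanish, it also bounds the
    number of letters i+1 for i < n, and epsilon_n bounds that of o. The letters 2 and 1-bar are
    counted by epsilon_1 only. *)
Lemma eps0_coords l (b : KR X n l) : (forall i, 1 < i <= n -> wep i (word b) = 0) ->
  forall c, c \notin [:: Pos 1; Pos 2; Bar 1] -> coord b c = 0.
Proof.
move=> h; have hlt i : 1 < i < n ->
    coord b (Bar i) + (coord b (Pos i.+1) - coord b (Bar i.+1)) = 0.
  move=> /andP[i1 lt_i]; have i0 : 0 < i by apply: ltnW.
  have ir : 0 < i < n by rewrite i0.
  by have [<- _ _] := word_sig_lt n2 b ir; apply: h; rewrite i1 ltnW.
have hn : wep n (word b) = 0 by apply: h; rewrite leqnn andbT ltnW.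
have hB x : 1 < x <= n -> coord b (Bar x) = 0.
  case/andP=> x1; rewrite leq_eqVlt => /orP[/eqP ->|lt_x].
    have [XB|XD] := typeBD X.
      by have [E _ _] := word_sig_nB n2 b XB; move: hn; rewrite E; clear; lia.
    by have [E _ _] := word_sig_nD n2 b XD; move: hn; rewrite E; clear; lia.
  by have := hlt x; rewrite x1 lt_x => /(_ isT); clear; lia.
move=> c hc; have [cA|cA] := boolP (c \in A); last exact: coord_notin.
case: c hc cA => [x||x]; rewrite ?mem_Pos ?mem_Bar !inE !eq_letterE => hc xr.
- have [y Ey] : exists y, x = y.+1 by exists x.-1; move: xr; clear; lia.
  have := hlt y; have := hB x; rewrite Ey; move: hc xr; rewrite Ey; clear.
  move: (coord b _) (coord b _) (coord b _) => u v w; lia.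
- have [XB|XD] := typeBD X; last by move: xr; rewrite mem_Circ (match_typeD _ _ XD).
  by have [E _ _] := word_sig_nB n2 b XB; move: hn; rewrite E; clear; lia.
by apply: hB; move: hc xr; clear; lia.
Qed.

Definition highest_weight l k (p : KR X n l \tens KR X n k) (m z : nat) : Prop :=
  [/\ row p.1 = nseq l (Pos 1),
      exists a, row p.2 = nseq a (Pos 1) ++ nseq m (Pos 2) ++ nseq z (Bar 1) &
      m + z <= l].

(** Epsilon of a tensor product dominates that of its left factor, which is therefore 1^l. Its phi_i
    vanishes for i > 1 and is l for i = 1, so the right factor may have epsilon_1 = m + z up to l
    and no other epsilon_i. *)
Lemma highest_weight_form l k (p : KR X n l \tens KR X n k) :
  (forall i, i != ord0 -> cr_e i p = None) -> exists m z, highest_weight p m z.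
Proof.
move=> he; have hw0 i : 0 < i <= n -> wep i (word p.1 ++ word p.2) = 0.
  case/andP=> i0 le_i; have hi : (inord i : 'I_n.+1) != ord0.
    by rewrite -val_eqE /= inordK // -lt0n.
  have [_ He] := word2_model X n2 l k hi.
  by have := He p (he _ hi); rewrite inordK.
have h1 i : 0 < i <= n -> wep i (word p.1) = 0.
  by move=> /hw0; rewrite weps_cat; clear; lia.
have c1 : forall c, c \notin [:: Pos 1; Pos 2; Bar 1] -> coord p.1 c = 0.
  by apply: eps0_coords => i /andP[i1 le_i]; apply: h1; rewrite le_i ltnW.
have r1 : 0 < 1 < n by clear -n2; lia.
have [E1 E1' _] := word_sig_lt n2 p.1 r1.
have B2 : coord p.1 (Bar 2) = 0 by apply: c1.
rewrite h1 ?B2 in E1; last by move: n2; clear; lia.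
have R1 : row p.1 = nseq (coord p.1 (Pos 1)) (Pos 1).
  rewrite row_support.
    have [-> ->] : coord p.1 (Pos 2) = 0 /\ coord p.1 (Bar 1) = 0.
      by move: E1; clear; lia.
    by rewrite B2 /= cats0.
  move=> c hc; apply: c1; move: hc; rewrite !inE.
  by case: (c == Pos 1); case: (c == Pos 2); case: (c == Bar 1); rewrite ?orbT.
have sl : coord p.1 (Pos 1) = l by rewrite -[RHS](size_row p.1) R1 size_nseq.
rewrite sl in R1.
have w1 : word p.1 = nseq l (Pos 1) by rewrite /word R1 rev_nseq.
have ph i : 0 < i <= n -> wph i (word p.1) = l * (i == 1).
  move=> ir; have [pP eP] := letter_val_Pos1 X n2 ir.
  by rewrite w1 (nseq_phi _ _ eP).2 pP.
have c2 : forall c, c \notin [:: Pos 1; Pos 2; Bar 1] -> coord p.2 c = 0.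
  apply: eps0_coords => i /andP[i1 le_i].
  have ir : 0 < i <= n by rewrite le_i ltnW.
  have := hw0 i ir; rewrite weps_cat ph // h1 //.
  by rewrite (gtn_eqF i1) muln0 subn0.
have B2' : coord p.2 (Bar 2) = 0 by apply: c2.
have R2 : row p.2 = nseq (coord p.2 (Pos 1)) (Pos 1) ++
    nseq (coord p.2 (Pos 2)) (Pos 2) ++ nseq (coord p.2 (Bar 1)) (Bar 1).
  rewrite row_support ?B2' //= => c hc; apply: c2; move: hc; rewrite !inE.
  by case: (c == Pos 1); case: (c == Pos 2); case: (c == Bar 1); rewrite ?orbT.
exists (coord p.2 (Pos 2)), (coord p.2 (Bar 1)); split=> //.
  by exists (coord p.2 (Pos 1)).
have r1' : 0 < 1 <= n by clear -n2; lia.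
have [E2 _ _] := word_sig_lt n2 p.2 r1.
have := hw0 1 r1'; rewrite weps_cat ph // h1 // E2 B2'; clear; lia.
Qed.

(** * Insertion and inverse insertion for tableaux with columns (1|y) and (1) *)

Definition one_y_tableau y m r : tableau := nseq m [:: Pos 1; y] ++ nseq r [:: Pos 1].

Section Tab.
Variable y : letter.
Hypothesis yA : y \in A.
(** The bounds exclude 1, which does not stack below 1, and 1-bar, which would make the columns
    (1|y) fall under the special cases for x and x-bar. Two values are used: 2 at highest weight,
    and 2-bar after an arrow e_0. *)
Hypothesis y_bounds :
  (- Z.of_nat n < zcode n y < Z.of_nat n /\ zcode n y <> 0)%Z.

Let P1A : Pos 1 \in A. Proof. by rewrite mem_Pos; clear -n2; lia. Qed.
Let P1z : zcode n (Pos 1) = (- Z.of_nat n)%Z. Proof. by rewrite /=; lia. Qed.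

Lemma bump_1 : Defs.bump X n (Pos 1) [:: Pos 1] [:: Pos 1] (Pos 1).
Proof.
apply/bump_one; split=> //; split; first by lia.
by rewrite P1z; case: X; clear -n2; lia.
Qed.

Lemma bump_1y : Defs.bump X n (Pos 1) [:: Pos 1; y] [:: Pos 1; y] (Pos 1).
Proof.
apply: zbump_bump => //; split; first by rewrite /= P1A yA.
rewrite P1z; case: X; [right; left | do 3 (split; first lia); right; left];
  move: y_bounds; clear -n2; lia.
Qed.

Lemma bump_yy : Defs.bump X n y [:: Pos 1; y] [:: Pos 1; y] y.
Proof.
apply: zbump_bump => //; split; first by rewrite /= P1A yA.
rewrite P1z; case: X; [left | do 3 (split; first lia); left];
  move: y_bounds; clear -n2; lia.
Qed.

Lemma stacks_1y : stacks X n (Pos 1) y.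
Proof.
left; apply/lltP; split=> //; first by rewrite P1z; lia.
by rewrite P1z => -[_ []]; lia.
Qed.

Lemma insert_y j r : Defs.insert X n y (one_y_tableau y j r.+1) (one_y_tableau y j.+1 r).
Proof.
elim: j => [|j IH]; first exact/insert_A1/stacks_1y.
exact: insert_bump bump_yy IH.
Qed.

Lemma insert_1 j r : Defs.insert X n (Pos 1) (one_y_tableau y j r) (one_y_tableau y j r.+1).
Proof.
elim: j => [|j IH]; last exact: insert_bump bump_1y IH.
elim: r => [|r IH]; first exact: insert_A0.
exact: insert_bump bump_1 IH.
Qed.

(** Insertion begins at the right end of the word: each y passes through the columns (1|y) and stops
    below the first single 1; afterwards each 1 passes through all columns and lengthens the first
    row. *)
Lemma insert_word_one_y a m l : m <= l ->
  insert_word X n (nseq a (Pos 1) ++ nseq m y) (row_tableau (nseq l (Pos 1)))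
    (one_y_tableau y m (l - m + a)).
Proof.
move=> ml; elim: a => [|a IH]; last first.
  by rewrite addnS; apply: insert_cons IH (insert_1 _ _).
rewrite addn0 /=; elim: m ml => [|m IH] ml.
  by rewrite subn0 /row_tableau map_nseq; constructor.
apply: insert_cons (IH (ltnW ml)) _.
by rewrite -(subnSK ml); apply: insert_y.
Qed.

Lemma one_y_tableau_rcons1 m r : one_y_tableau y m r.+1 = rcons (one_y_tableau y m r) [:: Pos 1].
Proof. by rewrite /one_y_tableau rcons_cat -cats1 nseq_cons cats0. Qed.

Lemma one_y_tableau_rcons2 m : one_y_tableau y m.+1 0 = rcons (one_y_tableau y m 0) [:: Pos 1; y].
Proof. by rewrite /one_y_tableau !cats0 -cats1 nseq_cons cats0. Qed.

Lemma uninsert_1 m r : uninsert X n (Pos 1) (one_y_tableau y m r) (one_y_tableau y m r) (Pos 1).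
Proof.
elim: r => [|r IH]; last by rewrite one_y_tableau_rcons1; apply: uninsert_rcons bump_1 IH.
elim: m => [|m IH]; first exact: uninsert_nil.
by rewrite one_y_tableau_rcons2; apply: uninsert_rcons bump_1y IH.
Qed.

Lemma uninsert_y m : uninsert X n y (one_y_tableau y m 0) (one_y_tableau y m 0) y.
Proof.
elim: m => [|m IH]; first exact: uninsert_nil.
by rewrite one_y_tableau_rcons2; apply: uninsert_rcons bump_yy IH.
Qed.

(** A letter removed from either row passes unchanged through the columns on its left, so the first
    row releases 1s and the second row releases ys. *)
Lemma uninserts_one_y p m r :
  uninserts X n p m (one_y_tableau y m (p + r)) (row_tableau (nseq (m + r) (Pos 1)))
    (nseq p (Pos 1) ++ nseq m y).
Proof.
elim: p => [|p IH]; last first.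
  apply: uninserts_row1 IH; rewrite addSn one_y_tableau_rcons1.
  exact/UninsertRow1/uninsert_1.
rewrite add0n; elim: m r => [|m IH] r.
  by rewrite /row_tableau map_nseq; constructor.
rewrite addSnnS; apply: uninserts_row2 (IH r.+1).
have -> : one_y_tableau y m.+1 r = one_y_tableau y m 0 ++ [:: Pos 1; y] :: nseq r [:: Pos 1].
  by rewrite /one_y_tableau cats0 nseq_cons.
have -> : one_y_tableau y m r.+1 = one_y_tableau y m 0 ++ [:: Pos 1] :: nseq r [:: Pos 1].
  by rewrite /one_y_tableau cats0.
apply: UninsertRow2; first exact: uninsert_y.
by apply/allP => K; rewrite mem_nseq => /andP[_ /eqP ->].
Qed.

Lemma row2_length_one_y m r : row2_length (one_y_tableau y m r) = m.
Proof.
by rewrite /row2_length /one_y_tableau count_cat !count_nseq /= mul1n mul0n addn0.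
Qed.

End Tab.

Lemma mem_Pos2 : Pos 2 \in A /\
  (- Z.of_nat n < zcode n (Pos 2) < Z.of_nat n /\ zcode n (Pos 2) <> 0)%Z.
Proof. by rewrite mem_Pos; split; rewrite /=; lia. Qed.

Lemma mem_Bar2 : Bar 2 \in A /\
  (- Z.of_nat n < zcode n (Bar 2) < Z.of_nat n /\ zcode n (Bar 2) <> 0)%Z.
Proof. by rewrite mem_Bar; split; rewrite /=; lia. Qed.

(** Both sides contain the same letters 2 and 1-bar; the numbers of 1s are forced by the row lengths
    k and l. *)
Lemma rule_data_highest l k (p : KR X n l \tens KR X n k) q m z :
  highest_weight p m z -> highest_weight q m z -> rule_data p q z m.
Proof.
move=> [E1 [a E2] le_l] [E3 [a' E4] le_k].
have sa : a + (m + z) = k.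
  by have := size_row p.2; rewrite E2 !size_cat !size_nseq.
have sa' : a' + (m + z) = l.
  by have := size_row q.2; rewrite E4 !size_cat !size_nseq.
have [yA yb] := mem_Pos2.
exists (nseq (l - z) (Pos 1)), (nseq a (Pos 1) ++ nseq m (Pos 2)).
exists (one_y_tableau (Pos 2) m (l - z - m + a)), (nseq (m + a) (Pos 1)).
exists (nseq a' (Pos 1) ++ nseq m (Pos 2)).
have El : l = z + (l - z) by move: le_l; clear; lia.
have Ek : k = z + (m + a) by move: sa; clear; lia.
split.
- by rewrite E1 E2 -nseqD -El -catA.
- rewrite /separated mem_cat !mem_nseq /= !andbF.
  by [].
- rewrite /insertion_data row2_length_one_y; split.
    by apply: insert_word_one_y => //; move: le_l; clear; lia.
  have -> : a' = l - z - m by move: sa'; clear; lia.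
  exact: uninserts_one_y.
- exact: row2_length_one_y.
by rewrite E3 E4 -nseqD -Ek -catA.
Qed.

End HighestWeight.

(** * The isomorphism and the energy function *)

Lemma iso_phi n (B B' : crystal n) (g : B -> B') i b : crystal_iso g ->
  phi i (g b) = phi i b.
Proof.
case=> _ _ gf; have [m] := ubnP (phi i b); elim: m b => // m IH b lt_m.
case E: (cr_f i b) => [c|]; last by rewrite /phi !string_length0 // gf E.
have E' : cr_f i (g b) = Some (g c) by rewrite gf E.
move/cr_fe: E => /phi_e Eb; move/cr_fe: E' => /phi_e ->.
by rewrite Eb IH //; move: lt_m; rewrite Eb ltnS.
Qed.

Lemma energy_step_nonzero n (B B' : crystal n)
    (iota : B \tens B' -> B' \tens B) i p :
  i != ord0 -> energy_step iota i p = 0%R.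
Proof. by rewrite /energy_step => /negPf ->. Qed.

Lemma int_drop (x y : int) : (y - x = -1)%R -> x = (y + 1)%R.
Proof. lia. Qed.

Section Final.
Variables (X : affine_type) (n : nat).
Hypothesis n2 : 2 < n.
Local Notation wep i := (weps (lphi X n i) (leps X n i)).
Local Notation wph i := (wphi (lphi X n i) (leps X n i)).

Lemma hw_inj l k (p p' : KR X n l \tens KR X n k) m z :
  highest_weight p m z -> highest_weight p' m z -> p = p'.
Proof.
move=> [E1 [a E2] _] [F1 [a' F2] _]; case: p p' E1 E2 F1 F2 => p1 p2 [q1 q2] /=.
move=> E1 E2 F1 F2; congr pair; apply: row_inj; rewrite ?E1 ?F1 // E2 F2.
have := size_row p2; have := size_row q2; rewrite E2 F2 !size_cat !size_nseq.
by move=> h h'; congr (nseq _ _ ++ _); move: h h'; clear; lia.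
Qed.

(** The second equation is phi_1 = k + l - 2(m + z) without subtraction. Thus phi_1 and phi_2
    determine m and z. *)
Lemma hw_wphi l k (p : KR X n l \tens KR X n k) m z : highest_weight p m z ->
  wph 2 (word2 p) = m /\ wph 1 (word2 p) + (z + m + z + m) = k + l.
Proof.
move=> [E1 [a E2] le_l].
have sa : a + (m + z) = k.
  by have := size_row p.2; rewrite E2 !size_cat !size_nseq.
have r1 : 0 < 1 < n by clear -n2; lia.
have r2 : 0 < 2 < n by [].
have r1' : 0 < 1 <= n by clear -n2; lia.
have r2' : 0 < 2 <= n by clear -n2; lia.
have [P2A _] := mem_Pos2 X n2.
have [pP1 eP1] := letter_val_Pos1 X n2 r1'.
have [pP2 eP2] := letter_val_Pos1 X n2 r2'.
have [pB1 eB1] := letter_val_Bar1 X n2 r1'.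
have [pB2 eB2] := letter_val_Bar1 X n2 r2'.
have [p1 e1] := letter_val_lt n2 P2A r1.
have [p2 e2] := letter_val_lt n2 P2A r2.
rewrite /= in p1 e1 p2 e2.
have [x1 x2] := nseq_phi (lphi X n 1) a eP1.
have [x3 x4] := nseq_phi (lphi X n 2) a eP2.
have [y1 y2] := nseq_phi (lphi X n 1) l eP1.
have [y3 y4] := nseq_phi (lphi X n 2) l eP2.
have [z1 z2] := nseq_eps (leps X n 1) z pB1.
have [z3 z4] := nseq_eps (leps X n 2) z pB2.
have [u1 u2] := nseq_eps (leps X n 1) m p1.
have [u3 u4] := nseq_phi (lphi X n 2) m e2.
rewrite /word2 /word E1 E2 !rev_cat !rev_nseq !(weps_cat, wphi_cat).
rewrite ?(x1, x2, x3, x4, y2, y4, z1, z2, z3, z4, u1, u2, u3, u4).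
rewrite ?(pP1, pP2, eB1, eB2, e1, p2) /=; move: sa le_l; clear; lia.
Qed.

Lemma letter_eps_Pos2 i : 1 < i <= n -> leps X n i (Pos 2) = 0.
Proof.
case/andP=> i1 le_i; have [P2A _] := mem_Pos2 X n2.
have [lt_i|ge_i] := ltnP i n.
  have ir : 0 < i < n by rewrite ltnW.
  have [_ ->] := letter_val_lt n2 P2A ir; rewrite !eq_letterE.
  by move: i1; clear; lia.
have -> : i = n by apply/eqP; rewrite eqn_leq le_i.
have [XB|XD] := typeBD X; first by have [_ ->] := letter_val_nB n2 XB P2A.
by have [_ ->] := letter_val_nD n2 XD P2A.
Qed.

Lemma hw_e l k (p : KR X n l \tens KR X n k) m z i : highest_weight p m z -> i != ord0 ->
  cr_e i p = None.
Proof.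
move=> [E1 [a E2] le_l] i0; case E: (cr_e i p) => [p1|] //.
have := eps_e E; rewrite (model_eps n2 (word2_model X n2 l k) _ i0).
have ir := nonzero_range i0.
have [pP eP] := letter_val_Pos1 X n2 ir.
have [pB eB] := letter_val_Bar1 X n2 ir.
have [x1 x2] := nseq_phi (lphi X n i) a eP.
have [y1 y2] := nseq_phi (lphi X n i) l eP.
have [z1 z2] := nseq_eps (leps X n i) z pB.
rewrite /word2 /word E1 E2 !rev_cat !rev_nseq !(weps_cat, wphi_cat).
rewrite ?(x1, x2, y1, y2, z1, z2) pP eB.
have [i1|i1] := eqVneq (i : nat) 1.
  have [P2A _] := mem_Pos2 X n2.
  have r1 : 0 < 1 < n by clear -n2; lia.
  have [p1' e1'] := letter_val_lt n2 P2A r1; rewrite /= in p1' e1'.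
  have [u1 u2] := nseq_eps (leps X n 1) m p1'.
  by rewrite i1 u1 u2 e1'; move: le_l; clear; lia.
have i2 : 1 < i <= n by move: ir i1; clear; lia.
have [u1 u2] := nseq_phi (lphi X n i) m (letter_eps_Pos2 i2).
by rewrite u1; clear; lia.
Qed.

Lemma rule_data_cancelled l k (p : KR X n l \tens KR X n k) q z m :
  rule_data p q z m -> cancelled p.1 p.2 = z.
Proof.
move=> [Ts [v [T0 [r [w [[E1 E2] sep _ _ _]]]]]].
rewrite /cancelled E1 E2 !count_cat !count_nseq /= mul1n.
move: sep; rewrite /separated -!has_pred1 !has_count.
by move: (count _ _) (count _ _) => c1 c2; clear; lia.
Qed.

Lemma iter_rem_head (c : letter) z s : ssrnat.iter z (rem c) (nseq z c ++ s) = s.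
Proof. by elim: z => //= z IH; rewrite -iterS iterSr /= eqxx. Qed.

Lemma rem_tail (c : letter) s z : c \notin s ->
  rem c (s ++ nseq z.+1 c) = s ++ nseq z c.
Proof.
elim: s => [|d s IH] /=; first by rewrite eqxx.
by rewrite inE negb_or eq_sym => /andP[/negPf -> /IH ->].
Qed.

Lemma iter_rem_tail (c : letter) z y s : c \notin s ->
  ssrnat.iter z (rem c) (s ++ nseq (y + z) c) = s ++ nseq y c.
Proof.
move=> cs; elim: z => [|z IH]; first by rewrite addn0.
by rewrite addnS iterSr rem_tail.
Qed.

Lemma iter_rem_parts l k (p : KR X n l \tens KR X n k) z Ts v :
  row p.1 = nseq z (Pos 1) ++ Ts -> row p.2 = v ++ nseq z (Bar 1) ->
  ssrnat.iter z (rem (Pos 1)) (row p.1) = Ts /\ ssrnat.iter z (rem (Bar 1)) (row p.2) = v.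
Proof.
move=> E1 E2; rewrite E1 E2 iter_rem_head; split=> //.
have [s Ev cs] := row_tail_Bar1 n2 E2.
by rewrite {1}Ev -catA -nseqD iter_rem_tail // -Ev.
Qed.

Lemma rule_of_data l k (p : KR X n l \tens KR X n k) q z m : rule_data p q z m ->
  rule p.1 p.2 q.1 q.2 (l - z) (k - z) m.
Proof.
move=> H; have Ez := rule_data_cancelled H; case: H.
move=> Ts [v [T0 [r [w [[E1 E2] sep [hI hU] hm [E3 E4]]]]]].
have [ETs Ev] := iter_rem_parts E1 E2.
rewrite /rule Ez ETs Ev; split=> //; split=> //.
by exists T0, w, r; split=> //; rewrite -?hm.
Qed.

(** One known outcome is the only one, by determinism of insertion and of inverse insertion; a row
    determines its element. *)
Lemma data_of_rule l k (p : KR X n l \tens KR X n k) q z m b2' b1' l' k' m' :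
  rule_data p q z m -> rule p.1 p.2 b2' b1' l' k' m' ->
  [/\ q = (b2', b1'), l' = l - z, k' = k - z & m' = m].
Proof.
move=> H; have Ez := rule_data_cancelled H; case: H.
move=> Ts [v [T0 [r [w [[E1 E2] sep [hI hU] hm [E3 E4]]]]]].
have [ETs Ev] := iter_rem_parts E1 E2.
rewrite /rule Ez ETs Ev => -[-> [-> [T0' [w' [r' [hI' Em hU' E3' E4']]]]]].
have ET := insert_word_det n2 hI hI'; subst T0' m'.
have [Er Ew] := uninserts_det n2 hU hU'; subst w'.
have Er' : r = r'.
  have := congr1 reading Er; rewrite !reading_row_tableau.
  exact: (can_inj revK).
split=> //; rewrite [q]surjective_pairing; congr pair; apply: row_inj.
  by rewrite E3 E3' Er'.
by rewrite E4 E4'.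
Qed.

Section Fixed.
Variables (l k : nat).
Variable (iota : KR X n l \tens KR X n k -> KR X n k \tens KR X n l).
Hypothesis hiota : crystal_iso iota.
Variable (H : KR X n l \tens KR X n k -> int).
Hypothesis hH : energy_function iota H.
Hypothesis hH0 : energy_normalized H.
Implicit Type p : KR X n l \tens KR X n k.

(** The isomorphism preserves phi_1 and phi_2, and in [hw_wphi] the two lengths enter only through
    their sum. *)
Lemma iota_hw p m z : highest_weight p m z -> highest_weight (iota p) m z.
Proof.
move=> hp; have [h2 h1] := hw_wphi hp.
have [giso ge gf] := hiota.
have [m' [z' hq]] : exists m' z', highest_weight (iota p) m' z'.
  by apply: highest_weight_form => // i i0; rewrite ge (hw_e hp i0).
have [h2' h1'] := hw_wphi hq.
have wE i : 0 < i <= n -> wph i (word2 (iota p)) = wph i (word2 p).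
  case/andP=> i0 le_i; have hi : (inord i : 'I_n.+1) != ord0.
    by rewrite -val_eqE /= inordK // -lt0n.
  have := iso_phi (inord i) p hiota.
  rewrite (model_phi n2 (word2_model X n2 l k)) //.
  by rewrite (model_phi n2 (word2_model X n2 k l)) // inordK.
have r1' : 0 < 1 <= n by clear -n2; lia.
have r2' : 0 < 2 <= n by clear -n2; lia.
rewrite (wE _ r2') in h2'; rewrite (wE _ r1') in h1'.
have Em : m' = m by rewrite -h2 -h2'.
have Ez : z' = z by move: h1 h1'; rewrite Em; clear; lia.
by rewrite -Em -Ez.
Qed.

(** Nothing is computed at p itself: the outcome of the rule, its agreement with [iota], and the
    value of H all arrive along the arrows from p0. *)
Lemma generated p : exists m z p0,
  [/\ highest_weight p0 m z, rule_data p (iota p) z m & H p = H p0].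
Proof.
move: p; apply: (crystal_ind n2 (word2_model X n2 l k)) => [p he|i p p' i0 Ef].
  have [m [z hp]] := highest_weight_form n2 he.
  by exists m, z, p; split=> //; apply: (rule_data_highest n2 hp (iota_hw hp)).
move=> [m [z [p0 [hp0 hg hHp]]]]; exists m, z, p0; split=> //.
  have [q' Eq hg'] := rule_data_f n2 i0 hg Ef.
  by have [_ _ gf] := hiota; move: Eq; rewrite gf Ef => -[->].
move/cr_fe: Ef => Ee; have := hH Ee; rewrite energy_step_nonzero //.
by move/eqP; rewrite GRing.subr_eq0 => /eqP <-.
Qed.

(** * Arrows e_0 at highest weight elements and the values of H *)

Lemma hw_coords l0 k0 (p : KR X n l0 \tens KR X n k0) m z : highest_weight p m z ->
  [/\ forall c, coord p.1 c = (c == Pos 1) * l0,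
     coord p.2 (Pos 1) + (m + z) = k0, coord p.2 (Pos 2) = m,
     coord p.2 (Bar 1) = z &
     forall c, c \notin [:: Pos 1; Pos 2; Bar 1] -> coord p.2 c = 0].
Proof.
move=> [E1 [a E2] le_l].
have sa : a + (m + z) = k0.
  by have := size_row p.2; rewrite E2 !size_cat !size_nseq.
have cE c : coord p.2 c = (Pos 1 == c) * a + ((Pos 2 == c) * m + (Bar 1 == c) * z).
  by rewrite -row_count E2 !count_cat !count_nseq.
split.
- by move=> c; rewrite -row_count E1 count_nseq /= eq_sym.
- by rewrite cE /= mul1n addn0.
- by rewrite cE /= mul1n addn0.
- by rewrite cE /= mul1n.
move=> c; rewrite !inE !negb_or cE => /and3P[/negPf h1 /negPf h2 /negPf h3].
by rewrite !(eq_sym _ c) h1 h2 h3.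
Qed.

(** f_0 consumes a letter 1-bar or 2-bar, and 1^l has neither. Hence e_0 acts on the right factor
    whenever epsilon_0 is positive there. *)
Lemma hw_phi0 l0 k0 (p : KR X n l0 \tens KR X n k0) m z : highest_weight p m z ->
  phi (ord0 : 'I_n.+1) p.1 = 0.
Proof.
case/hw_coords=> h _ _ _ _; apply: string_length0.
by rewrite /= /kr_f /= !h /= move_None // h.
Qed.

Lemma hw_e0 l0 k0 (p : KR X n l0 \tens KR X n k0) m z : highest_weight p m z ->
  (0 < m) || (z < k0) -> exists b,
   [/\ cr_e (ord0 : 'I_n.+1) p.2 = Some b,
       0 < eps (ord0 : 'I_n.+1) p.2,
       cr_e (ord0 : 'I_n.+1) p = Some (p.1, b) &
       if 0 < m then move p.2 (Pos 2) (Bar 1) = Some b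
       else move p.2 (Pos 1) (Bar 2) = Some b].
Proof.
move=> hp hmz; have [c1 c2 c3 c4 c5] := hw_coords hp.
have B2 : coord p.2 (Bar 2) = 0 by apply: c5.
have n0 : 0 < n by clear -n2; lia.
have P1A : Pos 1 \in alphabet X n by rewrite mem_Pos; clear -n2; lia.
have P2A : Pos 2 \in alphabet X n by rewrite mem_Pos; clear -n2; lia.
have B1A : Bar 1 \in alphabet X n by rewrite mem_Bar; clear -n2; lia.
have B2A : Bar 2 \in alphabet X n by rewrite mem_Bar; clear -n2; lia.
have [b Eb] : exists b, (if 0 < m then move p.2 (Pos 2) (Bar 1)
       else move p.2 (Pos 1) (Bar 2)) = Some b.
  case: ifP hmz => [m0 _|m0 /= lt_z].
    apply: move_Some => //; first by rewrite c3.
    by move=> _ [En]; exfalso; move: n2; rewrite -En.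
  apply: move_Some => //; first by rewrite -(ltn_add2r (m + z)) add0n c2; case: (m) m0.
  by move=> _ [En]; exfalso; move: n2; rewrite -En.
have Ee : cr_e (ord0 : 'I_n.+1) p.2 = Some b.
  by rewrite /= /kr_e /= B2 c3.
have e0 : 0 < eps (ord0 : 'I_n.+1) p.2 by rewrite (eps_e Ee).
exists b; split=> //; last by case: ifP Eb.
have Ee' : kr_e (ord0 : 'I_n.+1) p.2 = Some b := Ee.
by rewrite /= /tensor_e (hw_phi0 hp) leqNgt e0 /= Ee'.
Qed.

(** The step is -1 if e_0 acts on the right factor of both p and [iota p]. As the factors of
    [iota p] are interchanged, z < l plays for it the role of z < k. *)
Lemma energy_drop p m z p' : highest_weight p m z -> z < l -> (0 < m) || (z < k) ->
  cr_e ord0 p = Some p' -> H p = (H p' + 1)%R.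
Proof.
move=> hp zl hmz Ee; have hq := iota_hw hp.
have [b [_ e0 _ _]] := hw_e0 hp hmz.
have [|b' [_ e0' _ _]] := hw_e0 hq; first by rewrite zl orbT.
have f0 : eps (ord0 : 'I_n.+1) p.2 <= 0 = false by rewrite leqNgt e0.
have E : energy_step iota ord0 p = (-1)%R.
  by rewrite /energy_step eqxx (hw_phi0 hp) (hw_phi0 hq) f0 e0 e0'.
have := hH Ee; rewrite {}E => E.
exact: int_drop E.
Qed.

(** Here e_0 turns a letter 2 into 1-bar and ends at a highest weight element. *)
Lemma hw_raise p m z : highest_weight p m.+1 z -> exists2 p', highest_weight p' m z.+1 &
  H p = (H p' + 1)%R.
Proof.
move=> hp; have [E1 [a E2] le_l] := hp; have [c1 c2 c3 c4 c5] := hw_coords hp.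
have [b [_ _ Ee Em]] := hw_e0 hp isT.
exists (p.1, b); last first.
  by apply: energy_drop hp _ _ Ee => //; move: le_l; clear; lia.
split=> //=; last by move: le_l; clear; lia.
exists (coord p.2 (Pos 1)); rewrite (@row_support _ _ n2 _ b).
  rewrite (move_coord_d n2 Em) // (move_coord_u n2 Em) // !(move_coord n2 Em) //.
  by rewrite c3 c4 (c5 (Bar 2)).
move=> c; rewrite !inE !negb_or => /and4P[h1 h2 h3 h4].
by rewrite (move_coord n2 Em) // c5 // !inE !negb_or h1 h2 h4.
Qed.

(** Without letters 2, e_0 turns a 1 into 2-bar, and the result is no longer of highest weight. Its
    component is recognized by running the insertion: z is unchanged, and the single 2-bar alone
    reaches the second row, so m = 1. *)
Lemma hw_raise0 p z : highest_weight p 0 z -> z < l -> z < k -> exists2 p', highest_weight p' 1 z &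
  H p = (H p' + 1)%R.
Proof.
move=> hp zl zk; have [E1 _ _] := hp; have [c1 c2 c3 c4 c5] := hw_coords hp.
have [|b [_ _ Ee Em]] := hw_e0 hp; first by rewrite zk orbT.
have Hd : H p = (H (p.1, b) + 1)%R.
  by apply: energy_drop hp zl _ Ee; rewrite zk orbT.
have [m [z' [p0 [hp0 hg Hp0]]]] := generated (p.1, b).
have Eb : row b = nseq (coord p.2 (Pos 1)).-1 (Pos 1) ++ [:: Bar 2] ++ nseq z (Bar 1).
  rewrite (@row_support _ _ n2 _ b).
    rewrite (move_coord_d n2 Em) // (move_coord_u n2 Em) // !(move_coord n2 Em) //.
    by rewrite c3 c4 (c5 (Bar 2)).
  move=> c; rewrite !inE !negb_or => /and4P[h1 h2 h3 h4].
  by rewrite (move_coord n2 Em) // c5 // !inE !negb_or h1 h2 h4.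
have Ez : z' = z.
  have := rule_data_cancelled hg; rewrite /cancelled /= E1 Eb.
  rewrite !count_cat !count_nseq /=.
  by move: zl; clear; lia.
subst z'; case: hg => Ts [v [T0 [r [w [[F1 F2] _ [hI _] hm _]]]]].
have [E3 E4] := iter_rem_parts F1 F2.
have [B2A yb] := mem_Bar2 X n2.
have [G1 G2] : row (p.1, b).1 = nseq z (Pos 1) ++ nseq (l - z) (Pos 1) /\
   row (p.1, b).2 = (nseq (coord p.2 (Pos 1)).-1 (Pos 1) ++ nseq 1 (Bar 2)) ++ nseq z (Bar 1).
  by rewrite /= E1 -nseqD subnKC ?(ltnW zl) // Eb -catA.
have [E3' E4'] := iter_rem_parts G1 G2.
rewrite -E3 -E4 E3' E4' in hI.
have l1 : 1 <= l - z by rewrite subn_gt0.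
have := insert_word_det n2 hI (insert_word_one_y n2 B2A yb _ l1).
move=> ET; rewrite ET row2_length_one_y in hm; subst m.
by exists p0 => //; rewrite Hd Hp0.
Qed.

(** The element that fixes the normalization has [minn l k] cancelled pairs, which leaves m = 0, so
    it lies in the component of p. It is p itself if k <= l, and not of highest weight if k > l. *)
Lemma energy_base p z : highest_weight p 0 z -> z = minn l k -> H p = 0%R.
Proof.
move=> hp Ez; have [c1 _ _ _ _] := hw_coords hp.
have B1A : Bar 1 \in alphabet X n by rewrite mem_Bar; clear -n2; lia.
have [|||b Eb] := @kr_elt_exists X n k (fun c => (c == Bar 1) * k).
- rewrite (bigD1_seq (Bar 1)) ?alphabet_uniq //= ?eqxx ?mul1n.
  by rewrite big1 ?addn0 // => c /negPf ->.
- by case: (X).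
- by clear -n2; lia.
have Cb : concentrated b (Bar 1).
  move=> c; have [cA|cA] := boolP (c \in alphabet X n).
    by rewrite Eb //; case: eqP => _; rewrite ?mul1n.
  rewrite coord_notin //; case: eqP => // Ec; by rewrite Ec B1A in cA.
have C1 : concentrated p.1 (Pos 1).
  by move=> c; rewrite c1; case: eqP => _; rewrite ?mul1n.
have [m [z' [p0 [hp0 hg Hp0]]]] := generated (p.1, b).
have Ez' : z' = minn l k.
  by rewrite -(rule_data_cancelled hg) /cancelled /= !row_count C1 Cb !eqxx.
have Em : m = 0.
  have [_ h _ _ _] := hw_coords hp0; have [_ _ h'] := hp0.
  by move: h h' Ez'; clear; lia.
rewrite (_ : p = p0) -?Hp0; first exact: hH0.
by apply: (hw_inj hp); rewrite Ez -Ez' -Em.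
Qed.

Lemma energy_hw p m z : highest_weight p m z -> H p = ((2 * (minn l k - z))%:Z - m%:Z)%R.
Proof.
have [N] := ubnP (minn l k - z); elim: N m z p => // N IH m z p lt_N hp.
have zle : z + m <= minn l k.
  have [_ h _ _ _] := hw_coords hp; have [_ _ h'] := hp.
  by move: h h'; clear; lia.
(* Positive m is isolated because m = 0 leads to (1, z), which has the same z and so is outside the
   induction hypothesis; one more arrow then raises z. *)
have pos m0 p0 : highest_weight p0 m0.+1 z -> z + m0.+1 <= minn l k ->
    H p0 = ((2 * (minn l k - z))%:Z - m0.+1%:Z)%R.
  move=> hp0 zle0; have [p' hp' ->] := hw_raise hp0.
  rewrite (IH _ _ _ _ hp'); first by move: zle0; clear; lia.
  by move: lt_N zle0; clear; lia.
case: m hp zle => [|m] hp zle; last exact: pos.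
have [Ez|nz] := eqVneq z (minn l k).
  by rewrite (energy_base hp Ez) Ez; clear; lia.
have [zl zk] : z < l /\ z < k by move: zle nz; clear; lia.
have [p' hp' ->] := hw_raise0 hp zl zk.
rewrite (pos _ _ hp'); last by move: zl zk; clear; lia.
by clear; lia.
Qed.

Lemma energy_rule_data p q z m : rule_data p q z m -> q = iota p /\
  H p = ((2 * minn (l - z) (k - z))%:Z - m%:Z)%R.
Proof.
have [m0 [z0 [p0 [hp0 hg0 Hp0]]]] := generated p; move=> hg.
have [-> Ez Ek Em] := data_of_rule hg (rule_of_data hg0).
have Ez0 : z0 = z by rewrite -(rule_data_cancelled hg) -(rule_data_cancelled hg0).
split; first by rewrite [RHS]surjective_pairing.
by rewrite Hp0 (energy_hw hp0) -Em Ez0; clear; lia.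
Qed.

End Fixed.
End Final.

Theorem theorem4p12 (X : affine_type) (n l k : nat)
  (hn : min_rank X <= n) (hl : 1 <= l) (hk : 1 <= k)
  (iota : KR X n l \tens KR X n k -> KR X n k \tens KR X n l)
  (hiota : crystal_iso iota)
  (H : KR X n l \tens KR X n k -> int)
  (hH : energy_function iota H) (hH0 : energy_normalized H)
  (b1 : KR X n l) (b2 : KR X n k) :
  (exists b2' b1' l' k' m, rule b1 b2 b2' b1' l' k' m) /\
  (forall b2' b1' l' k' m, rule b1 b2 b2' b1' l' k' m ->
     iota (b1, b2) = (b2', b1') /\
     H (b1, b2) = ((2 * minn l' k')%:Z - m%:Z)%R).
Proof.
have n2 : 2 < n by move: hn; clear; case: X => //; exact: ltnW.
have [m [z [p0 [_ hg _]]]] := generated n2 hiota hH (b1, b2).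
have hr := rule_of_data n2 hg; split.
  by exists (iota (b1, b2)).1, (iota (b1, b2)).2, (l - z), (k - z), m.
move=> b2' b1' l' k' m' /(data_of_rule n2 hg)[-> -> -> ->]; split=> //.
by have [_ ->] := energy_rule_data n2 hiota hH hH0 hg.
Qed.
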